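(* Let $\ell\in\mathbb{Z}_+$ and let $g:\boldsymbol{\Omega}_\ell\to\mathbb{R}$ belong to the class $\mathcal{L}$. (a) For $\mathbb{P}$-a.e. $\omega$ and simultaneously for all $\zeta\in\mathcal{U}$ the limit $$\Lambda_\ell(g,\zeta;\omega)=\lim_{n\to\infty}n^{-1}\log E\Big[e^{\sum_{k=0}^{n-1}g(T_{X_k}\omega,\,Z_{k+1,k+\ell})}\mathbf{1}\{X_n=\hat x_n(\zeta)\}\Big]$$ exists in $(-\infty,\infty]$. For a particular $\zeta$ the limit is independent of the choice of the convex representation $\zeta=\sum_{z\in\mathcal{R}}\beta_z z$ and of the numbers $b_z^{(n)}$ that define $\hat x_n(\zeta)$. (b) The limit $$\Lambda_\ell(g;\omega)=\lim_{n\to\infty}n^{-1}\log E\Big[e^{\sum_{k=0}^{n-1}g(T_{X_k}\omega,\,Z_{k+1,k+\ell})}\Big]$$ exists $\mathbb{P}$-a.s. in $(-\infty,\infty]$ and satisfies ($\mathbb{P}$-a.s.) $$\Lambda_\ell(g;\omega)=\sup_{\xi\in\mathbb{Q}^d\cap\,\mathcal{U}}\Lambda_\ell(g,\xi;\omega)=\sup_{\zeta\in\mathcal{U}}\Lambda_\ell(g,\zeta;\omega).$$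
   Context: Fix $d\in\mathbb{N}$ and a finite nonempty set $\mathcal{R}\subset\mathbb{Z}^d$. Let $\mathcal{G}=\{\sum_{z\in\mathcal{R}}a_z z: a_z\in\mathbb{Z}\}$ be the additive group generated by $\mathcal{R}$ and let $\mathcal{U}$ be the convex hull of $\mathcal{R}$ in $\mathbb{R}^d$. $P$ (expectation $E$) is the law of the random walk $(X_k)_{k\ge 0}$ on $\mathbb{Z}^d$ with $X_0=0$ and i.i.d. steps $Z_k=X_k-X_{k-1}$ uniformly distributed on $\mathcal{R}$; $Z_{i,j}=(Z_i,\dots,Z_j)$. $E$ averages over the walk only, with $\omega$ fixed. $(\Omega,\mathfrak{S},\mathbb{P},\{T_z:z\in\mathcal{G}\})$ is a measurable dynamical system: $(\Omega,\mathfrak S,\mathbb P)$ is a probability space, the $T_z$ are measurable commuting transformations of $\Omega$ with $T_{x+y}=T_xT_y$ and $T_0$ the identity, and $\mathbb{P}$ is invariant under all $T_z$. (No ergodicity is assumed.) $\boldsymbol{\Omega}_\ell=\Omega\times\mathcal{R}^\ell$, with $\boldsymbol{\Omega}_0=\Omega$. A measurable function $g:\boldsymbol{\Omega}_\ell\to\mathbb{R}$ is in class $\mathcal{L}$ if for each $\tilde z_{1,\ell}\in\mathcal{R}^\ell$: $g(\cdot,\tilde z_{1,\ell})\in L^1(\mathbb{P})$, and for every nonzero $z\in\mathcal{R}$, $$\varlimsup_{\varepsilon\searrow0}\varlimsup_{n\to\infty}\max_{x\in\mathcal{G}:|x|\le n}\frac1n\sum_{0\le k\le\varepsilon n}|g(T_{x+kz}\omega,\tilde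 z_{1,\ell})|=0\quad\text{for }\mathbb{P}\text{-a.e. }\omega.$$ Lattice points $\hat x_n(\zeta)$: for each $\zeta\in\mathcal{U}$ fix weights $\beta_z(\zeta)\in[0,1]$, $z\in\mathcal{R}$, with $\sum_z\beta_z(\zeta)=1$ and $\zeta=\sum_{z}\beta_z(\zeta)z$; when $\zeta\in\mathcal{U}\cap\mathbb{Q}^d$ the weights are required to be rational. Then $$\hat x_n(\zeta)=\sum_{z\in\mathcal{R}}\big(\lfloor n\beta_z(\zeta)\rfloor+b_z^{(n)}(\zeta)\big)z,\quad n\in\mathbb{Z}_+,$$ where $b_z^{(n)}(\zeta)\in\{0,1\}$ are arbitrary subject to: $b_z^{(n)}(\zeta)=0$ if $\beta_z(\zeta)=0$, and $\sum_z b_z^{(n)}(\zeta)=n-\sum_z\lfloor n\beta_z(\zeta)\rfloor$. *)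

(* Defs.v *)
From HB Require Import structures.
From mathcomp Require Export all_boot all_order all_algebra finmap.
From mathcomp Require Export all_classical all_reals all_analysis.

Set Implicit Arguments.
Unset Strict Implicit.
Unset Printing Implicit Defensive.

Import Order.TTheory GRing.Theory Num.Theory.
Export numFieldNormedType.Exports.

Local Open Scope classical_set_scope.
Local Open Scope ring_scope.

(* The finite step set is [steps]; the coercion of [steps] to a type is used throughout,
   so that [z : steps] is a step and [val z] the corresponding point of Z^d. *)

Definition lattice_span (d : nat) (steps : {fset 'rV[int]_d}) : set 'rV[int]_d :=
  [set x | exists a : steps -> int, x = \sum_(z : steps) a z *: val z].

Definition real_point (R : realType) (d : nat) (x : 'rV[int]_d) : 'rV[R]_d :=
  map_mx (intr : int -> R) x.

Definition convex_weights (R : realType) (d : nat) (steps : {fset 'rV[int]_d})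
    (zeta : 'rV[R]_d) (beta : steps -> R) : Prop :=
  [/\ forall z, 0 <= beta z <= 1,
      \sum_(z : steps) beta z = 1
    & zeta = \sum_(z : steps) beta z *: real_point R (val z)].

Definition step_hull (R : realType) (d : nat) (steps : {fset 'rV[int]_d}) :
    set 'rV[R]_d :=
  [set zeta | exists beta : steps -> R, convex_weights zeta beta].

Arguments step_hull R {d} steps _.

Definition rational_point (R : realType) (d : nat) : set 'rV[R]_d :=
  [set zeta | forall i, rational (zeta ord0 i)].

Arguments rational_point R {d} _.

Definition admissible_weights (R : realType) (d : nat) (steps : {fset 'rV[int]_d})
    (zeta : 'rV[R]_d) (beta : steps -> R) : Prop :=
  convex_weights zeta beta /\
  (rational_point R zeta -> forall z, rational (beta z)).

Definition admissible_rounding (R : realType) (d : nat)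
    (steps : {fset 'rV[int]_d}) (beta : steps -> R) (b : nat -> steps -> bool) : Prop :=
  forall n,
    (forall z, beta z = 0 -> b n z = false) /\
    \sum_(z : steps) (b n z)%:Z =
      n%:Z - \sum_(z : steps) Num.floor (n%:R * beta z).

Definition xhat (R : realType) (d : nat) (steps : {fset 'rV[int]_d})
    (beta : steps -> R) (b : nat -> steps -> bool) (n : nat) : 'rV[int]_d :=
  \sum_(z : steps) (Num.floor (n%:R * beta z) + (b n z)%:Z) *: val z.

(* [Z k] is the increment X_(k+1) - X_k, i.e. the (k+1)-st step of the walk. *)
Definition iid_uniform_steps (R : realType) (d : nat) (steps : {fset 'rV[int]_d})
    (dW : measure_display) (W : measurableType dW) (Q : probability W R)
    (Z : nat -> W -> steps) : Prop :=
  [/\ forall k (A : set steps), measurable (Z k @^-1` A),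
      forall k (z : steps), Q (Z k @^-1` [set z]) = ((#|{: steps}|%:R)^-1)%:E
    & forall (J : {fset nat}) (A : nat -> set steps),
        Q (\bigcap_(i in [set` J]) Z i @^-1` A i) =
          (\prod_(i <- J) Q (Z i @^-1` A i))%E].

Definition walk (d : nat) (steps : {fset 'rV[int]_d}) (W : Type)
    (Z : nat -> W -> steps) (k : nat) (w : W) : 'rV[int]_d :=
  \sum_(i < k) val (Z i w).

(* With the indexing above this is (Z_{k+1}, ..., Z_{k+ell}). *)
Definition step_window (d : nat) (steps : {fset 'rV[int]_d}) (W : Type)
    (Z : nat -> W -> steps) (ell k : nat) (w : W) : ell.-tuple steps :=
  [tuple Z (k + i)%N w | i < ell].

Definition measurable_dynamical_system (R : realType) (d : nat)
    (steps : {fset 'rV[int]_d}) (dO : measure_display) (Omega : measurableType dO)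
    (P : probability Omega R) (T : 'rV[int]_d -> Omega -> Omega) : Prop :=
  [/\ forall x, lattice_span steps x -> measurable_fun [set: Omega] (T x),
      T 0 = id,
      forall x y, lattice_span steps x -> lattice_span steps y ->
        T (x + y) = T x \o T y
    & forall x, lattice_span steps x ->
        forall A, measurable A -> P (T x @^-1` A) = P A].

Definition euclidean_norm (R : realType) (d : nat) (x : 'rV[int]_d) : R :=
  Num.sqrt (\sum_i (x ord0 i)%:~R ^+ 2).

(* Joint measurability of [g] on Omega x steps^ell (steps^ell finite and discrete)
   amounts to measurability of all sections, which is part of integrability. *)
Definition class_L (R : realType) (d : nat) (steps : {fset 'rV[int]_d})
    (dO : measure_display) (Omega : measurableType dO)
    (P : probability Omega R) (T : 'rV[int]_d -> Omega -> Omega) (ell : nat)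
    (g : Omega -> ell.-tuple steps -> R) : Prop :=
  forall zt : ell.-tuple steps,
    P.-integrable [set: Omega] (fun omega => (g omega zt)%:E) /\
    forall z : steps, val z != 0 ->
      {ae P, forall omega,
        limf_esup (fun eps : R =>
          limn_esup (fun n : nat =>
            ereal_sup
              [set (n%:R^-1 * \sum_(0 <= k < (Num.truncn (eps * n%:R)).+1)
                     `|g (T (x + val z *+ k) omega) zt|)%:E
              | x in [set x | lattice_span steps x /\
                              euclidean_norm R x <= n%:R]]))
          0^'+ = 0%E}.

Section FreeEnergy.
Context (R : realType) (d : nat) (steps : {fset 'rV[int]_d}).
Context (dW : measure_display) (W : measurableType dW) (Q : probability W R).
Context (Z : nat -> W -> steps) (Omega : Type).
Context (T : 'rV[int]_d -> Omega -> Omega) (ell : nat).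
Context (g : Omega -> ell.-tuple steps -> R).

Definition energy (omega : Omega) (n : nat) (w : W) : R :=
  \sum_(k < n) g (T (walk Z k w) omega) (step_window Z ell k w).

(* [lne] is the extended logarithm, with [lne 0 = -oo]. *)
Definition p2l_seq (omega : Omega) (n : nat) : \bar R :=
  ((n%:R^-1)%:E * lne 'E_Q[(fun w => expR (energy omega n w))%R])%E.

Definition p2p_seq (omega : Omega) (beta : steps -> R) (b : nat -> steps -> bool)
    (n : nat) : \bar R :=
  ((n%:R^-1)%:E *
   lne 'E_Q[(fun w => expR (energy omega n w) *
                      \1_[set w | walk Z n w = xhat beta b n] w)%R])%E.

Definition Lambda_p2l (omega : Omega) : \bar R :=
  limn (p2l_seq omega).

Definition Lambda_p2p (beta : 'rV[R]_d -> steps -> R)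
    (b : 'rV[R]_d -> nat -> steps -> bool) (zeta : 'rV[R]_d) (omega : Omega) :
    \bar R :=
  limn (p2p_seq omega (beta zeta) (b zeta)).

End FreeEnergy.

(* Main.v *)
Require Import Defs.
From HB Require Import structures.
From mathcomp Require Import all_boot all_order all_algebra finmap.
From mathcomp Require Import all_classical all_reals all_analysis.
From mathcomp Require Import measurable_realfun ring lra zify.
Import Order.TTheory GRing.Theory Num.Theory.
Import numFieldNormedType.Exports.
Local Open Scope classical_set_scope.
Local Open Scope ring_scope.
Set Implicit Arguments.
Unset Strict Implicit.
Unset Printing Implicit Defensive.

(** Write Z_n(x) for the expectation of the exponential weight over the walks of n
    steps that end at x. Up to a factor exp(o(n)) it equals a sum over paths,
    [path_sum], in which the windows that reach beyond the end of the path are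
    replaced by the least value that the potential can take there. With this
    convention concatenation of paths loses no energy, so Z_m(x) Z_n(y; started from
    x) <= Z_(m+n)(x + y). Along the multiples j c of one integer vector c of step
    counts, ln Z is therefore a superadditive process over the single measure
    preserving map T_y, y the endpoint of c, and has an almost sure rate in (-oo,
    +oo] by a superadditive ergodic theorem without ergodicity
    ([superadditive_ergodic]): a maximal inequality obtained from a greedy covering
    of the orbit shows that a limsup above q forces a liminf of at least q, and
    integrability of g bounds the process from below. There are countably many
    vectors c, so one null set serves all of them ([ray_limit_ae]).

    Everything else is deterministic and takes place in one environment. Class L says
    that a segment of eps n sites in the direction of a nonzero step costs at most
    delta n, uniformly over starting points at distance of order n
    ([tame_environment]). Hence a path can be prolonged by eps n steps, arranged as
    one segment per direction, at negligible cost ([path_sum_long_bridge]); steps equal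
    to 0 would visit one site too often and are spread along another segment
    ([lace]). For arbitrary weights beta, the counts that follow n beta lie between
    multiples (1 - eta) n and (1 + eta) n of a rational approximation of beta, and the
    two differences are such prolongations. So the rate along beta is squeezed
    between (1 - eta) and (1 + eta) times a rate that is known to exist
    ([log_sum_rate_cvg]).

    If two weights have the same barycenter, the endpoints of the two count sequences
    stay at bounded distance, their difference takes finitely many values, and a
    pigeonhole argument provides words of bounded length that lead from one endpoint
    to the other ([tracks_bridge]). So the rate depends on the barycenter only
    ([log_sum_rate_unique]).

    For the free endpoint, the sum over all paths is at most a polynomial in n times
    Z_n at the endpoint of one count vector a ([free_path_sum_le]). This vector varies
    with n, but after rounding up on a grid of mesh n / k it is a multiple of one of
    finitely many integer vectors. The known rates of these, which are rates at
    rational points, bound the free energy from above ([free_end_upper]). *)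

(** * Birkhoff sums and the maximal inequality *)

(** Scan the times from left to right: at a time in A jump over the window that
    witnesses it and gain c times its length, elsewhere move by one and gain at least
    0. Every time in A that is visited or jumped over is paid for, except in a last
    window of length at most N. The same statement gives the maximal inequality, with
    F the Birkhoff sums, and the lower bound for superadditive processes. *)
Lemma greedy_cover (R : realType) (F : nat -> nat -> R) (A : pred nat) (c : R)
    (N : nat) :
  0 <= c -> (forall i n, 0 <= F i n) ->
  (forall i m n, F i m + F (i + m)%N n <= F i (m + n)%N) ->
  (forall i, A i -> exists l, (0 < l <= N)%N /\ c * l%:R <= F i l) ->
  forall n i, c * (\sum_(k < n) (A (i + k)%N)%:R) - c * N%:R <= F i n.
Proof.
move=> c0 F0 Fsup HA n.
elim/ltn_ind: n => n IH i.
have [nN|Nn] := leqP n N.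
  apply: le_trans (F0 i n); rewrite -mulrBr mulr_ge0_le0// subr_le0.
  apply: (@le_trans _ _ (\sum_(k < n) 1)).
    by apply: ler_sum => k _; case: (A _).
  by rewrite sumr_const card_ord ler_nat.
have step l : (0 < l <= n)%N -> c * (\sum_(k < l) (A (i + k)%N)%:R) <= F i l ->
    c * (\sum_(k < n) (A (i + k)%N)%:R) - c * N%:R <= F i n.
  move=> /andP[l0 ln] Hl.
  have nlt : (n - l < n)%N by rewrite ltn_subrL l0 (leq_trans l0 ln).
  have := IH _ nlt (i + l)%N.
  have := Fsup i l (n - l)%N; rewrite subnKC //.
  have -> : \sum_(k < n) (A (i + k)%N)%:R =
    \sum_(k < l) (A (i + k)%N)%:R + \sum_(k < n - l) (A (i + l + k)%N)%:R :> R.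
    have [p ->] : exists p, n = (l + p)%N by exists (n - l)%N; rewrite subnKC.
    rewrite big_split_ord /= addKn; congr (_ + _).
    by apply: eq_bigr => k _; rewrite addnA.
  rewrite mulrDr; lra.
have [Ai|nAi] := boolP (A i).
  have [l [/andP[l0 lN] Hl]] := HA _ Ai.
  apply: (step l); first by rewrite l0 (leq_trans lN (ltnW Nn)).
  apply: le_trans Hl; apply: ler_wpM2l => //.
  apply: (@le_trans _ _ (\sum_(k < l) 1)).
    by apply: ler_sum => k _; case: (A _).
  by rewrite sumr_const card_ord.
apply: (step 1%N); first exact: leq_ltn_trans Nn.
by rewrite big_ord1 addn0 (negbTE nAi) mulr0.
Qed.

Lemma le0_of_bounded_multiples (R : realType) (a b : R) :
  (forall n : nat, n%:R * a <= b) -> a <= 0.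
Proof.
move=> H; rewrite leNgt; apply/negP => a0.
have := H (Num.truncn (b / a)).+1; apply/negP; rewrite -ltNge.
rewrite -ltr_pdivrMr//; exact: truncnS_gt.
Qed.

Section Ergodic.
Context (R : realType) (d : measure_display) (Omega : measurableType d).
Context (P : probability Omega R) (tau : Omega -> Omega).
Hypothesis mtau : measurable_fun [set: Omega] tau.
Hypothesis ptau : forall A, measurable A -> P (tau @^-1` A) = P A.

Lemma measurable_iter n : measurable_fun [set: Omega] (iter n tau).
Proof.
elim: n => [|n IH]; first exact: measurable_id.
exact: (measurableT_comp mtau IH).
Qed.

Lemma iter_preserving n (A : set Omega) :
  measurable A -> P (iter n tau @^-1` A) = P A.
Proof.
elim: n A => [|n IH] A mA //.
have -> : iter n.+1 tau @^-1` A = iter n tau @^-1` (tau @^-1` A) by [].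
rewrite IH ?ptau//; rewrite -[_ @^-1` _]setTI; exact: mtau.
Qed.

Lemma integral_iter n (h : Omega -> \bar R) :
  measurable_fun [set: Omega] h -> (forall w, 0 <= h w)%E ->
  (\int[P]_w h (iter n tau w) = \int[P]_w h w)%E.
Proof.
move=> mh h0.
have mi := measurable_iter n.
have := ge0_integral_pushforward mi P measurableT mh (fun y _ => h0 y).
rewrite preimage_setT => <-.
apply: eq_measure_integral => A mA _.
exact: iter_preserving.
Qed.

Definition birkhoff_sum (h : Omega -> R) (n : nat) (w : Omega) : R :=
  \sum_(k < n) h (iter k tau w).

Lemma birkhoff_sumD (h : Omega -> R) w m n :
  birkhoff_sum h (m + n) w = birkhoff_sum h m w + birkhoff_sum h n (iter m tau w).
Proof.
rewrite /birkhoff_sum big_split_ord /=; congr (_ + _).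
by apply: eq_bigr => k _; rewrite addnC iterD.
Qed.

Lemma measurable_birkhoff_sum (h : Omega -> R) n : measurable_fun [set: Omega] h ->
  measurable_fun [set: Omega] (birkhoff_sum h n).
Proof.
move=> mh; apply: measurable_sum => k.
exact: (measurableT_comp mh (measurable_iter k)).
Qed.

Lemma integral_birkhoff_sum (h : Omega -> R) n : measurable_fun [set: Omega] h ->
  (forall w, 0 <= h w) ->
  (\int[P]_w (birkhoff_sum h n w)%:E = n%:R%:E * \int[P]_w (h w)%:E)%E.
Proof.
move=> mh h0; rewrite /birkhoff_sum.
under eq_integral do rewrite -sumEFin.
rewrite ge0_integral_sum//; last 2 first.
- move=> k; apply/measurable_EFinP.
  exact: (measurableT_comp mh (measurable_iter k)).
- by move=> k x _; rewrite lee_fin.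
under eq_bigr => k _.
  rewrite (integral_iter k (h := fun w => (h w)%:E)); last 2 first.
  - exact/measurable_EFinP.
  - by move=> w; rewrite lee_fin.
  over.
rewrite sumr_const card_ord.
by rewrite mule_natl.
Qed.

End Ergodic.

Section Maximal.
Context (R : realType) (d : measure_display) (Omega : measurableType d).
Context (P : probability Omega R) (tau : Omega -> Omega).
Hypothesis mtau : measurable_fun [set: Omega] tau.
Hypothesis ptau : forall A, measurable A -> P (tau @^-1` A) = P A.
Variable h : Omega -> R.
Hypothesis mh : measurable_fun [set: Omega] h.
Hypothesis h0 : forall w, 0 <= h w.

Let level (lam : R) (L : nat) : set Omega :=
  [set w | exists l, (0 < l <= L)%N /\ lam * l%:R <= birkhoff_sum tau h l w].

Let measurable_level lam L : measurable (level lam L).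
Proof.
have -> : level lam L = \bigcup_(l in [set l | (0 < l <= L)%N])
    (birkhoff_sum tau h l @^-1` `[lam * l%:R, +oo[).
  apply/seteqP; split => [w [l [lL Hl]]|w [l lL]] /=.
    by exists l => //=; rewrite in_itv/= andbT.
  by rewrite in_itv/= andbT => Hl; exists l.
apply: bigcup_measurable => l _; rewrite -[_ @^-1` _]setTI.
exact: (measurable_birkhoff_sum mtau).
Qed.

Let birkhoff_sum_ge0 (f : Omega -> R) n w : (forall w, 0 <= f w) ->
  0 <= birkhoff_sum tau f n w.
Proof. by move=> f0; apply: sumr_ge0. Qed.

(** Integrating the greedy covering bound over n shifts gives
    n (lam P(level) - E h) <= lam L for every n. *)
Let maximal_finite (lam : R) (L : nat) : 0 <= lam ->
  (lam%:E * P (level lam L) <= \int[P]_w (h w)%:E)%E.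
Proof.
move=> lam0; set E := level lam L.
have mE : measurable E := measurable_level lam L.
have ge n w : lam * birkhoff_sum tau \1_E n w <=
    birkhoff_sum tau h n w + lam * L%:R.
  rewrite -lerBlDr.
  pose F (i n : nat) : R := birkhoff_sum tau h n (iter i tau w).
  have -> : birkhoff_sum tau \1_E n w =
      \sum_(k < n) (iter (0 + k) tau w \in E)%:R :> R.
    by rewrite /birkhoff_sum; apply: eq_bigr => k _; rewrite indicE add0n.
  apply: (@greedy_cover R F (fun i => iter i tau w \in E)) => //.
  - by move=> i m; apply: birkhoff_sum_ge0.
  - by move=> i m p; rewrite /F birkhoff_sumD -iterD addnC.
  - by move=> i /set_mem [l Hl]; exists l.
have int n : (n%:R%:E * (lam%:E * P E) <=
     n%:R%:E * (\int[P]_w (h w)%:E) + (lam * L%:R)%:E)%E.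
  have := @ge0_le_integral _ _ _ P _ measurableT
    (fun w => (lam * birkhoff_sum tau \1_E n w)%:E)
    (fun w => (birkhoff_sum tau h n w + lam * L%:R)%:E).
  have m1 : measurable_fun [set: Omega] (birkhoff_sum tau \1_E n : Omega -> R).
    by apply: (measurable_birkhoff_sum mtau); exact: measurable_indic.
  have m2 : measurable_fun [set: Omega] (birkhoff_sum tau h n).
    exact: (measurable_birkhoff_sum mtau).
  have i0 w : 0 <= \1_E w :> R by [].
  have H1 : (\int[P]_w (lam * birkhoff_sum tau \1_E n w)%:E =
      n%:R%:E * (lam%:E * P E))%E.
    under eq_integral do rewrite EFinM.
    rewrite ge0_integralZl//; last 2 first.
    - exact/measurable_EFinP.
    - by move=> w _; rewrite lee_fin birkhoff_sum_ge0.
    rewrite (integral_birkhoff_sum mtau ptau)//.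
    by rewrite integral_indic// setIT muleCA.
  have H2 : (\int[P]_w (birkhoff_sum tau h n w + lam * L%:R)%:E =
     n%:R%:E * (\int[P]_w (h w)%:E) + (lam * L%:R)%:E)%E.
    under eq_integral do rewrite EFinD.
    rewrite ge0_integralD//; last 3 first.
    - by move=> w _; rewrite lee_fin birkhoff_sum_ge0.
    - exact/measurable_EFinP.
    - by move=> w _; rewrite lee_fin mulr_ge0.
    rewrite (integral_birkhoff_sum mtau ptau)// integral_cst//.
    have PT : (P [set: Omega] = 1)%E by exact: probability_setT.
    by rewrite [X in (_ + _ * X)%E]PT mule1.
  rewrite H1 H2; apply.
  - by move=> w _; rewrite lee_fin mulr_ge0// birkhoff_sum_ge0.
  - apply/measurable_EFinP; exact: measurable_funM.
  - apply/measurable_EFinP; exact: measurable_funD.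
  - by move=> w _; rewrite lee_fin.
have I0 : (0 <= \int[P]_w (h w)%:E)%E.
  by apply: integral_ge0 => w _; rewrite lee_fin.
have [->|Ifin] := eqVneq (\int[P]_w (h w)%:E)%E +oo%E; first by rewrite leey.
have {}Ifin : (\int[P]_w (h w)%:E)%E \is a fin_num.
  by rewrite ge0_fin_numE// ltey.
have Pfin : P E \is a fin_num by exact: fin_num_measure.
move: int; rewrite -(fineK Ifin) -(fineK Pfin) => int.
rewrite -EFinM lee_fin -subr_le0.
apply: (@le0_of_bounded_multiples _ _ (lam * L%:R)) => n.
have := int n; rewrite -!EFinM -EFinD lee_fin mulrBr.
by rewrite lerBlDl.
Qed.

Lemma maximal_inequality (lam : R) : 0 <= lam ->
  (lam%:E * P [set w | exists l, (0 < l)%N /\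
                 (lam * l%:R <= birkhoff_sum tau h l w)%R]
   <= \int[P]_w (h w)%:E)%E.
Proof.
move=> lam0.
have -> : [set w | exists l, (0 < l)%N /\ lam * l%:R <= birkhoff_sum tau h l w]
    = \bigcup_L level lam L.
  apply/seteqP; split => [w [l [l0 Hl]]|w [L _ [l [/andP[l0 _] Hl]]]].
    by exists l => //; exists l; rewrite l0 leqnn.
  by exists l.
have cvgP : P (level lam n) @[n --> \oo] --> P (\bigcup_L level lam L).
  apply: nondecreasing_cvg_mu => //; first exact: bigcup_measurable.
  move=> m n mn; apply/subsetPset => w [l [/andP[l0 lm] Hl]].
  by exists l; rewrite l0 (leq_trans lm).
have cvgP' : (lam%:E * P (level lam n) @[n --> \oo] -->
    lam%:E * P (\bigcup_L level lam L))%E by exact: cvgeZl.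
rewrite -(cvg_lim _ cvgP')//.
apply: lime_le; first by apply/cvg_ex; eexists; exact: cvgP'.
by apply: nearW => n; exact: maximal_finite.
Qed.

Lemma measurable_birkhoff_exceed (lam : R) :
  measurable [set w | exists l, (0 < l)%N /\ lam * l%:R <= birkhoff_sum tau h l w].
Proof.
have -> : [set w | exists l, (0 < l)%N /\ lam * l%:R <= birkhoff_sum tau h l w]
    = \bigcup_L level lam L.
  apply/seteqP; split => [w [l [l0 Hl]]|w [L _ [l [/andP[l0 _] Hl]]]].
    by exists l => //; exists l; rewrite l0 leqnn.
  by exists l.
exact: bigcup_measurable.
Qed.

End Maximal.

(** * A superadditive ergodic theorem without ergodicity *)

Lemma ae_forall_countable (R : realType) (d : measure_display)
    (T : measurableType d) (mu : measure T R) (I : countType)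
    (Q : I -> T -> Prop) :
  (forall i, {ae mu, forall x, Q i x}) -> {ae mu, forall x, forall i, Q i x}.
Proof.
move=> H.
have : {ae mu, forall x, forall n : nat,
    if choice.unpickle n is Some i then Q i x else True}.
  apply: ae_foralln => n; case: (choice.unpickle n) => [i|]; first exact: H.
  exact: aeW.
by apply: filterS => x Hx i; have := Hx (choice.pickle i); rewrite choice.pickleK.
Qed.

(** The limit is the supremum of the levels that u reaches infinitely often. *)
Lemma cvg_of_frequently (R : realType) (u : nat -> R) :
  (forall n, 0 <= u n) ->
  (forall r' r, r' < r -> (forall n, exists2 l, (n <= l)%N & r <= u l) ->
     \forall n \near \oo, r' <= u n) ->
  exists2 l : \bar R, (0 <= l)%E & (u n)%:E @[n --> \oo] --> l.
Proof.
move=> u0 H.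
pose S := [set r : R | forall n, exists2 l, (n <= l)%N & r <= u l].
have S0 : S 0 by move=> n; exists n.
have [Sub|nSub] := pselect (has_ubound S); last first.
  exists +oo%E; first by rewrite leey.
  apply/cvgeryP/cvgryPge => A.
  have [r [Sr Ar]] : exists r, S r /\ A < r.
    apply: contrapT => /forallNP HA; apply: nSub; exists A => r Sr.
    by rewrite leNgt; apply/negP => Ar; apply: (HA r).
  exact: H Sr.
have hS : has_sup S by split => //; exists 0.
exists (sup S)%:E; first by rewrite lee_fin; apply: ub_le_sup.
apply: cvg_EFin; first exact: nearW.
apply/cvgrPdist_le => e e0.
have [r Sr Hr] := sup_adherent (divr_gt0 e0 (ltr0Sn R 1)) hS.
have up : \forall n \near \oo, u n < sup S + e.
  have : ~ S (sup S + e).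
    move=> /(ub_le_sup Sub); lra.
  move=> /existsNP[N HN]; exists N => // n /= Nn.
  by rewrite ltNge; apply/negP => Hn; apply: HN; exists n.
have lo : \forall n \near \oo, sup S - e <= u n.
  apply: (H _ r) => //; lra.
near=> n.
have h1 : u n < sup S + e by near: n.
have h2 : sup S - e <= u n by near: n.
rewrite /= ler_norml; lra.
Unshelve. all: by end_near.
Qed.

Section SuperadditiveNonneg.
Context (R : realType) (d : measure_display) (Omega : measurableType d).
Context (P : probability Omega R) (tau : Omega -> Omega).
Hypothesis mtau : measurable_fun [set: Omega] tau.
Hypothesis ptau : forall A, measurable A -> P (tau @^-1` A) = P A.
Variable F : nat -> Omega -> R.
Hypothesis mF : forall n, measurable_fun [set: Omega] (F n).
Hypothesis F0 : forall n w, 0 <= F n w.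
Hypothesis Fsup : forall m n w, F m w + F n (iter m tau w) <= F (m + n)%N w.

Let freq (r : R) : set Omega :=
  [set w | forall n, exists2 l, (n <= l)%N & r * l%:R <= F l w].

(** The points where the limit superior of F l / l is larger than q. The margin
    1 / (j + 1) leaves room for replacing F l (tau w) by F (l + 1) w in
    [fast_tau]. *)
Let fast (q : R) : set Omega := \bigcup_j freq (q + j.+1%:R^-1).

(** The points of fast q that have not seen the ratio q by time N. *)
Let slow (q : R) (N : nat) : set Omega :=
  fast q `&` [set w | forall l, (0 < l <= N)%N -> F l w < q * l%:R].

Let measurable_ge r l : measurable [set w | r * l%:R <= F l w].
Proof.
have -> : [set w | r * l%:R <= F l w] = F l @^-1` `[r * l%:R, +oo[.
  by apply/seteqP; split => w /=; rewrite in_itv/= andbT.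
by rewrite -[_ @^-1` _]setTI; exact: mF.
Qed.

Let measurable_fast q : measurable (fast q).
Proof.
apply: bigcup_measurable => j _; set r := q + _.
have -> : freq r =
    \bigcap_n \bigcup_(l in [set l | (n <= l)%N]) [set w | r * l%:R <= F l w].
  apply/seteqP; split => w Hw.
    by move=> n _; have [l nl Hl] := Hw n; exists l.
  by move=> n; have [l nl Hl] := Hw n I; exists l.
by apply: bigcap_measurableType => n _; apply: bigcup_measurable.
Qed.

Let measurable_slow q N : measurable (slow q N).
Proof.
apply: measurableI => //.
have -> : [set w | forall l, (0 < l <= N)%N -> F l w < q * l%:R] =
    \bigcap_(l in [set l | (0 < l <= N)%N]) ~` [set w | q * l%:R <= F l w].
  apply/seteqP; split => w Hw l /Hw.
    by move=> h /=; apply/negP; rewrite -ltNge.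
  by move=> /= /negP; rewrite -ltNge.
by apply: bigcap_measurableType => l _; exact: measurableC.
Qed.

Let fast_tau q w : fast q (tau w) -> fast q w.
Proof.
move=> [j _ Hj]; exists j.+1 => // n.
have e0 : 0 < j.+1%:R^-1 - j.+2%:R^-1 :> R.
  by rewrite subr_gt0 ltf_pV2 ?posrE// ltr_nat.
set r := q + j.+1%:R^-1 in Hj; set r' := q + j.+2%:R^-1.
have rr : 0 < r - r' by rewrite /r /r' opprD addrACA subrr add0r.
pose m := maxn n (Num.truncn (r' / (r - r'))).+1.
have [l ml Hl] := Hj m.
exists l.+1; first by rewrite (leq_trans _ (leqW ml))// leq_maxl.
have := Fsup 1 l w; rewrite add1n /= => H.
apply: le_trans H; apply: (@le_trans _ _ (r * l%:R)); last first.
  by apply: le_trans Hl _; rewrite lerDr.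
have : r' / (r - r') <= l%:R.
  apply: (@le_trans _ _ (Num.truncn (r' / (r - r'))).+1%:R).
    exact/ltW/truncnS_gt.
  by rewrite ler_nat (leq_trans _ ml)// leq_maxr.
rewrite ler_pdivrMr// -natr1; lra.
Qed.

(** The preimage of fast q under tau is contained in fast q and has the same
    measure, so that the two differ by a null set. *)
Let fast_iter_ae q : {ae P, forall w, fast q w -> forall k, fast q (iter k tau w)}.
Proof.
have mf := measurable_fast q.
have mtf : measurable (tau @^-1` fast q) by rewrite -[_ @^-1` _]setTI; exact: mtau.
have step k : {ae P, forall w, fast q (iter k tau w) -> fast q (iter k.+1 tau w)}.
  pose D := fast q `\` (tau @^-1` fast q).
  have mD : measurable D by exact: measurableD.
  have PD : P D = 0%E.
    rewrite measureD//; last exact: (le_lt_trans (probability_le1 _ _) (ltey _)).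
    have -> : fast q `&` tau @^-1` fast q = tau @^-1` fast q.
      by apply/setIidr => w; exact: fast_tau.
    rewrite [X in (_ - X)%E](ptau mf).
    by apply: subee; exact: fin_num_measure.
  exists (iter k tau @^-1` D); split.
  - by rewrite -[_ @^-1` _]setTI; exact: measurable_iter.
  - by rewrite iter_preserving.
  - move=> w /= Hw; split; first by apply: contrapT => h; apply: Hw.
    by move=> h; apply: Hw => _.
have := ae_foralln step.
apply: filterS => w Hw h0; elim=> [//|k IH]; exact: Hw.
Qed.

Let cvg_slow q : P (slow q n) @[n --> \oo] --> (0 : \bar R)%E.
Proof.
have E : \bigcap_n slow q n = set0.
  apply/seteqP; split => // w Hw.
  have [[j _ Hj] _] := Hw 0%N I.
  have [l l1 Hl] := Hj 1%N.
  have [_ /(_ l)] := Hw l I; rewrite l1 leqnn => /(_ isT) /=.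
  apply/negP; rewrite -leNgt; apply: le_trans Hl.
  by apply: ler_wpM2r => //; rewrite lerDl.
rewrite -(measure0 P) -E.
apply: nonincreasing_cvg_mu => //.
- exact: (le_lt_trans (probability_le1 _ _) (ltey _)).
- by rewrite E.
- move=> m n mn; apply/subsetPset => w [fw Hw]; split => // l /andP[l0 lm].
  by apply: Hw; rewrite l0 (leq_trans lm).
Qed.

(** By the maximal inequality the set of points that visit slow q N with frequency at
    least lam has measure at most P (slow q N) / lam, which tends to 0 as N grows. *)
Let slow_rare q (lam : R) : 0 < lam ->
  {ae P, forall w, exists N, forall n, (0 < n)%N ->
     birkhoff_sum tau (\1_(slow q N) : Omega -> R) n w < lam * n%:R}.
Proof.
move=> lam0.
pose E N := [set w | exists l, (0 < l)%N /\
              lam * l%:R <= birkhoff_sum tau (\1_(slow q N) : Omega -> R) l w].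
have mE N : measurable (E N).
  apply: measurable_birkhoff_exceed => //; exact: measurable_indic.
exists (\bigcap_N E N); split.
- exact: bigcap_measurableType.
- apply/eqP; rewrite eq_le measure_ge0 andbT.
  have le N : (lam%:E * P (\bigcap_N E N) <= P (slow q N))%E.
    apply: (@le_trans _ _ (lam%:E * P (E N))%E).
      apply: lee_wpmul2l; first by rewrite lee_fin ltW.
      apply: le_measure; rewrite ?inE//; first exact: bigcap_measurableType.
      by move=> w; apply.
    have := @maximal_inequality R d Omega P tau mtau ptau
      (\1_(slow q N) : Omega -> R) _ _ lam (ltW lam0).
    rewrite integral_indic// setIT; exact.
  have : (lam%:E * P (\bigcap_N E N) <= 0)%E.
    rewrite -(cvg_lim _ (@cvg_slow q))//.
    apply: lime_ge; first by apply/cvg_ex; eexists; exact: cvg_slow.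
    by apply: nearW.
  by rewrite pmule_rle0.
- move=> w /= Hw N _.
  apply: contrapT => HN; apply: Hw; exists N => n n0.
  rewrite ltNge; apply/negP => h; apply: HN; exists n; split => //.
Qed.

(** The orbit of a fast point is fast. Its times outside slow q N start a window with
    ratio q of length at most N, and the greedy covering applies. *)
Let fast_lower (q lam : R) : 0 <= q -> 0 < lam ->
  {ae P, forall w, fast q w ->
    exists N, forall n, (0 < n)%N -> q * (1 - lam) * n%:R - q * N%:R <= F n w}.
Proof.
move=> q0 lam0; move: (fast_iter_ae q) (slow_rare q lam0).
apply: filterS2 => w Hf [N HN] fw; exists N => n n0.
have := HN n n0.
pose A k := iter k tau w \notin slow q N.
have good : forall i, A i -> exists l, (0 < l <= N)%N /\ q * l%:R <= F l (iter i tau w).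
  move=> i; rewrite /A => /negP; rewrite in_setE => h.
  apply: contrapT => H; apply: h; split; first exact: Hf.
  move=> l lN; rewrite ltNge; apply/negP => h; apply: H; exists l; split => //.
have sup : forall i m p, F m (iter i tau w) + F p (iter (i + m) tau w) <=
    F (m + p)%N (iter i tau w).
  by move=> i m p; rewrite addnC iterD; exact: Fsup.
have := @greedy_cover R (fun i l => F l (iter i tau w)) A q N q0
  (fun i l => F0 l _) sup good n 0%N.
rewrite /=.
have -> : \sum_(k < n) (A (0 + k)%N)%:R =
    n%:R - birkhoff_sum tau (\1_(slow q N) : Omega -> R) n w :> R.
  rewrite /birkhoff_sum -[n in n%:R]card_ord -sumr_const -sumrB.
  apply: eq_bigr => k _; rewrite indicE /A add0n.
  by case: (_ \in _); rewrite ?subrr ?subr0.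
move=> h1 h2; apply: le_trans h1; rewrite lerD2r -mulrA ler_wpM2l//.
rewrite mulrBl mul1r lerD2l lerN2; exact: ltW.
Qed.

(** A limsup above q forces a liminf of at least q (1 - lam) for every lam > 0.
    Rational q and lam = 1 / (i + 1) suffice, so that one null set is discarded. *)
Lemma superadditive_nonneg_cvg :
  {ae P, forall w, exists2 l : \bar R, (0 <= l)%E &
     (F n w / n%:R)%:E @[n --> \oo] --> l}.
Proof.
have : {ae P, forall w, forall qi : rat * nat, 0 <= qi.1 ->
    fast (ratr qi.1) w -> exists N, forall n, (0 < n)%N ->
      ratr qi.1 * (1 - qi.2.+1%:R^-1) * n%:R - ratr qi.1 * N%:R <= F n w}.
  apply: ae_forall_countable => -[q i] /=.
  have [q0|q0] := boolP (0 <= q); last first.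
    by apply: aeW => w h; case/negP: q0.
  have := @fast_lower (ratr q) (i.+1%:R^-1) _ _.
  rewrite ler0q => /(_ q0); rewrite invr_gt0 ltr0n => /(_ isT).
  by apply: filterS => w Hw _.
apply: filterS => w Hw.
apply: cvg_of_frequently => [n|r' r r'r Hr]; first by rewrite divr_ge0.
have [r'0|r'0] := ltP r' 0.
  by apply: nearW => n; apply: le_trans (ltW r'0) _; rewrite divr_ge0.
have [q] := rat_in_itvoo r'r.
rewrite in_itv /= => /andP[r'q qr].
have q0 : 0 < ratr q :> R by exact: le_lt_trans r'q.
have fastq : fast (ratr q) w.
  exists (Num.truncn (r - ratr q)^-1) => // n.
  have [l nl Hl] := Hr n.+1.
  exists l; first exact: ltnW.
  have l0 : (0 < l)%N by exact: leq_ltn_trans nl.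
  move: Hl; rewrite ler_pdivlMr ?ltr0n// => Hl.
  apply: le_trans Hl; apply: ler_wpM2r => //.
  rewrite -lerBrDl -[leRHS]invrK lef_pV2 ?posrE ?invr_gt0 ?subr_gt0//.
  exact/ltW/truncnS_gt.
pose i := Num.truncn (2 * ratr q / (ratr q - r')).
have := Hw (q, i); rewrite /= ltW => [|]; last by rewrite -(ltr0q R).
move=> /(_ isT fastq)[N HN].
have qr'0 : 0 < ratr q - r' by rewrite subr_gt0.
have i1 : ratr q * i.+1%:R^-1 <= (ratr q - r') / 2.
  rewrite ler_pdivrMr// mulrAC -ler_pdivrMr//.
  rewrite -(ler_pdivrMl _ _ qr'0).
  apply: le_trans (ltW (truncnS_gt _)).
  lra.
near=> n.
have n0 : (0 < n)%N by near: n; exists 1%N.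
rewrite ler_pdivlMr ?ltr0n//.
apply: le_trans (HN n n0).
have : 2 * (ratr q * N%:R) / (ratr q - r') <= n%:R.
  near: n; exact: nbhs_infty_ger.
rewrite ler_pdivrMr// => h.
have -> : ratr q * (1 - i.+1%:R^-1) * n%:R =
    ratr q * n%:R - (ratr q * i.+1%:R^-1) * n%:R :> R.
  by rewrite mulrBr mulr1 mulrBl.
have : (ratr q * i.+1%:R^-1) * n%:R <= (ratr q - r') / 2 * n%:R.
  exact: ler_wpM2r.
move: (ratr q / _) h => y; move: (ratr q) (n%:R) (N%:R) => a m p; lra.
Unshelve. all: by end_near.
Qed.

End SuperadditiveNonneg.

Section Superadditive.
Context (R : realType) (d : measure_display) (Omega : measurableType d).
Context (P : probability Omega R) (tau : Omega -> Omega).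
Hypothesis mtau : measurable_fun [set: Omega] tau.
Hypothesis ptau : forall A, measurable A -> P (tau @^-1` A) = P A.

(** Where no such lam exists the averages exceed every integer i, and the maximal
    inequality bounds i times the measure of this set by the integral of h. *)
Lemma birkhoff_sum_bounded (h : Omega -> R) :
  P.-integrable [set: Omega] (EFin \o h) -> (forall w, 0 <= h w) ->
  {ae P, forall w, exists lam : R, forall n, (0 < n)%N ->
     birkhoff_sum tau h n w < lam * n%:R}.
Proof.
move=> ih h0.
have mh : measurable_fun [set: Omega] h.
  exact/measurable_EFinP/(measurable_int _ ih).
have Ifin : (\int[P]_w (h w)%:E)%E \is a fin_num := integrable_fin_num measurableT ih.
pose E (i : nat) := [set w | exists l, (0 < l)%N /\
              i%:R * l%:R <= birkhoff_sum tau h l w].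
have mE i : measurable (E i) by apply: measurable_birkhoff_exceed.
have mI : measurable (\bigcap_i E i) by exact: bigcap_measurableType.
exists (\bigcap_i E i); split => //.
- have le (i : nat) : (i%:R%:E * P (\bigcap_i E i) <= \int[P]_w (h w)%:E)%E.
    apply: (@le_trans _ _ (i%:R%:E * P (E i))%E).
      apply: lee_wpmul2l; first by rewrite lee_fin.
      by apply: le_measure; rewrite ?inE//; move=> w; apply.
    exact: (maximal_inequality mtau ptau).
  have Pfin : P (\bigcap_i E i) \is a fin_num by exact: fin_num_measure.
  rewrite -(fineK Pfin); congr (_%:E); apply/eqP; rewrite eq_le.
  rewrite fine_ge0// andbT.
  apply: (@le0_of_bounded_multiples _ _ (fine (\int[P]_w (h w)%:E)%E)) => n.
  by have := le n; rewrite -{1}(fineK Pfin) -{1}(fineK Ifin) -EFinM lee_fin.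
- move=> w /= Hw i _; apply: contrapT => Hi; apply: Hw; exists i%:R => n n0.
  by rewrite ltNge; apply/negP => H; apply: Hi; exists n.
Qed.

(** Adding the Birkhoff sums of h makes the process nonnegative without destroying
    superadditivity. The averages of h converge to a finite limit, which can be
    subtracted again. *)
Theorem superadditive_ergodic (S : nat -> Omega -> R) (h : Omega -> R) :
  (forall n, measurable_fun [set: Omega] (S n)) ->
  (forall w, S 0%N w = 0) ->
  (forall m n w, S m w + S n (iter m tau w) <= S (m + n)%N w) ->
  P.-integrable [set: Omega] (EFin \o h) -> (forall w, 0 <= h w) ->
  (forall w, - h w <= S 1%N w) ->
  {ae P, forall w, exists2 l : \bar R, (-oo < l)%E &
     (S n w / n%:R)%:E @[n --> \oo] --> l}.
Proof.
move=> mS S0 Ssup ih h0 Sh.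
have mh : measurable_fun [set: Omega] h.
  exact/measurable_EFinP/(measurable_int _ ih).
have mB n : measurable_fun [set: Omega] (birkhoff_sum tau h n).
  exact: measurable_birkhoff_sum.
have B0 n w : 0 <= birkhoff_sum tau h n w by exact: sumr_ge0.
pose F n w := S n w + birkhoff_sum tau h n w.
have Fsup m n w : F m w + F n (iter m tau w) <= F (m + n)%N w.
  rewrite /F birkhoff_sumD; have := Ssup m n w; lra.
have F0 n w : 0 <= F n w.
  elim: n w => [|n IH] w; first by rewrite /F S0 /birkhoff_sum big_ord0 addr0.
  apply: le_trans (Fsup 1%N n w); rewrite addr_ge0//.
  rewrite /F /birkhoff_sum big_ord1 /=; have := Sh w; lra.
have mF n : measurable_fun [set: Omega] (F n) by exact: measurable_funD.
have HF := superadditive_nonneg_cvg mtau ptau mF F0 Fsup.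
have HB : {ae P, forall w, exists2 l : \bar R, (0 <= l)%E &
     (birkhoff_sum tau h n w / n%:R)%:E @[n --> \oo] --> l}.
  apply: (superadditive_nonneg_cvg mtau ptau mB B0) => m n w.
  by rewrite birkhoff_sumD.
have Hbd := birkhoff_sum_bounded ih h0.
move: HF HB Hbd; apply: filterS3 => w [lF lF0 cF] [lB lB0 cB] [lam Hlam].
have lBfin : lB \is a fin_num.
  rewrite ge0_fin_numE//; apply: le_lt_trans (ltry lam).
  rewrite -(cvg_lim _ cB)//; apply: lime_le.
    by apply/cvg_ex; exists lB.
  exists 1%N => // n /= n0; rewrite lee_fin ler_pdivrMr ?ltr0n//.
  exact/ltW/Hlam.
exists (lF - lB)%E.
  move: lF lF0 cF lB lB0 cB lBfin => [r| |] //= _ _ [s| |] //= _ _ _.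
  by rewrite -EFinB ltNyr.
have -> : (fun n => (S n w / n%:R)%:E) =
    (fun n => (F n w / n%:R)%:E - (birkhoff_sum tau h n w / n%:R)%:E)%E.
  by apply/funext => n; rewrite -EFinB -mulrBl /F addrK.
apply: cvgeB => //.
by rewrite fin_num_adde_defl// fin_numN.
Qed.

End Superadditive.

(** * Path sums and concatenation *)

Section Lattice.
Context (d : nat) (steps : {fset 'rV[int]_d}).

Definition endpoint (s : seq steps) : 'rV[int]_d := \sum_(z <- s) val z.

Lemma endpoint_nil : endpoint [::] = 0.
Proof. exact: big_nil. Qed.

Lemma endpoint_cons z s : endpoint (z :: s) = val z + endpoint s.
Proof. exact: big_cons. Qed.

Lemma endpoint_cat s t : endpoint (s ++ t) = endpoint s + endpoint t.
Proof. exact: big_cat. Qed.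

Lemma endpoint_nseq n z : endpoint (nseq n z) = val z *+ n.
Proof. by elim: n => [|n IH] /=; rewrite ?endpoint_nil// endpoint_cons IH mulrS. Qed.

Lemma lattice_span0 : lattice_span steps 0.
Proof. by exists (fun=> 0); rewrite big1// => z _; rewrite scale0r. Qed.

Lemma lattice_spanD x y :
  lattice_span steps x -> lattice_span steps y -> lattice_span steps (x + y).
Proof.
move=> [a ->] [b ->]; exists (fun z => a z + b z).
by rewrite -big_split /=; apply: eq_bigr => z _; rewrite scalerDl.
Qed.

Lemma lattice_span_step (z : steps) : lattice_span steps (val z).
Proof.
exists (fun y => (y == z)%:Z); rewrite (bigD1 z)//= eqxx scale1r.
by rewrite big1 ?addr0// => y /negbTE ->; rewrite scale0r.
Qed.

Lemma lattice_span_endpoint s : lattice_span steps (endpoint s).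
Proof.
elim: s => [|z s IH]; first by rewrite endpoint_nil; exact: lattice_span0.
by rewrite endpoint_cons; apply: lattice_spanD => //; exact: lattice_span_step.
Qed.

End Lattice.

Section Paths.
Context (R : realType) (d ell : nat) (steps : {fset 'rV[int]_d}).
Context (phi : 'rV[int]_d -> ell.-tuple steps -> R) (G : 'rV[int]_d -> R).

(** A site followed by fewer than ell steps has no window. It receives the least
    possible value, so that prolonging a path can only raise its energy. *)
Definition site_energy (p : 'rV[int]_d) (s : seq steps) : R :=
  if (insub (take ell s) : option (ell.-tuple steps)) is Some w
  then phi p w else - G p.

Fixpoint path_energy (p : 'rV[int]_d) (s : seq steps) : R :=
  if s is z :: s' then site_energy p s + path_energy (p + val z) s' else 0.

(** Minus this cost is a lower bound for the energy of the path. *)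
Fixpoint path_cost (p : 'rV[int]_d) (s : seq steps) : R :=
  if s is z :: s' then G p + path_cost (p + val z) s' else 0.

Definition path_sum (p : 'rV[int]_d) (n : nat) (x : 'rV[int]_d) : R :=
  \sum_(s : n.-tuple steps | endpoint s == x) expR (path_energy p s).

Lemma path_cost_cat p s t :
  path_cost p (s ++ t) = path_cost p s + path_cost (p + endpoint s) t.
Proof.
elim: s p => [|z s IH] p /=; first by rewrite endpoint_nil addr0 add0r.
by rewrite IH endpoint_cons addrA addrA.
Qed.

Hypothesis phiG : forall x w, `|phi x w| <= G x.

Lemma site_energy_ge p s : 0 <= G p -> - G p <= site_energy p s.
Proof.
rewrite /site_energy; case: insubP => [w _ _|] //= _.
by have := phiG p w; rewrite ler_norml => /andP[].
Qed.

Lemma site_energy_cat p s t : site_energy p s <= site_energy p (s ++ t).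
Proof.
rewrite {1}/site_energy; case: insubP => [w|] /=.
  rewrite size_take_min => /eqP es ew.
  have ls : (ell <= size s)%N by rewrite -es geq_minr.
  rewrite /site_energy takel_cat// -ew; case: insubP => [w' _ /val_inj -> //|].
  by rewrite size_tuple eqxx.
move=> _; rewrite /site_energy; case: insubP => [w _ _|] //=.
by have := phiG p w; rewrite ler_norml => /andP[].
Qed.

Lemma path_energy_cat p s t :
  path_energy p s + path_energy (p + endpoint s) t <= path_energy p (s ++ t).
Proof.
elim: s p => [|z s IH] p; first by rewrite endpoint_nil add0r addr0.
rewrite cat_cons /= endpoint_cons.
have := IH (p + val z); have := site_energy_cat p (z :: s) t.
rewrite cat_cons addrA; lra.
Qed.

Lemma path_energy_ge p s : (forall x, 0 <= G x) ->
  - path_cost p s <= path_energy p s.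
Proof.
move=> G0; elim: s p => [|z s IH] p /=; first by rewrite oppr0.
have := IH (p + val z); have := @site_energy_ge p (z :: s) (G0 p); lra.
Qed.

Lemma path_sum_ge0 p n x : 0 <= path_sum p n x.
Proof. by apply: sumr_ge0 => s _; exact: expR_ge0. Qed.

Lemma path_sum_ge p s :
  expR (path_energy p s) <= path_sum p (size s) (endpoint s).
Proof.
rewrite /path_sum (bigD1 (in_tuple s))//= lerDl.
by apply: sumr_ge0 => t _; exact: expR_ge0.
Qed.

Lemma path_sum_gt0 p (s : seq steps) : 0 < path_sum p (size s) (endpoint s).
Proof. exact: (lt_le_trans (expR_gt0 _) (path_sum_ge p s)). Qed.

Lemma path_sum_neq0 p n x : path_sum p n x != 0 ->
  exists2 s : seq steps, size s = n & endpoint s = x.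
Proof.
move=> H.
have [s /eqP Hs|nos] := pickP (fun s : n.-tuple steps => endpoint s == x).
  by exists s => //; rewrite size_tuple.
by case/eqP: H; rewrite /path_sum big_pred0.
Qed.

Lemma sum_cat_tuple (n m : nat) (F : seq steps -> R) :
  \sum_(s : n.-tuple steps) \sum_(t : m.-tuple steps) F (s ++ t) =
  \sum_(u : (n + m).-tuple steps) F u.
Proof.
rewrite pair_big /=.
rewrite (reindex (fun p : n.-tuple steps * m.-tuple steps => cat_tuple p.1 p.2)) //=.
have tk (u : (n + m).-tuple steps) : size (take n u) == n.
  by rewrite size_takel// size_tuple leq_addr.
have dr (u : (n + m).-tuple steps) : size (drop n u) == m.
  by rewrite size_drop size_tuple addKn.
exists (fun u => (Tuple (tk u), Tuple (dr u))) => [[s t] _|u _] /=.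
  by congr pair; apply: val_inj;
    rewrite /= ?take_size_cat ?drop_size_cat ?size_tuple.
by apply: val_inj; rewrite /= cat_take_drop.
Qed.

(** Concatenation is injective on pairs of paths of given lengths, and
    [path_energy_cat] says that it loses no energy. *)
Lemma path_sum_mul p n m x y :
  path_sum p n x * path_sum (p + x) m y <= path_sum p (n + m) (x + y).
Proof.
rewrite /path_sum [leRHS]big_mkcond /=.
rewrite -(sum_cat_tuple n m (fun u =>
  if endpoint u == x + y then expR (path_energy p u) else 0)).
rewrite big_distrl /= [leLHS]big_mkcond /=.
apply: ler_sum => s _; case: eqP => [sx|_]; last first.
  by apply: sumr_ge0 => t _; case: ifP => // _; exact: expR_ge0.
rewrite big_distrr /= [leLHS]big_mkcond /=.
apply: ler_sum => t _; case: eqP => [ty|_]; last first.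
  by case: ifP => // _; exact: expR_ge0.
rewrite endpoint_cat sx ty eqxx -expRD ler_expR -sx.
exact: path_energy_cat.
Qed.

Lemma path_sum_bridge p n x t : (forall x, 0 <= G x) ->
  path_sum p n x * expR (- path_cost (p + x) t)
  <= path_sum p (n + size t) (x + endpoint t).
Proof.
move=> G0; apply: le_trans (path_sum_mul _ _ _ _ _).
apply: ler_wpM2l; first exact: path_sum_ge0.
apply: le_trans (path_sum_ge _ _).
by rewrite ler_expR; exact: path_energy_ge.
Qed.

End Paths.

Section Translation.
Context (R : realType) (d ell : nat) (steps : {fset 'rV[int]_d}).
Context (phi phi' : 'rV[int]_d -> ell.-tuple steps -> R) (G G' : 'rV[int]_d -> R).
Variable q : 'rV[int]_d.
Hypothesis phiq : forall x, lattice_span steps x -> phi' x = phi (q + x).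
Hypothesis Gq : forall x, lattice_span steps x -> G' x = G (q + x).

(** The sum started from q is the sum started from 0 in the environment seen from q:
    this turns [path_sum_mul] into superadditivity along an orbit of the shifts. *)
Lemma path_sum_translate n x : path_sum phi' G' 0 n x = path_sum phi G q n x.
Proof.
apply: eq_bigr => s _; congr expR; rewrite -[q in RHS]addr0.
elim: (val s) (0 : 'rV_d) (lattice_span0 steps) => [//|z t IH] p Hp /=.
rewrite /site_energy phiq// Gq// -addrA; congr (_ + _).
by apply: IH; apply: lattice_spanD => //; exact: lattice_span_step.
Qed.

End Translation.

(** * Bridges of small cost in a tame environment *)

Section Size.
Context (d : nat) (steps : {fset 'rV[int]_d}).

(** This norm takes values in nat and dominates the Euclidean norm. *)
Definition l1 (x : 'rV[int]_d) : nat := (\sum_i `|x ord0 i|)%N.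

Definition step_range : nat := (\sum_(z : steps) l1 (val z))%N.

Lemma l1_0 : l1 0 = 0%N.
Proof. by apply: big1 => i _; rewrite mxE. Qed.

Lemma l1D x y : (l1 (x + y) <= l1 x + l1 y)%N.
Proof.
rewrite /l1 -big_split /=; apply: leq_sum => i _.
by rewrite mxE -lez_nat PoszD !abszE ler_normD.
Qed.

Lemma l1_step (z : steps) : (l1 (val z) <= step_range)%N.
Proof. by rewrite /step_range (bigD1 z)//= leq_addr. Qed.

Lemma l1_endpoint (s : seq steps) : (l1 (endpoint s) <= size s * step_range)%N.
Proof.
elim: s => [|z s IH]; first by rewrite endpoint_nil l1_0.
rewrite endpoint_cons (leq_trans (l1D _ _))//= mulSn.
by rewrite leq_add// l1_step.
Qed.

End Size.

Section Lace.
Context (R : realType) (d : nat) (steps : {fset 'rV[int]_d}).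
Context (G : 'rV[int]_d -> R).
Hypothesis G0 : forall x, 0 <= G x.
Variables (z z0 : steps) (C : nat).

(** The word z z0^C z z0^C ... with a letters z and b letters z0. If z0 is the zero
    step, the walk stands still while it spends a block of z0, and spreading the blocks
    makes every site of the segment pay at most C + 1 times instead of making one site
    pay b times. *)
Fixpoint lace (a b : nat) : seq steps :=
  if a is a'.+1 then z :: nseq (minn C b) z0 ++ lace a' (b - minn C b) else [::].

Lemma size_lace a b : (b <= a * C)%N -> size (lace a b) = (a + b)%N.
Proof.
elim: a b => [|a IH] b /=; first by rewrite mul0n leqn0 => /eqP ->.
move=> H; rewrite size_cat size_nseq IH; last first.
  by move: H; rewrite mulSn; case: leqP => ?; lia.
by case: leqP => ?; lia.
Qed.

Lemma endpoint_lace a b : ((0 < b)%N -> val z0 = 0) ->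
  endpoint (lace a b) = val z *+ a.
Proof.
elim: a b => [|a IH] b H /=; first by rewrite endpoint_nil.
rewrite endpoint_cons endpoint_cat endpoint_nseq mulrS; congr (_ + _).
case: b H => [|b] H; first by rewrite minn0 mulr0n add0r IH.
by rewrite H// mul0rn add0r IH// => _; exact: H.
Qed.

Lemma path_cost_nseq0 p m : val z0 = 0 -> path_cost G p (nseq m z0) = m%:R * G p.
Proof.
move=> H; elim: m => [|m IH] /=; first by rewrite mul0r.
by rewrite H addr0 IH -nat1r mulrDl mul1r.
Qed.

Lemma path_cost_lace p a b : ((0 < b)%N -> val z0 = 0) ->
  path_cost G p (lace a b) <= C.+1%:R * \sum_(k < a.+1) G (p + val z *+ k).
Proof.
move=> H.
suff : path_cost G p (lace a b) <= \sum_(k < a) G (p + val z *+ k) +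
    C%:R * \sum_(k < a) G (p + val z *+ k.+1).
  move/le_trans; apply; rewrite -nat1r mulrDl mul1r; apply: lerD.
    by rewrite big_ord_recr /= lerDl.
  apply: ler_wpM2l => //; rewrite big_ord_recl /= lerDr//.
elim: a p b H => [|a IH] p b H /=; first by rewrite !big_ord0 mulr0 addr0.
rewrite !big_ord_recl /= mulr0n addr0 mulr1n mulrDr -!addrA lerD2l.
rewrite path_cost_cat.
have h1 : path_cost G (p + val z) (nseq (minn C b) z0) <= C%:R * G (p + val z).
  case: b H => [|b] H; first by rewrite minn0 /= mulr_ge0.
  rewrite path_cost_nseq0; last exact: H.
  by apply: ler_wpM2r => //; rewrite ler_nat geq_minl.
have -> : p + val z + endpoint (nseq (minn C b) z0) = p + val z.
  rewrite endpoint_nseq; case: b H {h1} => [|b] H; first by rewrite minn0 addr0.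
  by rewrite H// mul0rn addr0.
have := IH (p + val z) (b - minn C b)%N _.
have -> : \sum_(k < a) G (p + val z + val z *+ k) =
    \sum_(k < a) G (p + val z *+ bump 0 k).
  by apply: eq_bigr => k _; rewrite -addrA -mulrS.
have -> : \sum_(k < a) G (p + val z + val z *+ k.+1) =
    \sum_(k < a) G (p + val z *+ (bump 0 k).+1).
  by apply: eq_bigr => k _; rewrite -addrA -mulrS.
have H' : (0 < b - minn C b)%N -> val z0 = 0.
  by move=> h; apply: H; rewrite (leq_trans h)// leq_subr.
move=> /(_ H').
by move: h1; rewrite -/(val z); lra.
Qed.

End Lace.

Section Bridge.
Context (R : realType) (d ell : nat) (steps : {fset 'rV[int]_d}).
Context (phi : 'rV[int]_d -> ell.-tuple steps -> R) (G : 'rV[int]_d -> R).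
Hypothesis G0 : forall x, 0 <= G x.

(** The summability condition of class L, with both upper limits unfolded into
    quantifiers and the steps of a segment counted by a. *)
Definition tame_environment : Prop :=
  forall delta : R, 0 < delta -> exists2 eps : R, 0 < eps &
    \forall n \near \oo, forall x, lattice_span steps x -> (l1 x <= n)%N ->
      forall z : steps, val z != 0 -> forall a : nat, a%:R <= eps * n%:R ->
        \sum_(k < a.+1) G (x + val z *+ k) <= delta * n%:R.

Hypothesis tame : tame_environment.

Lemma tame_scaled (K : nat) (delta : R) : 0 < delta -> exists2 eps : R, 0 < eps &
    \forall n \near \oo, forall x, lattice_span steps x -> (l1 x <= K * n)%N ->
      forall z : steps, val z != 0 -> forall a : nat, a%:R <= eps * n%:R ->
        \sum_(k < a.+1) G (x + val z *+ k) <= delta * n%:R.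
Proof.
move=> d0; have d0' : 0 < delta / K.+1%:R by rewrite divr_gt0.
have [e e0 [N _ HN]] := tame d0'; exists e => //.
exists N => // n /= Nn x sx lx z z0 a ae.
have NK : (N <= K.+1 * n)%N by rewrite mulSn (leq_trans Nn)// leq_addr.
have := HN _ NK x sx _ z z0 a _.
have -> : delta / K.+1%:R * (K.+1 * n)%:R = delta * n%:R.
  by rewrite natrM mulrA divfK.
apply.
- by rewrite (leq_trans lx)// leq_mul2r leqnSn orbT.
- by apply: (le_trans ae (ler_wpM2l (ltW e0) _)); rewrite ler_nat leq_pmull.
Qed.

(** A site is a segment of length 0. If all steps are 0 there are no segments, but
    then 0 is the only site. *)
Lemma tame_site (K : nat) (delta : R) : 0 < delta ->
  \forall n \near \oo, forall x, lattice_span steps x -> (l1 x <= K * n)%N ->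
     G x <= delta * n%:R.
Proof.
move=> d0.
have [z z0|nz] := pickP (fun z : steps => val z != 0).
  have [e e0 [N _ HN]] := tame_scaled K d0; exists N => // n /= Nn x sx lx.
  have := HN n Nn x sx lx z z0 0%N; rewrite big_ord1 mulr0n addr0; apply.
  by rewrite mulr_ge0// ltW.
near=> n => x [a ->] _.
have -> : \sum_(z : steps) a z *: val z = 0.
  by apply: big1 => z _; have /negbFE/eqP -> := nz z; rewrite scaler0.
rewrite -ler_pdivrMl//; near: n; exact: nbhs_infty_ger.
Unshelve. all: by end_near.
Qed.

Lemma path_cost_le (B : nat) (c : R) p (t : seq steps) :
  (forall x, lattice_span steps x -> (l1 x <= B)%N -> G x <= c) ->
  lattice_span steps p -> (l1 p + size t * step_range steps <= B)%N ->
  path_cost G p t <= (size t)%:R * c.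
Proof.
move=> HG; elim: t p => [|z t IH] p sp lp /=; first by rewrite mul0r.
rewrite -nat1r mulrDl mul1r; apply: lerD.
  by apply: HG => //; apply: leq_trans lp; rewrite leq_addr.
apply: IH; first by apply: lattice_spanD => //; exact: lattice_span_step.
apply: leq_trans lp; rewrite /= mulSn addnA leq_add2r.
by rewrite (leq_trans (l1D _ _))// leq_add2l l1_step.
Qed.

Lemma path_cost_flatten (I : Type) (L : seq I) (f : I -> seq steps) (B N : nat)
    (c : R) p :
  (forall i, (size (f i) <= N)%N) ->
  (forall i x, lattice_span steps x -> (l1 x <= B)%N -> path_cost G x (f i) <= c) ->
  lattice_span steps p -> (l1 p + size L * (N * step_range steps) <= B)%N ->
  path_cost G p (flatten (map f L)) <= (size L)%:R * c.
Proof.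
move=> sf Hc; elim: L p => [|i L IH] p sp lp /=; first by rewrite mul0r.
rewrite path_cost_cat -nat1r mulrDl mul1r; apply: lerD.
  by apply: Hc => //; apply: leq_trans lp; rewrite leq_addr.
apply: IH; first by apply: lattice_spanD => //; exact: lattice_span_endpoint.
apply: leq_trans lp; rewrite /= mulSn addnA leq_add2r.
rewrite (leq_trans (l1D _ _))// leq_add2l (leq_trans (l1_endpoint _))//.
by rewrite leq_mul2r sf orbT.
Qed.

Lemma short_path_cost (M K : nat) (delta : R) : 0 < delta ->
  \forall n \near \oo, forall x, lattice_span steps x -> (l1 x <= M * n)%N ->
    forall t : seq steps, (size t <= K)%N -> path_cost G x t <= delta * n%:R.
Proof.
move=> d0; have d0' : 0 < delta / K.+1%:R by rewrite divr_gt0.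
have H := tame_site M.+1 d0'.
near=> n => x sx lx t tK.
have HG : forall y, lattice_span steps y -> (l1 y <= M.+1 * n)%N ->
    G y <= delta / K.+1%:R * n%:R by near: n.
have Kn : (K * step_range steps <= n)%N by near: n; exact: nbhs_infty_ge.
apply: le_trans (path_cost_le HG sx _) _.
  rewrite mulSnr leq_add// (leq_trans _ Kn)// leq_mul2r tK orbT//.
rewrite mulrA ler_wpM2r// mulrCA ler_piMr ?(ltW d0)//.
by rewrite ler_pdivrMr// mul1r ler_nat ltnW.
Unshelve. all: by end_near.
Qed.

(** One segment per nonzero step, one after the other. The zero steps are laced into the
    segment in direction y, which by assumption is long enough to absorb them. *)
Lemma long_path_cost (M C : nat) (delta : R) : 0 < delta ->
  exists2 eps : R, 0 < eps &
  \forall n \near \oo, forall x, lattice_span steps x -> (l1 x <= M * n)%N ->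
    forall (e : steps -> nat) (y : steps), val y != 0 ->
    (forall z, (e z)%:R <= eps * n%:R) ->
    (forall z, val z = 0 -> (e z <= C * e y)%N) ->
    exists t : seq steps, [/\ size t = (\sum_z e z)%N,
       endpoint t = \sum_z val z *+ e z & path_cost G x t <= delta * n%:R].
Proof.
move=> d0.
pose c := #|{: steps}|.
pose M' := (M + c * (C.+1 * step_range steps))%N.
have d0' : 0 < delta / (C.+1 * c.+1)%:R by rewrite divr_gt0.
have [eps0 e0 H] := tame_scaled M' d0'.
exists (Num.min eps0 1); first by rewrite lt_min e0 ltr01.
near=> n => x sx lx e y y0 elt ezero.
have H' : forall x, lattice_span steps x -> (l1 x <= M' * n)%N ->
      forall z : steps, val z != 0 -> forall a : nat, a%:R <= eps0 * n%:R ->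
        \sum_(k < a.+1) G (x + val z *+ k) <= delta / (C.+1 * c.+1)%:R * n%:R.
  by near: n.
have en z : (e z <= n)%N.
  rewrite -(ler_nat R); apply: le_trans (elt z) _.
  by rewrite ler_piMl// ge_min lexx orbT.
have ee z : (e z)%:R <= eps0 * n%:R.
  by apply: le_trans (elt z) _; rewrite ler_wpM2r// ge_min lexx.
pose b := (\sum_(z : steps | val z == 0%R) e z)%N.
have [z0 [bz0 bC]] : exists z0 : steps, ((0 < b)%N -> val z0 = 0) /\ (b <= e y * C)%N.
  have [z0 /eqP z00|nz] := pickP (fun z : steps => val z == 0).
    exists z0; split=> [_|]; first exact: z00.
    have -> : b = e z0.
      apply: big_pred1 => z; apply/idP/idP => [/eqP zz|/eqP ->].
        by apply/eqP/val_inj; rewrite zz z00.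
      by rewrite z00.
    by rewrite mulnC; exact: ezero.
  by exists y; rewrite /b big_pred0.
pose f (z : steps) := if val z == 0 then [::] else
  lace z z0 C (e z) (if z == y then b else 0%N).
have bz z : ((if z == y then b else 0) <= e z * C)%N by case: eqP => [->|].
have bz' z : (0 < if z == y then b else 0)%N -> val z0 = 0.
  by case: eqP => // _; exact: bz0.
have sf z : size (f z) = (if val z != 0 then
     (e z + if z == y then b else 0)%N else 0%N).
  by rewrite /f; case: eqP => //= _; rewrite size_lace.
exists (flatten [seq f z | z <- enum {: steps}]); split.
- rewrite size_flatten /shape -map_comp sumnE big_map big_enum /=.
  under eq_bigr do rewrite sf.
  rewrite -big_mkcond big_split /=.
  have -> : (\sum_(z : steps | val z != 0%R) if z == y then b else 0)%N = b.
    rewrite (bigD1 y)//= eqxx big1 ?addn0// => z /andP[_ /negbTE ->] //.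
  by rewrite addnC [RHS](bigID (fun z : steps => val z == 0)).
- rewrite /endpoint big_flatten big_map big_enum /=.
  apply: eq_bigr => z _; rewrite -/(endpoint _) /f; case: eqP => [->|_].
    by rewrite endpoint_nil mul0rn.
  by rewrite endpoint_lace// => /bz'.
- apply: le_trans (@path_cost_flatten _ _ f (M' * n) (C.+1 * n)
    (delta / c.+1%:R * n%:R) _ _ _ sx _) _.
  + move=> z; rewrite sf; case: ifP => // _.
    rewrite mulSn leq_add// (leq_trans (bz z))// mulnC leq_mul2l en orbT//.
  + move=> z p sp lp; rewrite /f; case: eqP => [_|/eqP nz] /=.
      by rewrite mulr_ge0// divr_ge0// ltW.
    apply: (le_trans (path_cost_lace G0 z C p (e z) (bz' z))).
    have := H' p sp lp z nz (e z) (ee z).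
    move=> h; apply: le_trans (ler_wpM2l _ h) _ => //.
    rewrite natrM mulrA ler_wpM2r// mulrCA ler_wpM2l ?(ltW d0)//.
    by rewrite invfM mulrA divff ?mul1r// pnatr_eq0.
  + rewrite -cardE -/c /M' mulnDl; apply: leq_add => //.
    by rewrite -!mulnA [(n * _)%N]mulnC.
  + rewrite -cardE -/c mulrA ler_wpM2r// mulrCA ler_piMr ?(ltW d0)//.
    by rewrite ler_pdivrMr// mul1r ler_nat ltnW.
Unshelve. all: by end_near.
Qed.

Hypothesis phiG : forall x w, `|phi x w| <= G x.
Let Zs := path_sum phi G 0.

(** If the path sum at x is not 0, then x is the endpoint of a path of length n, hence
    lies in the region where tameness bounds the cost of the bridge. *)
Lemma path_sum_short_bridge (K : nat) (delta : R) : 0 < delta ->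
  \forall n \near \oo, forall x (t : seq steps), (size t <= K)%N ->
    Zs n x * expR (- (delta * n%:R)) <= Zs (n + size t)%N (x + endpoint t).
Proof.
move=> d0; have [N _ HN] := short_path_cost (step_range steps) K d0.
exists N => // n /= Nn x t tK.
have [->|/path_sum_neq0[s sn sx]] := eqVneq (Zs n x) 0.
  by rewrite mul0r; exact: path_sum_ge0.
apply: le_trans (path_sum_bridge phiG _ _ _ _ G0).
apply: ler_wpM2l; first exact: path_sum_ge0.
rewrite ler_expR lerN2 add0r; apply: HN => //.
  by rewrite -sx; exact: lattice_span_endpoint.
by rewrite -sx (leq_trans (l1_endpoint s))// sn mulnC.
Qed.

Lemma path_sum_long_bridge (C : nat) (delta : R) : 0 < delta ->
  exists2 eps : R, 0 < eps &
  \forall n \near \oo, forall x (e : steps -> nat) (y : steps), val y != 0 ->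
    (forall z, (e z)%:R <= eps * n%:R) ->
    (forall z, val z = 0 -> (e z <= C * e y)%N) ->
    Zs n x * expR (- (delta * n%:R)) <=
    Zs (n + \sum_z e z)%N (x + \sum_z val z *+ e z).
Proof.
move=> d0; have [eps e0 [N _ HN]] := long_path_cost (step_range steps) C d0.
exists eps => //; exists N => // n /= Nn x e y y0 He Hz.
have [->|/path_sum_neq0[s sn sx]] := eqVneq (Zs n x) 0.
  by rewrite mul0r; exact: path_sum_ge0.
have [||t [<- <- Ht]] := HN n Nn x _ _ e y y0 He Hz.
- by rewrite -sx; exact: lattice_span_endpoint.
- by rewrite -sx (leq_trans (l1_endpoint s))// sn mulnC.
apply: le_trans (path_sum_bridge phiG _ _ _ _ G0).
apply: ler_wpM2l; first exact: path_sum_ge0.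
by rewrite ler_expR lerN2 add0r.
Qed.

End Bridge.

(** * Limits of ratios in the extended reals *)

Lemma cvg_EFin_of_bounds (R : realType) (u : nat -> R) (r : R) :
  (forall e, 0 < e -> \forall n \near \oo, r - e <= u n <= r + e) ->
  (u n)%:E @[n --> \oo] --> r%:E.
Proof.
move=> H; apply: cvg_EFin; first exact: nearW.
apply/cvgrPdist_le => e e0; have := H e e0; apply: filterS => n /= /andP[h1 h2].
rewrite ler_norml; lra.
Qed.

Lemma bounds_of_cvg_EFin (R : realType) (u : nat -> R) (r : R) :
  (u n)%:E @[n --> \oo] --> r%:E ->
  forall e, 0 < e -> \forall n \near \oo, r - e <= u n <= r + e.
Proof.
move=> /fine_cvgP[_ /cvgrPdist_le H] e e0; have := H e e0.
apply: filterS => n /=; rewrite ler_norml => /andP[h1 h2].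
by apply/andP; split; lra.
Qed.

Lemma cvg_pinfty_of_ge (R : realType) (u : nat -> R) :
  (forall A, \forall n \near \oo, A <= u n) -> (u n)%:E @[n --> \oo] --> +oo%E.
Proof. by move=> H; apply/cvgeryP/cvgryPge. Qed.

Lemma ge_of_cvg_pinfty (R : realType) (u : nat -> R) :
  (u n)%:E @[n --> \oo] --> +oo%E -> forall A, \forall n \near \oo, A <= u n.
Proof. by move=> /cvgeryP/cvgryPge. Qed.

Lemma near_addn (k : nat) (Q : nat -> Prop) :
  (\forall n \near \oo, Q (n + k)%N) -> \forall n \near \oo, Q n.
Proof.
move=> [N _ HN]; exists (N + k)%N => // n /= Nn.
have kn : (k <= n)%N by rewrite (leq_trans _ Nn)// leq_addl.
by rewrite -(subnK kn); apply: HN => /=; rewrite leq_subRL// addnC.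
Qed.

Lemma near_natmul (R : realType) (e a : R) : 0 < e ->
  \forall n \near \oo, a <= e * n%:R.
Proof.
move=> e0; near=> n; rewrite -ler_pdivrMl//; near: n; exact: nbhs_infty_ger.
Unshelve. all: by end_near.
Qed.

(** Two sequences that dominate each other up to bounded index shifts and errors of
    order o(n) grow at the same rate, be it finite or +oo. *)
Lemma cvg_ratio_interleave (R : realType) (U U' : nat -> R) (k k' : nat)
    (l : \bar R) : (-oo < l)%E ->
  (forall e, 0 < e -> \forall n \near \oo, U n - e * n%:R <= U' (n + k)%N) ->
  (forall e, 0 < e -> \forall n \near \oo, U' n - e * n%:R <= U (n + k')%N) ->
  (U n / n%:R)%:E @[n --> \oo] --> l -> (U' n / n%:R)%:E @[n --> \oo] --> l.
Proof.
move=> lNy H H'; case: l lNy => [r| |]// _ Hl.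
- apply: cvg_EFin_of_bounds => e e0.
  have d0 : 0 < e / 3 by lra.
  have bU := bounds_of_cvg_EFin Hl d0.
  have lo : \forall n \near \oo, r - e <= U' n / n%:R.
    apply: (@near_addn k).
    have h1 := H _ d0.
    have h2 := @near_natmul R (e / 3) ((r - e) * k%:R) d0.
    near=> n.
    have n0 : (0 < n)%N by near: n; exists 1%N.
    have n0R : 0 < n%:R :> R by rewrite ltr0n.
    have b1 : r - e / 3 <= U n / n%:R <= r + e / 3 by near: n.
    have b2 : U n - e / 3 * n%:R <= U' (n + k)%N by near: n.
    have b3 : (r - e) * k%:R <= e / 3 * n%:R by near: n.
    rewrite ler_pdivlMr ?ltr0n ?addn_gt0 ?n0//.
    move: b1; rewrite ler_pdivlMr// => /andP[b1 _].
    rewrite natrD; nra.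
  have up : \forall n \near \oo, U' n / n%:R <= r + e.
    have h1 := H' _ d0.
    have h2 := @near_natmul R (e / 3) ((r + e / 3) * k'%:R) d0.
    have bU' : \forall n \near \oo, U (n + k')%N / (n + k')%:R <= r + e / 3.
      case: bU => N _ HN; exists N => // n /= Nn.
      by have /andP[] := HN (n + k')%N (leq_trans Nn (leq_addr _ _)).
    near=> n.
    have n0 : (0 < n)%N by near: n; exists 1%N.
    have n0R : 0 < n%:R :> R by rewrite ltr0n.
    have b1 : U (n + k')%N / (n + k')%:R <= r + e / 3 by near: n.
    have b2 : U' n - e / 3 * n%:R <= U (n + k')%N by near: n.
    have b3 : (r + e / 3) * k'%:R <= e / 3 * n%:R by near: n.
    rewrite ler_pdivrMr//.
    move: b1; rewrite ler_pdivrMr ?ltr0n ?addn_gt0 ?n0// natrD => b1; nra.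
  by near=> n; apply/andP; split; near: n.
- apply: cvg_pinfty_of_ge => A.
  apply: (@near_addn k).
  have h1 := H 1 ltr01.
  have h2 := ge_of_cvg_pinfty Hl (`|A| * k.+1%:R + 1).
  near=> n.
  have n0 : (0 < n)%N by near: n; exists 1%N.
  have n0R : 1 <= n%:R :> R by rewrite ler1n.
  have b1 : `|A| * k.+1%:R + 1 <= U n / n%:R by near: n.
  have b2 : U n - 1 * n%:R <= U' (n + k)%N by near: n.
  rewrite ler_pdivlMr ?ltr0n ?addn_gt0 ?n0//.
  move: b1; rewrite ler_pdivlMr ?ltr0n// => b1.
  have Ale := ler_norm A; have A0 := normr_ge0 A.
  have k0 : 0 <= k%:R :> R by [].
  apply: (@le_trans _ _ (`|A| * (n + k)%:R)); first by rewrite ler_wpM2r.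
  apply: (@le_trans _ _ (`|A| * (k.+1%:R * n%:R))).
    rewrite ler_wpM2l// -natrM ler_nat mulSn leq_add2l leq_pmulr//.
  by rewrite mulrA; lra.
Unshelve. all: by end_near.
Qed.

(** The centre r may change with delta and eta. Since u is bounded, so are the centres,
    the windows shrink, and u is a Cauchy sequence. *)
Lemma cvg_of_sandwich (R : realType) (u : nat -> R) :
  (forall delta eta : R, 0 < delta -> 0 < eta -> exists eta' (l : \bar R),
    [/\ 0 < eta' <= Num.min eta (1 / 2), (-oo < l)%E,
        l = +oo%E -> (u n)%:E @[n --> \oo] --> +oo%E
      & forall r : R, l = r%:E ->
        \forall n \near \oo, (1 - eta') * r - delta <= u n <= (1 + eta') * r + delta])
  -> exists2 l : \bar R, (-oo < l)%E & (u n)%:E @[n --> \oo] --> l.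
Proof.
move=> H.
have [Hy|nHy] := pselect ((u n)%:E @[n --> \oo] --> +oo%E).
  by exists +oo%E; rewrite ?ltNyy.
have {}H (delta eta : R) : 0 < delta -> 0 < eta -> exists eta' r : R,
    0 < eta' <= Num.min eta (1 / 2) /\
    \forall n \near \oo, (1 - eta') * r - delta <= u n <= (1 + eta') * r + delta.
  move=> d0 e0; have [eta' [l [h1 lNy ly lr]]] := H _ _ d0 e0.
  case: l lNy ly lr => [r| |]// _ ly lr; last by case: nHy; exact: ly.
  by exists eta', r; split => //; exact: lr.
have [B HB] : exists B : R, \forall n \near \oo, `|u n| <= B.
  have [eta' [r [/andP[e0 e1] Hr]]] := H 1 1 ltr01 ltr01.
  move: e1; rewrite le_min => /andP[_ e1].
  exists (2 * `|r| + 1); move: Hr; apply: filterS => n /andP[h1 h2].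
  have := ler_norm r; have := ler_norm (- r); rewrite normrN => a1 a2.
  have a3 := normr_ge0 r.
  rewrite ler_norml; nra.
have B0 : 0 <= B.
  by have [n Hn] := filter_ex HB; exact: le_trans (normr_ge0 _) Hn.
have cv : cvg (u @ \oo).
  apply/cauchy_cvgP/cauchyP => e e0.
  (* Every centre satisfies `|r| <= 2 * B + 2, so that eta' * `|r| <= e / 8. *)
  pose D := 8 * (2 * B + 2 + 1).
  have D0 : 0 < D by rewrite /D; lra.
  have m0 : 0 < Num.min (e / 8) 1 by rewrite lt_min ltr01 divr_gt0.
  have [eta' [r [/andP[h0 h1] Hr]]] := H _ _ m0 (divr_gt0 e0 D0).
  move: h1; rewrite le_min => /andP[h1 h2].
  exists r.
  have rB : `|r| <= 2 * B + 2.
    have [n [Hn /andP[n1 n2]]] := filter_ex (filterI HB Hr).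
    have m1 : Num.min (e / 8) 1 <= 1 by rewrite ge_min lexx orbT.
    move: Hn; rewrite ler_norml => /andP[n3 n4].
    rewrite ler_norml; nra.
  move: Hr; apply: filterS => n /andP[n1 n2].
  have m1 : Num.min (e / 8) 1 <= e / 8 by rewrite ge_min lexx.
  rewrite /ball /= /ball_ /=.
  have k1 : eta' * `|r| <= e / 8.
    move: h1; rewrite ler_pdivlMr// /D => h1.
    have := normr_ge0 r; nra.
  have k2 : `|eta' * r| <= e / 8 by rewrite normrM (gtr0_norm h0).
  move: k2; rewrite ler_norml => /andP[k2 k3].
  rewrite ltr_norml; lra.
exists (lim (u @ \oo))%:E; first exact: ltNyr.
by apply: cvg_EFin => //; exact: nearW.
Qed.

(** * Step counts that follow a weight vector *)

Section LatticePoints.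
Context (R : realType) (d : nat) (steps : {fset 'rV[int]_d}).

Definition lattice_point (e : steps -> nat) : 'rV[int]_d :=
  \sum_z val z *+ e z.

Lemma lattice_point_path (e : steps -> nat) :
  exists2 t : seq steps, size t = (\sum_z e z)%N & endpoint t = lattice_point e.
Proof.
exists (flatten [seq nseq (e z) z | z <- enum {: steps}]).
  rewrite size_flatten /shape -map_comp sumnE big_map big_enum /=.
  by apply: eq_bigr => z _; rewrite size_nseq.
rewrite /endpoint big_flatten big_map big_enum /=.
by apply: eq_bigr => z _; rewrite -/(endpoint _) endpoint_nseq.
Qed.

Lemma lattice_point_coord (e : steps -> nat) i :
  (lattice_point e ord0 i)%:~R = \sum_(z : steps) (e z)%:R * ((val z) ord0 i)%:~R :> R.
Proof.
rewrite /lattice_point summxE rmorph_sum /=; apply: eq_bigr => z _.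
by rewrite mulmxnE rmorphMn /= mulr_natl.
Qed.

Definition simplex (beta : steps -> R) : Prop :=
  (forall z, 0 <= beta z) /\ \sum_z beta z = 1.

Definition barycenter (beta : steps -> R) : 'rV[R]_d :=
  \sum_z beta z *: real_point R (val z).

(** Both the counts in the definition of the points xhat and the multiples of an
    integer vector are of this kind. The second condition keeps the counts on the face
    of the simplex that carries beta. *)
Definition tracks (beta : steps -> R) (c : nat -> steps -> nat) (K : R) : Prop :=
  [/\ forall n, (\sum_z c n z)%N = n,
      forall n z, beta z = 0 -> c n z = 0%N
    & forall n z, `|(c n z)%:R - n%:R * beta z| <= K].

Lemma tracks_le beta c K n z : tracks beta c K -> (c n z <= n)%N.
Proof. by case=> H _ _; rewrite -{2}(H n) (bigD1 z)//= leq_addr. Qed.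

Lemma support_lower_bound (beta : steps -> R) : simplex beta ->
  exists2 b : R, 0 < b & forall z, beta z != 0 -> b <= beta z.
Proof.
move=> [b0 b1].
have H : forall z, exists b, 0 < b /\ (beta z != 0 -> b <= beta z).
  move=> z; have [->|bz] := eqVneq (beta z) 0; first by exists 1.
  by exists (beta z); split=> //; rewrite lt_neqAle eq_sym bz b0.
have {H}[f Hf] := choice H.
exists (\big[Num.min/1]_z f z).
  by apply: lt_bigmin => // z _; have [] := Hf z.
move=> z bz; apply: (@le_trans _ _ (f z)); last by have [_ ->] := Hf z.
exact: bigmin_le_cond.
Qed.

(** The conclusion, a factorization through a finite type, is the form that suits
    pigeonhole arguments. *)
Lemma bounded_lattice_values (v : nat -> 'rV[int]_d) (B : nat) :
  (forall n i, (`|v n ord0 i| <= B)%N) ->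
  exists (T : finType) (f : nat -> T), forall m n, f m = f n -> v m = v n.
Proof.
move=> H.
exists {ffun 'I_d -> 'I_(B + B).+1}.
exists (fun n => [ffun i => inord (absz (v n ord0 i + B%:Z))]) => m n /ffunP fmn.
have key (x y : int) : (`|x| <= B)%N -> (`|y| <= B)%N ->
    (inord (absz (x + B%:Z)) : 'I_(B + B).+1) =
    (inord (absz (y + B%:Z)) : 'I_(B + B).+1) -> x = y.
  move=> hx hy /(congr1 val) /=; rewrite !inordK; lia.
apply/rowP => i; have := fmn i; rewrite !ffunE; exact: key.
Qed.

Lemma recurrent_value (T : finType) (f : nat -> T) (N : nat) :
  exists n1 n2, (n1 + N < n2)%N /\ f n1 = f n2.
Proof.
pose h (i : 'I_(#|T|.+1)) := f (i * N.+1)%N.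
have : ~~ injectiveb h.
  apply/negP => /injectiveP /leq_card; by rewrite card_ord ltnn.
case/injectivePn => i [j ij hij].
have wl i' j' : (i' < j')%N -> (i' * N.+1 + N < j' * N.+1)%N.
  by move=> lt; rewrite -addnS -mulSnr leq_mul2r lt orbT.
have [lt|gt|/val_inj e] := ltngtP i j.
- by exists (i * N.+1)%N, (j * N.+1)%N; split => //; exact: wl.
- by exists (j * N.+1)%N, (i * N.+1)%N; split => //; exact: wl.
- by rewrite e eqxx in ij.
Qed.

Lemma early_value (T : finType) (f : nat -> T) :
  exists N0, forall n, exists2 m, (m <= N0)%N & f m = f n.
Proof.
have H (t : T) : exists m, (exists n, f n = t) -> f m = t.
  have [[n fn]|ne] := pselect (exists n, f n = t); last by exists 0%N.
  by exists n.
have {H}[g Hg] := choice H.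
exists (\max_t g t)%N => n; exists (g (f n)); last by apply: Hg; exists n.
exact: leq_bigmax.
Qed.

Variables (beta beta' : steps -> R) (c c' : nat -> steps -> nat) (K K' : R).
Hypotheses (sb : simplex beta) (sb' : simplex beta').
Hypothesis bary : barycenter beta = barycenter beta'.
Hypotheses (tc : tracks beta c K) (tc' : tracks beta' c' K').

Let v n := lattice_point (c' n) - lattice_point (c n).

(** The contributions n * barycenter of the two sequences cancel, and the deviations
    from them are bounded. *)
Lemma tracks_bounded_difference :
  exists B, forall n i, (`|v n ord0 i| <= B)%N.
Proof.
have [_ _ hc] := tc; have [_ _ hc'] := tc'.
pose A i : R := \sum_(z : steps) (K' + K) * `|((val z) ord0 i)%:~R|.
exists (\max_i (Num.truncn (A i)).+1)%N => n i.
apply: (@leq_trans (Num.truncn (A i)).+1); last first.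
  exact: (@leq_bigmax _ (fun i => (Num.truncn (A i)).+1)).
rewrite -(ler_nat R).
apply: le_trans (ltW (truncnS_gt (A i))).
have -> : (`|v n ord0 i|%N)%:R = `| (v n ord0 i)%:~R | :> R.
  by rewrite natr_absz intr_norm.
have eqn : (v n ord0 i)%:~R = \sum_(z : steps)
   (((c' n z)%:R - n%:R * beta' z) - ((c n z)%:R - n%:R * beta z)) *
   ((val z) ord0 i)%:~R :> R.
  have e0 : \sum_(z : steps) n%:R * (beta' z - beta z) * ((val z) ord0 i)%:~R = 0.
    have := bary => /rowP /(_ i); rewrite /barycenter !summxE => e.
    under eq_bigr do rewrite -mulrA mulrBl.
    rewrite -mulr_sumr sumrB.
    have E (g : steps -> R) : \sum_(z : steps) g z * ((val z) ord0 i)%:~R =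
       \sum_z (g z *: real_point R (val z)) ord0 i.
      by apply: eq_bigr => z _; rewrite !mxE.
    by rewrite !E e subrr mulr0.
  have vE : v n ord0 i = lattice_point (c' n) ord0 i - lattice_point (c n) ord0 i.
    by rewrite /v mxE; congr (_ + _); rewrite mxE.
  have -> : \sum_(z : steps)
     (((c' n z)%:R - n%:R * beta' z) - ((c n z)%:R - n%:R * beta z)) *
       ((val z) ord0 i)%:~R =
     \sum_(z : steps) (c' n z)%:R * ((val z) ord0 i)%:~R
     - \sum_(z : steps) (c n z)%:R * ((val z) ord0 i)%:~R
     - \sum_(z : steps) n%:R * (beta' z - beta z) * ((val z) ord0 i)%:~R.
    by rewrite -!sumrB; apply: eq_bigr => z _; ring.
  by rewrite e0 subr0 vE rmorphB /= !lattice_point_coord.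
rewrite eqn; apply: le_trans (ler_norm_sum _ _ _) _.
apply: ler_sum => z _; rewrite normrM ler_wpM2r//.
by apply: (le_trans (ler_normB _ _)); rewrite lerD.
Qed.

(** The difference v n = lattice_point (c' n) - lattice_point (c n) takes finitely
    many values. Choose m <= N0 with v m = v n, and n1, n2 far apart with v n1 = v n2.
    The integer vector e below, an increment of c' from n to n + k corrected by
    c' m - c m and by N0 w, leads from the endpoint of c n to that of c' (n + k),
    because the correction by w has total displacement v n1 - v n2 = 0. It is
    nonnegative, hence realized by a word: where beta' is positive the increment over
    k steps prevails, and where only beta is positive the term w, which grows with the
    gap between n1 and n2, outweighs c m. *)
Lemma tracks_bridge : exists k, forall n, exists2 t : seq steps,
  size t = k & lattice_point (c' (n + k)%N) = lattice_point (c n) + endpoint t.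
Proof.
have [B HB] := tracks_bounded_difference.
have [T [f Hf]] := bounded_lattice_values HB.
have [N0 HN0] := early_value f.
have [b b0 Hb] := support_lower_bound sb.
have [b' b0' Hb'] := support_lower_bound sb'.
have [sc zc hc] := tc; have [sc' zc' hc'] := tc'.
(* The gap N makes c grow between n1 and n2 in every direction of its support. *)
pose N := (Num.truncn ((2 * K) / b)).+1.
have [n1 [n2 [n12 /Hf vv]]] := recurrent_value f N.
(* In k steps c' grows by more than all corrections can remove. *)
pose k := (Num.truncn ((2 * K' + (N0 + N0 * (n1 + n2))%:R) / b')).+1.
exists k => n.
have [m mN0 /Hf vm] := HN0 n.
pose w z : int := (c n2 z)%:Z - (c n1 z)%:Z - ((c' n2 z)%:Z - (c' n1 z)%:Z).
pose e z : int := (c' (n + k)%N z)%:Z - (c' n z)%:Z +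
   ((c' m z)%:Z - (c m z)%:Z) + N0%:Z * w z.
have e0 z : 0 <= e z.
  have cm : (c m z <= N0)%N by rewrite (leq_trans (tracks_le _ _ tc)).
  have [b'z|b'z] := eqVneq (beta' z) 0; last first.
    have g : ((c' n z + N0 + N0 * (n1 + n2))%N <= c' (n + k)%N z)%N.
      rewrite -(ler_nat R) -addnA natrD.
      have h1 := hc' n z; have h2 := hc' (n + k)%N z.
      move: h1 h2; rewrite !ler_norml natrD => /andP[h1 h2] /andP[h3 h4].
      have h5 : 2 * K' + (N0 + N0 * (n1 + n2))%:R <= k%:R * beta' z.
        apply: (@le_trans _ _ (k%:R * b')); last by rewrite ler_wpM2l// Hb'.
        rewrite -ler_pdivrMr//; exact/ltW/truncnS_gt.
      move: h5; set X := (N0 + _)%:R => h5; lra.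
    have l1 := tracks_le n1 z tc; have l2 := tracks_le n2 z tc'.
    have w1 : - (n1 + n2)%:Z <= w z by rewrite /w; lia.
    have : - (N0%:Z * (n1 + n2)%:Z) <= N0%:Z * w z.
      by rewrite -mulrN ler_wpM2l.
    move: g cm; rewrite /e -(lez_nat _ (c' (n + k)%N z)) !PoszD PoszM PoszD; lia.
  have z0 p : c' p z = 0%N by exact: zc'.
  have [bz|bz] := eqVneq (beta z) 0.
    by rewrite /e /w !z0 !zc.
  have w1 : 1 <= w z.
    have : (c n1 z < c n2 z)%N.
      rewrite -(ltr_nat R).
      have h1 := hc n1 z; have h2 := hc n2 z.
      move: h1 h2; rewrite !ler_norml => /andP[h1 h2] /andP[h3 h4].
      have h5 : 2 * K < (n2%:R - n1%:R) * beta z.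
        apply: (@lt_le_trans _ _ (N%:R * b)).
          by rewrite -ltr_pdivrMr//; exact: truncnS_gt.
        apply: ler_pM => //; [exact: ltW| |exact: Hb].
        rewrite lerBrDl -natrD ler_nat; exact: ltnW.
      lra.
    by rewrite /w !z0; lia.
  have : N0%:Z * 1 <= N0%:Z * w z by rewrite ler_wpM2l.
  by move: cm; rewrite /e !z0 mulr1; lia.
have absE z : (`|e z|%N)%:Z = e z by rewrite gez0_abs.
have [t st et] := lattice_point_path (fun z => `|e z|%N).
have sumc (g : nat -> steps -> nat) p : (\sum_z g p z)%N = p ->
   \sum_z (g p z)%:Z = p%:Z.
  by move=> gp; rewrite -[in RHS]gp (big_morph _ PoszD (erefl 0%:Z)).
exists t.
  rewrite st; apply/eqP; rewrite -eqz_nat (big_morph _ PoszD (erefl 0%:Z)).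
  under eq_bigr do rewrite absE /e /w.
  rewrite !big_split /= -mulr_sumr !big_split /= !sumrN !big_split /= !sumrN.
  rewrite !sumc//; apply/eqP; rewrite PoszD; ring.
rewrite et.
have lpE (g : steps -> nat) : lattice_point g = \sum_z (g z)%:Z *: val z.
  by apply: eq_bigr => z _; rewrite -[X in X *: _]natz scaler_nat.
have -> : lattice_point (fun z => `|e z|%N) =
   lattice_point (c' (n + k)%N) - lattice_point (c' n) +
   (lattice_point (c' m) - lattice_point (c m)) +
   N0%:Z *: (lattice_point (c n2) - lattice_point (c n1) -
    (lattice_point (c' n2) - lattice_point (c' n1))).
  rewrite !lpE -!sumrB -big_split /= scaler_sumr -big_split /=.
  apply: eq_bigr => z _; rewrite absE /e /w.
  by rewrite !scalerDl -scalerA !scalerDl !scaleNr !scalerBl.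
have -> : lattice_point (c n2) - lattice_point (c n1) -
    (lattice_point (c' n2) - lattice_point (c' n1)) = v n1 - v n2.
  by rewrite /v !opprB addrACA [RHS]addrACA [X in _ = X + _]addrC.
rewrite vv subrr scaler0 addr0 -[_ (c' m) - _]/(v m) vm /v.
by rewrite [X in _ = _ + X]addrA subrK [RHS]addrC subrK.
Qed.

End LatticePoints.

(** * Rates along arbitrary weights *)

(** The indices J n and J' n are chosen so that J n * m and J' n * m are about
    (1 + eta) n and (1 - eta) n: the sequence L, run at speed 1 / m, is compared with
    U shortly after and shortly before time n. *)
Lemma sandwich_limits (R : realType) (U L : nat -> R) (J J' : nat -> nat)
    (m : nat) (eta delta : R) (l : \bar R) :
  (0 < m)%N -> 0 < eta -> eta <= 1 / 2 -> 0 < delta ->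
  (forall n, (1 + eta) * n%:R <= (J n)%:R * m%:R <= (1 + eta) * n%:R + m%:R) ->
  (forall n, (1 - eta) * n%:R - m%:R <= (J' n)%:R * m%:R <= (1 - eta) * n%:R) ->
  (L j / j%:R)%:E @[j --> \oo] --> l ->
  (\forall n \near \oo, U n - delta * n%:R <= L (J n)) ->
  (\forall n \near \oo, L (J' n) - delta * n%:R <= U n) ->
  (l = +oo%E -> (U n / n%:R)%:E @[n --> \oo] --> +oo%E) /\
  (forall r : R, l = (r * m%:R)%:E -> \forall n \near \oo,
     (1 - eta) * r - 5 * delta <= U n / n%:R <= (1 + eta) * r + 5 * delta).
Proof.
move=> m0 e0 e1 d0 hJ hJ' cL up lo.
have m1 : 1 <= m%:R :> R by rewrite ler1n.
have m0' : 0 < m%:R :> R by rewrite ltr0n.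
have JN (k : nat) : \forall n \near \oo, (k <= J n)%N /\ (k <= J' n)%N.
  have /(@near_natmul R _ ((k.+1 * m)%:R)) h : 0 < 1 - eta by lra.
  move: h; apply: filterS => n h.
  have /andP[a1 _] := hJ n; have /andP[a2 _] := hJ' n.
  move: h; rewrite natrM => h.
  have N0 : 0 <= n%:R :> R by [].
  split; rewrite -(ler_nat R) -(ler_pM2r m0'); move: h; rewrite -natr1; nra.
have pull (Q : nat -> Prop) : (\forall j \near \oo, Q j) ->
    \forall n \near \oo, Q (J n) /\ Q (J' n).
  move=> [k _ Hk]; move: (JN k); apply: filterS => n [h1 h2].
  by split; exact: Hk.
split => [ly|r lr].
  rewrite ly in cL; apply: cvg_pinfty_of_ge => A.
  have [B Ale A0] : exists2 B : R, A <= B & 0 <= B by exists `|A|; rewrite ?ler_norm.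
  have Lbig := pull _ (ge_of_cvg_pinfty cL (4 * m%:R * (B + delta))).
  have hn := @near_natmul R (1 / 4) m%:R.
  have hq : 0 < 1 / 4 :> R by lra.
  apply: filter_app Lbig; apply: filter_app (JN 1%N); apply: filter_app (hn hq).
  apply: filter_app lo; exists 0%N => // n _ b1 b2 [_ j0] [_].
  have j0R : 0 < (J' n)%:R :> R by rewrite ltr0n.
  have n0 : 0 < n%:R :> R by nra.
  rewrite ler_pdivlMr// ler_pdivlMr// => b3.
  have /andP[a2 _] := hJ' n.
  set N : R := n%:R in b1 b2 n0 a2 *; set y : R := (J' n)%:R in j0R b3 a2.
  set M : R := m%:R in b2 b3 a2.
  have en : eta * N <= 1 / 2 * N by rewrite ler_wpM2r// ltW.
  have c1 : N <= 4 * (y * M) by lra.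
  have c2 : (B + delta) * N <= (B + delta) * (4 * (y * M)).
    by rewrite ler_wpM2l//; lra.
  have c3 : A * N <= B * N by rewrite ler_wpM2r// ltW.
  lra.
rewrite lr in cL.
have [B [r1 r2 r0]] : exists B : R, [/\ r <= B, - r <= B & 0 <= B].
  by exists `|r|; rewrite ler_norm -normrN ler_norm normr_ge0.
have Lnear := pull _ (bounds_of_cvg_EFin cL d0).
have hn := @near_natmul R delta (B * m%:R + m%:R * delta) d0.
apply: filter_app Lnear; apply: filter_app (JN 1%N); apply: filter_app hn.
apply: filter_app lo; apply: filter_app up.
exists 0%N => // n _ b1 b2 b3 [i0 j0] [c1 c2].
have i0R : 0 < (J n)%:R :> R by rewrite ltr0n.
have j0R : 0 < (J' n)%:R :> R by rewrite ltr0n.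
move: c1 c2 => /andP[_ c1] /andP[c2 _].
rewrite ler_pdivrMr// in c1; rewrite ler_pdivlMr// in c2.
have /andP[a1 a2] := hJ n; have /andP[a3 a4] := hJ' n.
have n0 : 0 < n%:R :> R.
  by rewrite ltNge; apply/negP => h; nra.
set N : R := n%:R in b1 b2 b3 a1 a2 a3 a4 n0 *.
set x : R := (J n)%:R in b1 c1 i0R a1 a2.
set y : R := (J' n)%:R in b2 c2 j0R a3 a4.
set M : R := m%:R in m1 m0' b3 c1 c2 a1 a2 a3 a4.
have t1 : x <= x * M by rewrite ler_peMr// ltW.
have t2 : y <= y * M by rewrite ler_peMr// ltW.
have p1 : r * (x * M - (1 + eta) * N) <= B * M.
  apply: (@le_trans _ _ (B * (x * M - (1 + eta) * N))).
    by apply: ler_wpM2r => //; lra.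
  by apply: ler_wpM2l => //; lra.
have p2 : r * (y * M - (1 - eta) * N) >= - (B * M).
  rewrite -lerN2 opprK -mulrN.
  apply: (@le_trans _ _ (B * (- (y * M - (1 - eta) * N)))).
    by apply: ler_wpM2r => //; lra.
  by apply: ler_wpM2l => //; lra.
have q1 : delta * x <= delta * ((1 + eta) * N + M) by rewrite ler_pM2l//; lra.
have q2 : delta * y <= delta * ((1 - eta) * N) by rewrite ler_pM2l//; lra.
have q3 : delta * (eta * N) <= delta * (1 / 2 * N).
  by rewrite ler_pM2l// ler_pM2r.
have q4 : 0 <= delta * (eta * N) by rewrite !mulr_ge0// ltW.
have dN : 0 <= delta * N by rewrite mulr_ge0// ltW.
have Md : 0 <= M * delta by rewrite mulr_ge0// ltW.
have BM : 0 <= B * M by rewrite mulr_ge0// ltW.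
rewrite ler_pdivlMr// ler_pdivrMr//; apply/andP; split; lra.
Qed.

(** The arithmetic of comparing a count c, within K of N * be, with q copies of an
    integer c0 that approximates m * be. If q * m exceeds N by the factor 1 + eta, the
    copies exceed c by an amount comparable to eta * N. *)
Lemma overshoot_bounds (R : realType) (N q m eta b K be c c0 : R) :
  0 <= N -> 0 <= q -> 0 < m -> 0 < eta -> eta <= 1 / 2 -> 0 < b -> b <= be ->
  be <= 1 -> 2 <= m * (eta * b) -> 2 * K + m + 1 <= eta * b * N ->
  (1 + eta) * N <= q * m <= (1 + eta) * N + m ->
  - K <= c - N * be <= K -> m * be <= c0 <= m * be + 1 ->
  eta * b * N / 2 <= q * c0 - c <= 4 * eta * N.
Proof.
move=> N0 q0 m0 e0 e1 b0 bbe be1 hm hn /andP[j1 j2] /andP[h1 h2] /andP[k1 k2].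
have be0 : 0 <= be by lra.
have eN : 0 <= eta * N by rewrite mulr_ge0// ltW.
have etaN : eta * N * b <= eta * N by rewrite ler_piMr//; lra.
have en2 : eta * N <= 1 / 2 * N by rewrite ler_wpM2r.
have qle : q <= eta * b * N + 1.
  have g2 : 2 * N <= m * (eta * b) * N by rewrite ler_wpM2r.
  by rewrite -(ler_pM2r m0); lra.
have s1 : q * (m * be) <= q * c0 by rewrite ler_wpM2l.
have s2 : q * c0 <= q * (m * be + 1) by rewrite ler_wpM2l.
have s3 : (1 + eta) * N * be <= q * m * be by rewrite ler_wpM2r.
have s4 : q * m * be <= ((1 + eta) * N + m) * be by rewrite ler_wpM2r.
have s5 : eta * N * b <= eta * N * be by rewrite ler_wpM2l.
have s6 : eta * N * be <= eta * N by rewrite ler_piMr.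
have s7 : m * be <= m by rewrite ler_piMr// ltW.
by apply/andP; split; lra.
Qed.

(** The comparison from the other side, with q * m below N by the factor 1 - eta. *)
Lemma undershoot_bounds (R : realType) (N q m eta b K be c c0 : R) :
  0 <= N -> 0 <= q -> 0 < m -> 0 < eta -> eta <= 1 / 2 -> 0 < b -> b <= be ->
  be <= 1 -> 2 <= m * (eta * b) -> 4 * (K + m) <= eta * b * N -> 0 <= K ->
  (1 - eta) * N - m <= q * m <= (1 - eta) * N ->
  - K <= c - N * be <= K -> m * be <= c0 <= m * be + 1 ->
  eta * b * N / 4 <= c - q * c0 <= 2 * eta * N.
Proof.
move=> N0 q0 m0 e0 e1 b0 bbe be1 hm hn K0 /andP[j1 j2] /andP[h1 h2] /andP[k1 k2].
have be0 : 0 <= be by lra.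
have eN : 0 <= eta * N by rewrite mulr_ge0// ltW.
have etaN : eta * N * b <= eta * N by rewrite ler_piMr//; lra.
have qle : q <= eta * b * N / 2.
  have g2 : 2 * N <= m * (eta * b) * N by rewrite ler_wpM2r.
  by rewrite -(ler_pM2r m0); lra.
have s1 : q * (m * be) <= q * c0 by rewrite ler_wpM2l.
have s2 : q * c0 <= q * (m * be + 1) by rewrite ler_wpM2l.
have s3 : ((1 - eta) * N - m) * be <= q * m * be by rewrite ler_wpM2r.
have s4 : q * m * be <= ((1 - eta) * N) * be by rewrite ler_wpM2r.
have s5 : eta * N * b <= eta * N * be by rewrite ler_wpM2l.
have s6 : eta * N * be <= eta * N by rewrite ler_piMr.
have s7 : m * be <= m by rewrite ler_piMr// ltW.
by apply/andP; split; lra.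
Qed.

Section Rates.
Context (R : realType) (d : nat) (steps : {fset 'rV[int]_d}).
Variable Zs : nat -> 'rV[int]_d -> R.

Definition log_sum (e : steps -> nat) : R :=
  ln (Zs (\sum_z e z)%N (lattice_point e)).

Hypothesis Zs_gt0 : forall s : seq steps, 0 < Zs (size s) (endpoint s).
Hypothesis short_bridge : forall (K : nat) (delta : R), 0 < delta ->
  \forall n \near \oo, forall x (t : seq steps), (size t <= K)%N ->
    Zs n x * expR (- (delta * n%:R)) <= Zs (n + size t)%N (x + endpoint t).
Hypothesis long_bridge : forall (C : nat) (delta : R), 0 < delta ->
  exists2 eps : R, 0 < eps &
  \forall n \near \oo, forall x (e : steps -> nat) (y : steps), val y != 0 ->
    (forall z, (e z)%:R <= eps * n%:R) ->
    (forall z, val z = 0 -> (e z <= C * e y)%N) ->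
    Zs n x * expR (- (delta * n%:R)) <=
    Zs (n + \sum_z e z)%N (x + lattice_point e).
Hypothesis ray : forall c : steps -> nat, (0 < \sum_z c z)%N ->
  exists2 l : \bar R, (-oo < l)%E &
    (log_sum (fun z => j * c z)%N / j%:R)%:E @[j --> \oo] --> l.

Lemma Zs_point_gt0 (e : steps -> nat) : 0 < Zs (\sum_z e z)%N (lattice_point e).
Proof. by have [t <- <-] := lattice_point_path e. Qed.

Lemma ln_bridge (a b x : R) : 0 < a -> a * expR (- x) <= b -> ln a - x <= ln b.
Proof.
move=> a0 h; have ae : 0 < a * expR (- x) by rewrite mulr_gt0// expR_gt0.
have := h; rewrite -ler_ln ?posrE// ?(lt_le_trans ae)//.
by rewrite lnM ?posrE ?expR_gt0// expRK.
Qed.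

Lemma log_sum_short (K : nat) (delta : R) : 0 < delta ->
  \forall n \near \oo, forall (a a' : steps -> nat) (t : seq steps),
    (\sum_z a z)%N = n -> (\sum_z a' z)%N = (n + size t)%N -> (size t <= K)%N ->
    lattice_point a' = lattice_point a + endpoint t ->
    log_sum a - delta * n%:R <= log_sum a'.
Proof.
move=> d0; have := short_bridge K d0; apply: filterS => n H a a' t sa sa' tK e.
rewrite /log_sum sa sa' e; apply: ln_bridge; last exact: H.
by rewrite -sa; exact: Zs_point_gt0.
Qed.

(** The bridge [long_bridge] in terms of the two count vectors that it joins. *)
Lemma log_sum_long (C : nat) (delta : R) : 0 < delta ->
  exists2 eps : R, 0 < eps &
  \forall n \near \oo, forall (a a' : steps -> nat) (y : steps), val y != 0 ->
    (\sum_z a z)%N = n -> (forall z, (a z <= a' z)%N) ->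
    (forall z, (a' z)%:R <= (a z)%:R + eps * n%:R) ->
    (forall z, val z = 0 -> (a' z)%:R - (a z)%:R <= C%:R * ((a' y)%:R - (a y)%:R) :> R) ->
    log_sum a - delta * n%:R <= log_sum a'.
Proof.
move=> d0; have [eps e0 H] := long_bridge C d0; exists eps => //.
move: H; apply: filterS => n H a a' y y0 sa le up zr.
have subR z : ((a' z - a z)%N)%:R = (a' z)%:R - (a z)%:R :> R by rewrite natrB.
have := H (lattice_point a) (fun z => a' z - a z)%N y y0.
have -> : (n + \sum_z (a' z - a z))%N = (\sum_z a' z)%N.
  by rewrite -sa -big_split /=; apply: eq_bigr => z _; rewrite subnKC.
have -> : lattice_point a + lattice_point (fun z => a' z - a z)%N = lattice_point a'.
  by rewrite -big_split /=; apply: eq_bigr => z _; rewrite -mulrnDr subnKC.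
move=> h; rewrite /log_sum sa; apply: ln_bridge.
  by rewrite -sa; exact: Zs_point_gt0.
apply: h => z; first by rewrite subR lerBlDl.
by move=> /zr; rewrite -!subR -natrM ler_nat.
Qed.

(** The bridges of [tracks_bridge] have bounded length and exist in both
    directions. *)
Theorem log_sum_rate_unique (beta beta' : steps -> R) c c' K K' (l : \bar R) :
  simplex beta -> simplex beta' -> barycenter beta = barycenter beta' ->
  tracks beta c K -> tracks beta' c' K' -> (-oo < l)%E ->
  (log_sum (c n) / n%:R)%:E @[n --> \oo] --> l ->
  (log_sum (c' n) / n%:R)%:E @[n --> \oo] --> l.
Proof.
move=> sb sb' bary tc tc' lNy cl.
have [k Hk] := tracks_bridge sb sb' bary tc tc'.
have [k' Hk'] := tracks_bridge sb' sb (esym bary) tc' tc.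
have [sc _ _] := tc; have [sc' _ _] := tc'.
apply: (@cvg_ratio_interleave _ (fun n => log_sum (c n)) _ k k') => // e e0.
  have := log_sum_short k e0; apply: filterS => n H.
  by have [t st Ht] := Hk n; apply: (H _ _ t); rewrite ?st ?sc'.
have := log_sum_short k' e0; apply: filterS => n H.
by have [t st Ht] := Hk' n; apply: (H _ _ t); rewrite ?st ?sc.
Qed.

(** If the walk only uses the zero step, the counts are the multiples of one unit
    vector, a ray. *)
Let rate_cvg_degenerate (beta : steps -> R) c K : simplex beta -> tracks beta c K ->
  (forall z, beta z != 0 -> val z = 0) ->
  exists2 l : \bar R, (-oo < l)%E &
    (log_sum (c n) / n%:R)%:E @[n --> \oo] --> l.
Proof.
move=> [b0 b1] [sc zc _] H.
have [z0 bz0] : exists z0, beta z0 != 0.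
  apply: contrapT => /forallNP h.
  have : \sum_z beta z = 0.
    by apply: big1 => z _; apply/eqP/negPn/negP; exact: h.
  by rewrite b1 => /eqP; rewrite oner_eq0.
have cE n : c n = (fun z => n * (z == z0))%N.
  apply/funext => z.
  have other y : y != z0 -> c n y = 0%N.
    move=> /eqP yz; apply: zc; apply/eqP/negPn/negP => by0; apply: yz.
    by apply: val_inj; rewrite !H.
  have [->|zz] := eqVneq z z0; last by rewrite muln0; exact: other.
  rewrite muln1 -[RHS](sc n) (bigD1 z0)//= big1 ?addn0//.
have s1 : (\sum_z (z == z0))%N = 1%N.
  by rewrite (bigD1 z0)//= eqxx big1 ?addn0// => z /negbTE ->.
have [] := @ray (fun z => (z == z0) : nat); first by rewrite s1.
by move=> l lNy cl; exists l => //; under eq_fun do rewrite cE.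
Qed.

(** The counts c n are compared with multiples of c0, the weights beta rounded up to
    the denominator m. Dilating time by 1 + eta or 1 - eta makes every count larger or
    smaller, so that the difference is a bridge; it has at most eps n steps in each
    direction, and at most C times as many zero steps as steps in direction y. *)
Let rate_cvg_moving (beta : steps -> R) c K y : simplex beta -> tracks beta c K ->
  beta y != 0 -> val y != 0 ->
  exists2 l : \bar R, (-oo < l)%E &
    (log_sum (c n) / n%:R)%:E @[n --> \oo] --> l.
Proof.
move=> sb tc by0 y0.
have [b b_gt0 hb] := support_lower_bound sb.
have [be0 be1] := sb; have [sc zc hc] := tc.
have K0 : 0 <= K by apply: le_trans (hc 0%N y).
have bele z : beta z <= 1.
  by rewrite -be1 (bigD1 z)//= lerDl sumr_ge0.
have b1 : b <= 1 by exact: le_trans (hb y by0) (bele y).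
(* No direction gains more than 8 / b times what direction y gains: the ratios are
   4 eta n to eta b n / 2 above, and 2 eta n to eta b n / 4 below. *)
pose C := (Num.truncn (8 / b)).+1.
have hC : 8 <= C%:R * b.
  by rewrite -ler_pdivrMr//; exact/ltW/truncnS_gt.
apply: cvg_of_sandwich => delta0 eta0 d0 e0.
have d5 : 0 < delta0 / 5 by lra.
set delta := delta0 / 5 in d5.
have [eps eps0 Hlong] := log_sum_long C d5.
(* The bridge from below starts at a time of at least n / 4 and gains 2 eta n, whence
   the factor 8. *)
pose eta := Num.min (Num.min eta0 (1 / 2)) (eps / 8).
have eta_gt0 : 0 < eta by rewrite !lt_min e0 /=; apply/andP; split; lra.
have eta_half : eta <= 1 / 2 by rewrite /eta !ge_min lexx !orbT.
have eta_eps : 8 * eta <= eps.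
  have : eta <= eps / 8 by rewrite /eta !ge_min lexx !orbT.
  lra.
pose m := (Num.truncn (2 / (eta * b))).+1.
have eb0 : 0 < eta * b by rewrite mulr_gt0.
have hm : 2 <= m%:R * (eta * b).
  by rewrite -ler_pdivrMr//; exact/ltW/truncnS_gt.
have m0 : 0 < m%:R :> R by rewrite ltr0n.
pose c0 z := if beta z == 0 then 0%N else (Num.truncn (m%:R * beta z)).+1.
have c0P z : beta z != 0 -> m%:R * beta z <= (c0 z)%:R <= m%:R * beta z + 1.
  move=> bz; rewrite /c0 (negbTE bz).
  have /andP[t1 t2] := @truncn_itv _ (m%:R * beta z) (mulr_ge0 (ltW m0) (be0 z)).
  by rewrite (ltW t2) -natr1 lerD2r t1.
have c00 z : beta z = 0 -> c0 z = 0%N by move=> bz; rewrite /c0 bz eqxx.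
pose M := (\sum_z c0 z)%N.
have mM : (m <= M)%N.
  have mE : m%:R = \sum_z m%:R * beta z by rewrite -mulr_sumr be1 mulr1.
  rewrite -(ler_nat R) mE /M natr_sum.
  apply: ler_sum => z _; have [bz|bz] := eqVneq (beta z) 0.
    by rewrite bz mulr0.
  by have /andP[] := c0P z bz.
have M0 : (0 < M)%N by exact: leq_trans mM.
have [l lNy cl] := ray M0.
pose J n := (Num.truncn ((1 + eta) * n%:R / m%:R)).+1.
pose J' n := Num.truncn ((1 - eta) * n%:R / m%:R).
have eta1 : 0 <= 1 - eta by lra.
have eta2 : 0 <= 1 + eta by lra.
have hJ n : (1 + eta) * n%:R <= (J n)%:R * m%:R <= (1 + eta) * n%:R + m%:R.
  have /andP[t1 t2] := @truncn_itv _ ((1 + eta) * n%:R / m%:R)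
     (divr_ge0 (mulr_ge0 eta2 (ler0n _ n)) (ltW m0)).
  move: t1 t2; rewrite ler_pdivlMr// ltr_pdivrMr// /J => t1 t2.
  by rewrite (ltW t2) -natr1 mulrDl mul1r lerD2r t1.
have hJ' n : (1 - eta) * n%:R - m%:R <= (J' n)%:R * m%:R <= (1 - eta) * n%:R.
  have /andP[t1 t2] := @truncn_itv _ ((1 - eta) * n%:R / m%:R)
     (divr_ge0 (mulr_ge0 eta1 (ler0n _ n)) (ltW m0)).
  move: t1 t2; rewrite ler_pdivlMr// ltr_pdivrMr// -natr1 [X in _ < X]mulrDl mul1r.
  by move=> t1 t2; rewrite t1 andbT lerBlDr ltW.
have big (x : R) : \forall n \near \oo, x <= eta * b * n%:R.
  exact: near_natmul.
have up : \forall n \near \oo,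
    log_sum (c n) - delta * n%:R <= log_sum (fun z => J n * c0 z)%N.
  move: Hlong (big (2 * K + m%:R + 1)); apply: filterS2 => n H hn.
  have N0 : 0 <= n%:R :> R by [].
  have dif z : beta z != 0 ->
      eta * b * n%:R / 2 <= (J n * c0 z)%:R - (c n z)%:R <= 4 * eta * n%:R.
    move=> bz; rewrite natrM.
    apply: (overshoot_bounds N0 _ m0 eta_gt0 eta_half b_gt0 (hb z bz) (bele z)
      hm hn (hJ n) _ (c0P z bz)) => //.
    by rewrite -ler_norml; exact: hc.
  apply: (H _ _ y) => // z.
  - have [bz|bz] := eqVneq (beta z) 0; first by rewrite zc.
    have /andP[k1 _] := dif z bz; rewrite -(ler_nat R) -subr_ge0.
    by apply: le_trans k1; rewrite divr_ge0// mulr_ge0// ltW.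
  - have [bz|bz] := eqVneq (beta z) 0.
      by rewrite zc// c00// muln0 add0r mulr_ge0// ltW.
    have /andP[_ k2] := dif z bz; rewrite -lerBlDl; apply: le_trans k2 _.
    rewrite ler_wpM2r//; lra.
  - move=> _; have /andP[k1 _] := dif y by0.
    have [bz|bz] := eqVneq (beta z) 0.
      rewrite zc// c00// muln0 subrr mulr_ge0//.
      by apply: le_trans k1; rewrite divr_ge0// mulr_ge0// ltW.
    have /andP[_ k2] := dif z bz; apply: (le_trans k2).
    apply: (@le_trans _ _ (C%:R * (eta * b * n%:R / 2))); last by rewrite ler_wpM2l.
    have : 8 * (eta * n%:R) <= C%:R * b * (eta * n%:R).
      by rewrite ler_wpM2r// mulr_ge0// ltW.
    lra.
have lo : \forall n \near \oo,
    log_sum (fun z => J' n * c0 z)%N - delta * n%:R <= log_sum (c n).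
  case: Hlong => N1 _ HN1.
  move: (big (4 * (K + m%:R) + 4 * m%:R * (N1%:R + 1))); apply: filterS => n hn.
  have /andP[j1 j2] := hJ' n.
  have N0 : 0 <= n%:R :> R by [].
  have m1 : 1 <= m%:R :> R by rewrite ler1n.
  have mN1 : 0 <= m%:R * N1%:R :> R by rewrite mulr_ge0// ltW.
  have etaN : eta * b * n%:R <= eta * n%:R.
    by rewrite ler_wpM2r// ler_piMr// ltW.
  have etaN2 : eta * n%:R <= 1 / 2 * n%:R by rewrite ler_wpM2r.
  have hn' : 4 * (K + m%:R) <= eta * b * n%:R.
    apply: le_trans hn; rewrite lerDl !mulr_ge0// ?ltW// addr_ge0//.
  have dif z : beta z != 0 ->
      eta * b * n%:R / 4 <= (c n z)%:R - (J' n * c0 z)%:R <= 2 * eta * n%:R.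
    move=> bz; rewrite natrM.
    apply: (undershoot_bounds N0 _ m0 eta_gt0 eta_half b_gt0 (hb z bz) (bele z)
      hm hn' K0 (hJ' n) _ (c0P z bz)) => //.
    by rewrite -ler_norml; exact: hc.
  have le z : (J' n * c0 z <= c n z)%N.
    have [bz|bz] := eqVneq (beta z) 0; first by rewrite c00// muln0.
    have /andP[k1 _] := dif z bz; rewrite -(ler_nat R) -subr_ge0.
    by apply: le_trans k1; rewrite divr_ge0// mulr_ge0// ltW.
  have sJ : (\sum_z (J' n * c0 z))%N = (J' n * M)%N by rewrite -big_distrr.
  have JM : (J' n * M <= n)%N.
    by rewrite -[leqRHS](sc n) -sJ; apply: leq_sum => z _.
  have NJM : n%:R / 4 <= (J' n * M)%:R :> R.
    apply: (@le_trans _ _ ((J' n)%:R * m%:R)); last first.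
      by rewrite natrM ler_wpM2l// ler_nat.
    lra.
  have NJ : (N1 <= J' n * M)%N.
    rewrite -(ler_nat R); apply: le_trans NJM.
    have : N1%:R <= m%:R * N1%:R :> R by rewrite ler_peMl.
    lra.
  have := HN1 _ NJ (fun z => J' n * c0 z)%N (c n) y y0 sJ le.
  move=> H; apply: le_trans (H _ _) => [|z|z _].
  - by rewrite lerD2l lerN2 ler_wpM2l ?ler_nat// ltW.
  - have [bz|bz] := eqVneq (beta z) 0.
      by rewrite zc// addr_ge0// mulr_ge0// ltW.
    have /andP[_ k2] := dif z bz; rewrite -lerBlDl; apply: le_trans k2 _.
    have f1 : eps * (n%:R / 4) <= eps * (J' n * M)%:R by rewrite ler_wpM2l// ltW.
    have f2 : 8 * eta * n%:R <= eps * n%:R by rewrite ler_wpM2r.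
    lra.
  - have /andP[k1 _] := dif y by0.
    have [bz|bz] := eqVneq (beta z) 0.
      rewrite zc// c00// muln0 subrr mulr_ge0//.
      by apply: le_trans k1; rewrite divr_ge0// mulr_ge0// ltW.
    have /andP[_ k2] := dif z bz; apply: (le_trans k2).
    apply: (@le_trans _ _ (C%:R * (eta * b * n%:R / 4))); last by rewrite ler_wpM2l.
    have : 8 * (eta * n%:R) <= C%:R * b * (eta * n%:R).
      by rewrite ler_wpM2r// mulr_ge0// ltW.
    lra.
have m_gt0 : (0 < m)%N by [].
have [h1 h2] := sandwich_limits m_gt0 eta_gt0 eta_half d5 hJ hJ' cl up lo.
exists eta, (if l is r%:E then (r / m%:R)%:E else +oo%E); split.
- by rewrite eta_gt0 /eta ge_min lexx.
- by case: (l) => [r| |]; rewrite ?ltNyr ?ltNyy.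
- by case: l lNy cl h1 h2 => [r| |]// _ _ h1 _ _; exact: h1.
- case: l lNy cl h1 h2 => [r'| |]// _ _ _ h2 r [rE].
  have h5 : 5 * delta = delta0 by rewrite /delta; lra.
  by rewrite -h5; apply: h2; rewrite -rE divfK// gt_eqF.
Qed.

Theorem log_sum_rate_cvg (beta : steps -> R) c K : simplex beta -> tracks beta c K ->
  exists2 l : \bar R, (-oo < l)%E &
    (log_sum (c n) / n%:R)%:E @[n --> \oo] --> l.
Proof.
move=> sb tc.
have [[y [by0 y0]]|H] := pselect (exists y, beta y != 0 /\ val y != 0).
  exact: (rate_cvg_moving sb tc by0 y0).
apply: (rate_cvg_degenerate sb tc) => z bz.
by apply/eqP/negPn/negP => vz; apply: H; exists z.
Qed.

End Rates.

(** * Free endpoints *)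

Lemma near_ln_le (R : realType) (p : nat) (delta : R) : 0 < delta ->
  \forall n \near \oo, p%:R * ln n.+1%:R <= delta * n%:R.
Proof.
move=> d0; pose e := delta / p.+1%:R.
have e0 : 0 < e by rewrite divr_gt0.
have e20 : 0 < e ^+ 2 / 8 by rewrite divr_gt0// exprn_gt0.
have h := @near_natmul R (e ^+ 2 / 8) 1 e20.
near=> n.
have b1 : 1 <= e ^+ 2 / 8 * n%:R by near: n.
have n1 : (1 <= n)%N by near: n; exists 1%N.
have ln_le : ln n.+1%:R <= e * n%:R.
  rewrite -[leRHS]expRK ler_ln ?posrE ?expR_gt0//.
  have -> : e * n%:R = e * n%:R / 2 + e * n%:R / 2 by rewrite -splitr.
  rewrite expRD; have ge := expR_ge1Dx (e * n%:R / 2).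
  have g0 : 0 <= 1 + e * n%:R / 2.
    by rewrite addr_ge0// divr_ge0// mulr_ge0// ltW.
  apply: le_trans (ler_pM g0 g0 ge ge).
  have n1R : 1 <= n%:R :> R by rewrite ler1n.
  have b2 : n%:R <= e ^+ 2 / 8 * n%:R * n%:R.
    by rewrite -[leLHS]mul1r ler_wpM2r.
  have en0 : 0 <= e * n%:R by rewrite mulr_ge0// ltW.
  have -> : (1 + e * n%:R / 2) * (1 + e * n%:R / 2) =
     1 + e * n%:R + 2 * (e ^+ 2 / 8 * n%:R * n%:R) by rewrite expr2; field.
  rewrite -natr1; lra.
apply: (@le_trans _ _ (p%:R * (e * n%:R))); first by rewrite ler_wpM2l.
rewrite mulrA ler_wpM2r// /e mulrCA ler_piMr ?(ltW d0)//.
by rewrite ler_pdivrMr// mul1r ler_nat.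
Unshelve. all: by end_near.
Qed.

(** The arithmetic of rounding a count a up to a multiple J * s of J, where J is about
    N / k: the shift by 2 in s makes every increment positive and comparable to
    N / k. *)
Lemma coarse_cell_bounds (R : realType) (N k J s a : R) :
  0 < N -> 0 < k -> 0 <= a -> a <= N -> k * (k + 2) <= N -> 0 <= s -> 0 <= J ->
  N <= J * k <= N + k -> k * a + N <= s * N <= k * a + 2 * N ->
  N / k <= J * s - a <= 3 * N / k.
Proof.
move=> N0 k0 a0 aN kN s0 J0 /andP[j1 j2] /andP[s1 s2].
have lo : N * (k * a + N) <= J * k * (s * N).
  by apply: ler_pM => //; rewrite ?addr_ge0 ?mulr_ge0// ltW.
have up : J * k * (s * N) <= (N + k) * (k * a + 2 * N).
  by apply: ler_pM => //; rewrite mulr_ge0// ltW.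
have lo' : k * a + N <= J * s * k.
  rewrite -(ler_pM2l N0); apply: le_trans lo _.
  by rewrite le_eqVlt; apply/orP; left; apply/eqP; ring.
have ak : k * k * a <= k * k * N by rewrite ler_wpM2l// mulr_ge0// ltW.
have kNN : k * (k + 2) * N <= N * N by rewrite ler_wpM2r// ltW.
have up' : J * s * k <= k * a + 3 * N.
  rewrite -(ler_pM2l N0).
  have -> : N * (J * s * k) = J * k * (s * N) by ring.
  apply: le_trans up _; lra.
rewrite ler_pdivrMr// ler_pdivlMr//; apply/andP; split; lra.
Qed.

Section FreeEnd.
Context (R : realType) (d : nat) (steps : {fset 'rV[int]_d}).
Variable Zs : nat -> 'rV[int]_d -> R.
Local Notation logZ := (log_sum Zs).

Hypothesis Zs_gt0 : forall s : seq steps, 0 < Zs (size s) (endpoint s).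
Hypothesis long_bridge : forall (C : nat) (delta : R), 0 < delta ->
  exists2 eps : R, 0 < eps &
  \forall n \near \oo, forall x (e : steps -> nat) (y : steps), val y != 0 ->
    (forall z, (e z)%:R <= eps * n%:R) ->
    (forall z, val z = 0 -> (e z <= C * e y)%N) ->
    Zs n x * expR (- (delta * n%:R)) <=
    Zs (n + \sum_z e z)%N (x + lattice_point e).
Hypothesis ray : forall c : steps -> nat, (0 < \sum_z c z)%N ->
  exists2 l : \bar R, (-oo < l)%E &
    (logZ (fun z => j * c z)%N / j%:R)%:E @[j --> \oo] --> l.

Variables (V : nat -> R) (p : nat) (r : R).
Hypothesis V_gt0 : forall n, 0 < V n.
Hypothesis V_le : forall n, exists2 a : steps -> nat, (\sum_z a z)%N = n &
  V n <= n.+1%:R ^+ p * Zs n (lattice_point a).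
Hypothesis ray_le : forall (c : steps -> nat) (l : \bar R), (0 < \sum_z c z)%N ->
  (logZ (fun z => j * c z)%N / j%:R)%:E @[j --> \oo] --> l ->
  (l <= ((\sum_z c z)%:R * r)%:E)%E.

Let ray_upper (delta : R) (c : steps -> nat) : 0 < delta -> (0 < \sum_z c z)%N ->
  \forall j \near \oo, logZ (fun z => j * c z)%N <=
     j%:R * ((\sum_z c z)%:R * r + delta).
Proof.
move=> d0 c0; have [l lNy cl] := ray c0; have := ray_le c0 cl.
case: l lNy cl => [l| |]// _ cl; rewrite lee_fin => lr.
have := bounds_of_cvg_EFin cl d0.
move=> [N _ HN]; exists N.+1 => // j /= Nj.
have /andP[_] := HN j (ltnW Nj).
rewrite ler_pdivrMr ?ltr0n ?(leq_ltn_trans _ Nj)// => h; apply: le_trans h _.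
by rewrite mulrC ler_wpM2l// lerD2r.
Qed.

Let ln_V_le n (a : steps -> nat) : (\sum_z a z)%N = n ->
  V n <= n.+1%:R ^+ p * Zs n (lattice_point a) ->
  ln (V n) <= p%:R * ln n.+1%:R + logZ a.
Proof.
move=> sa h; have Z0 : 0 < Zs n (lattice_point a) by rewrite -sa; exact: Zs_point_gt0.
apply: (@le_trans _ _ (ln (n.+1%:R ^+ p * Zs n (lattice_point a)))).
  by rewrite ler_ln ?posrE// mulr_gt0// exprn_gt0.
by rewrite lnM ?posrE ?exprn_gt0// lnXn// -[ln _ *+ p]mulr_natl /log_sum sa.
Qed.

(** The count vector provided by [V_le] varies with n, but it is rounded up to a
    multiple of one of the finitely many vectors with entries below k + 3, and the
    increments form a bridge. For n large the bounds of [ray_le] hold for all of these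
    vectors at once. *)
Theorem free_end_upper (eps : R) : 0 < eps ->
  \forall n \near \oo, ln (V n) <= (r + eps) * n%:R.
Proof.
(* Five errors of size delta * n: the polynomial factor, the bridge, the change of
   total length times r, and two for the number J <= 2 n of repetitions. *)
move=> eps0; pose delta := eps / 5.
have d0 : 0 < delta by rewrite divr_gt0.
have hln := near_ln_le p d0.
have [[y y0]|nomove] := pselect (exists y : steps, val y != 0); last first.
  have allz (z : steps) : val z = 0.
    by apply/eqP/negPn/negP => h; apply: nomove; exists z.
  have [a1 sa1 _] := V_le 1.
  have [z0 _] : exists z0 : steps, true.
    apply: contrapT => /forallNP h; move: sa1; rewrite big1// => z _.
    by case: (h z).
  have s1 : (\sum_z (z == z0))%N = 1%N.
    by rewrite (bigD1 z0)//= eqxx big1 ?addn0// => z /negbTE ->.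
  have := @ray_upper delta (fun z => (z == z0) : nat) d0; rewrite s1 => /(_ isT) h.
  near=> n; have [a sa Va] := V_le n.
  apply: le_trans (ln_V_le sa Va) _.
  have -> : logZ a = logZ (fun z => n * (z == z0))%N.
    rewrite /log_sum sa -big_distrr /= s1 muln1; congr (ln (Zs _ _)).
    by rewrite /lattice_point !big1// => z _; rewrite allz mul0rn.
  have b1 : logZ (fun z => n * (z == z0))%N <= n%:R * (1%:R * r + delta) by near: n.
  have b2 : p%:R * ln n.+1%:R <= delta * n%:R by near: n.
  have b3 : 0 <= delta * n%:R by rewrite mulr_ge0// ltW.
  have -> : (r + eps) * n%:R = r * n%:R + 5 * (delta * n%:R).
    by rewrite /delta; field.
  lra.
have [eps' eps'0 Hlong] := log_sum_long Zs_gt0 long_bridge 3 d0.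
pose q := #|{: steps}|.
have [B [rB rB' B0]] : exists B : R, [/\ r <= B, - r <= B & 0 <= B].
  by exists `|r|; rewrite ler_norm -normrN ler_norm normr_ge0.
(* Each increment is at most 3 n / k: this must be below eps' * n, and all q of them
   together, times `|r|, below delta * n. *)
pose k := (Num.truncn (3 / eps' + 3 * q%:R * B / delta)).+1.
have k0 : 0 < k%:R :> R by [].
have hk : 3 / eps' + 3 * q%:R * B / delta < k%:R by exact: truncnS_gt.
have qB : 0 <= 3 * q%:R * B by rewrite !mulr_ge0.
have k_eps : 3 <= eps' * k%:R.
  rewrite mulrC -ler_pdivrMr//; apply: le_trans (ltW hk).
  by rewrite lerDl divr_ge0// ltW.
have k_B : 3 * q%:R * B <= delta * k%:R.
  rewrite [leRHS]mulrC -ler_pdivrMr//; apply: le_trans (ltW hk).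
  by rewrite lerDr divr_ge0// ltW.
have Hray : \forall j \near \oo, forall s : {ffun steps -> 'I_k.+3},
    (0 < \sum_z s z)%N -> logZ (fun z => j * s z)%N <=
     j%:R * ((\sum_z s z)%:R * r + delta).
  apply: filter_forall => s.
  have [s0|s0] := posnP (\sum_z s z)%N; first by near=> j.
  by have := @ray_upper delta (fun z => s z : nat) d0 s0; apply: filterS => j.
have {}Hray : \forall n \near \oo, forall s : {ffun steps -> 'I_k.+3},
    (0 < \sum_z s z)%N -> logZ (fun z => (n %/ k).+1 * s z)%N <=
     (n %/ k).+1%:R * ((\sum_z s z)%:R * r + delta).
  case: Hray => N _ HN; exists (N * k)%N => // n /= Nn.
  by apply: HN => /=; rewrite leqW// leq_divRL.
have Hbig := nbhs_infty_ge (k * (k + 2))%N.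
near=> n; have [a sa Va] := V_le n.
apply: le_trans (ln_V_le sa Va) _.
have n0 : (0 < n)%N by near: n; exists 1%N.
have n0R : 0 < n%:R :> R by rewrite ltr0n.
have kn : (k * (k + 2) <= n)%N by near: n.
have an z : (a z <= n)%N by rewrite -sa (bigD1 z)//= leq_addr.
pose J := (n %/ k).+1.
pose s0 z := ((k * a z) %/ n + 2)%N.
have s0k z : (s0 z < k.+3)%N.
  have : ((k * a z) %/ n <= k)%N.
    by rewrite -[leqRHS](mulnK k n0) leq_div2r// leq_mul2l an orbT.
  by rewrite /s0 addn2 !ltnS.
have hJ : (n%:R <= J%:R * k%:R :> R) && (J%:R * k%:R <= n%:R + k%:R :> R).
  rewrite -natrM -natrD !ler_nat /J ltnW ?ltn_ceil//=.
  by rewrite mulSnr leq_add2r leq_trunc_div.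
have hs z : (k%:R * (a z)%:R + n%:R <= (s0 z)%:R * n%:R :> R) &&
    ((s0 z)%:R * n%:R <= k%:R * (a z)%:R + 2 * n%:R :> R).
  have -> : 2 * n%:R = (2 * n)%:R :> R by rewrite natrM.
  rewrite -!natrM -!natrD !ler_nat /s0.
  rewrite [X in (_ <= X <= _)%N](_ : _ = (k * a z %/ n).+1 * n + n)%N; last first.
    by rewrite -mulSnr addn2.
  rewrite leq_add2r ltnW ?ltn_ceil//=.
  by rewrite mul2n -addnn addnA leq_add2r mulSnr leq_add2r leq_trunc_div.
have knR : k%:R * (k%:R + 2) <= n%:R :> R by rewrite -natrD -natrM ler_nat.
have cell z : (n%:R / k%:R <= (J * s0 z)%:R - (a z)%:R :> R) &&
    ((J * s0 z)%:R - (a z)%:R <= 3 * n%:R / k%:R :> R).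
  by rewrite natrM; apply: coarse_cell_bounds => //; rewrite ler_nat.
have nk0 : 0 <= n%:R / k%:R :> R by rewrite divr_ge0.
have le z : (a z <= J * s0 z)%N.
  by rewrite -(ler_nat R) -subr_ge0; have /andP[h _] := cell z; exact: le_trans h.
have Hl : forall (a a' : steps -> nat) (y : steps), val y != 0 ->
    (\sum_z a z)%N = n -> (forall z, (a z <= a' z)%N) ->
    (forall z, (a' z)%:R <= (a z)%:R + eps' * n%:R) ->
    (forall z, val z = 0 -> (a' z)%:R - (a z)%:R <= 3%:R * ((a' y)%:R - (a y)%:R) :> R) ->
    logZ a - delta * n%:R <= logZ a' by near: n.
have b1 : logZ a - delta * n%:R <= logZ (fun z => J * s0 z)%N.
  apply: (Hl _ _ y) => // z.
    have /andP[_ h] := cell z; rewrite -lerBlDl; apply: le_trans h _.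
    rewrite ler_pdivrMr//.
    have : 3 * n%:R <= eps' * k%:R * n%:R by rewrite ler_wpM2r.
    by rewrite mulrAC.
  move=> _; have /andP[_ h] := cell z; have /andP[h' _] := cell y.
  by apply: le_trans h _; rewrite -mulrA ler_wpM2l.
have S0 : (0 < \sum_z s0 z)%N.
  by rewrite (bigD1 y)//= /s0 addn_gt0 addn_gt0 orbT.
have b2 : logZ (fun z => J * s0 z)%N <= J%:R * ((\sum_z s0 z)%:R * r + delta).
  have Hr : forall s : {ffun steps -> 'I_k.+3},
    (0 < \sum_z s z)%N -> logZ (fun z => (n %/ k).+1 * s z)%N <=
     (n %/ k).+1%:R * ((\sum_z s z)%:R * r + delta) by near: n.
  have := Hr [ffun z => Ordinal (s0k z)].
  have E (F : (steps -> nat) -> R) : F (fun z => [ffun z => Ordinal (s0k z)] z : nat) = F s0.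
    by congr F; apply/funext => z; rewrite ffunE.
  have sE : (\sum_z [ffun z => Ordinal (s0k z)] z)%N = (\sum_z s0 z)%N.
    by apply: eq_bigr => z _; rewrite ffunE.
  rewrite sE S0 => /(_ isT).
  rewrite (E (fun g => logZ (fun z => (n %/ k).+1 * g z)%N)).
  exact.
have sumJ : J%:R * (\sum_z s0 z)%:R - n%:R = \sum_z ((J * s0 z)%:R - (a z)%:R) :> R.
  by rewrite sumrB -!natr_sum -big_distrr /= natrM sa.
have sumlo : 0 <= J%:R * (\sum_z s0 z)%:R - n%:R :> R.
  by rewrite sumJ sumr_ge0// => z _; have /andP[h _] := cell z; exact: le_trans h.
have sumup : J%:R * (\sum_z s0 z)%:R - n%:R <= q%:R * (3 * n%:R / k%:R) :> R.
  rewrite sumJ; apply: (@le_trans _ _ (\sum_(z : steps) 3 * n%:R / k%:R)).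
    by apply: ler_sum => z _; have /andP[] := cell z.
  by rewrite sumr_const -[leLHS]mulr_natl.
have b3 : (J%:R * (\sum_z s0 z)%:R - n%:R) * r <= delta * n%:R.
  apply: (@le_trans _ _ ((J%:R * (\sum_z s0 z)%:R - n%:R) * B)).
    by rewrite ler_wpM2l.
  apply: (@le_trans _ _ (q%:R * (3 * n%:R / k%:R) * B)); first by rewrite ler_wpM2r.
  have -> : q%:R * (3 * n%:R / k%:R) * B = (3 * q%:R * B) * n%:R / k%:R.
    by field; rewrite gt_eqF.
  rewrite ler_pdivrMr//.
  have : 3 * q%:R * B * n%:R <= delta * k%:R * n%:R by rewrite ler_wpM2r// ltW.
  by rewrite -[delta * n%:R * _]mulrAC.
have b4 : p%:R * ln n.+1%:R <= delta * n%:R by near: n.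
have b5 : delta * J%:R <= 2 * (delta * n%:R).
  rewrite mulrCA ler_wpM2l ?(ltW d0)//.
  by rewrite -natrM ler_nat /J mulSn mul1n -addn1 leq_add// leq_div.
have -> : (r + eps) * n%:R = r * n%:R + 5 * (delta * n%:R).
  by rewrite /delta; field.
move: b1 b2 b3 b4 b5; rewrite mulrDr.
move: (\sum_z s0 z)%N => M b1 b2 b3 b4 b5.
lra.
Unshelve. all: by end_near.
Qed.

End FreeEnd.

Section CountVectors.
Context (R : realType) (d ell : nat) (steps : {fset 'rV[int]_d}).
Context (phi : 'rV[int]_d -> ell.-tuple steps -> R) (G : 'rV[int]_d -> R).

Definition free_path_sum (n : nat) : R :=
  \sum_(s : n.-tuple steps) expR (path_energy phi G 0 s).

Lemma path_sum_le_free n x : path_sum phi G 0 n x <= free_path_sum n.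
Proof.
rewrite /free_path_sum [leRHS](bigID (fun s : n.-tuple steps => endpoint s == x)) /=.
by rewrite lerDl; apply: sumr_ge0 => s _; exact: expR_ge0.
Qed.

Lemma endpoint_count (s : seq steps) :
  endpoint s = lattice_point (fun z => count_mem z s).
Proof.
elim: s => [|y s IH].
  by rewrite endpoint_nil /lattice_point big1// => z _; rewrite mulr0n.
rewrite endpoint_cons IH /lattice_point /=.
rewrite (bigD1 y)//= [RHS](bigD1 y)//= eqxx add1n mulrS -addrA; congr (_ + (_ + _)).
by apply: eq_bigr => z /negbTE zy; rewrite eq_sym zy.
Qed.

Lemma sum_count_mem (s : seq steps) : (\sum_z count_mem z s)%N = size s.
Proof.
elim: s => [|y s IH] /=; first by rewrite big1.
rewrite big_split /= IH (bigD1 y)//= eqxx big1 ?addn0//.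
by move=> z /negbTE zy; rewrite eq_sym zy.
Qed.

(** Paths with the same step counts share their endpoint, and there are at most
    (n + 1) ^ #|steps| vectors of step counts. *)
Lemma free_path_sum_le n : (0 < #|{: steps}|)%N ->
  exists2 a : steps -> nat, (\sum_z a z)%N = n &
  free_path_sum n <= n.+1%:R ^+ #|{: steps}| * path_sum phi G 0 n (lattice_point a).
Proof.
move=> /card_gt0P[z0 _].
pose cnt (s : n.-tuple steps) : {ffun steps -> 'I_n.+1} :=
  [ffun z => inord (count_mem z s)].
have cntE (s : n.-tuple steps) z : cnt s z = count_mem z s :> nat.
  by rewrite ffunE inordK// ltnS (leq_trans (count_size _ _))// size_tuple.
pose s0 : n.-tuple steps := nseq_tuple n z0.
pose f (a : {ffun steps -> 'I_n.+1}) := path_sum phi G 0 n (lattice_point (fun z => a z : nat)).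
pose best := [arg max_(s > s0) f (cnt s)]%O.
have bestP s : f (cnt s) <= f (cnt best).
  by rewrite /best; case: arg_maxP => //= i _ ->.
have cntE' s : (fun z => cnt s z : nat) = (fun z => count_mem z s).
  by apply/funext => z; exact: cntE.
exists (fun z => cnt best z : nat).
  by rewrite -[RHS](size_tuple best) -sum_count_mem; apply: eq_bigr => z _; exact: cntE.
rewrite /free_path_sum (partition_big cnt predT)//=.
apply: (@le_trans _ _ (\sum_(a : {ffun steps -> 'I_n.+1}) f (cnt best))); last first.
  by rewrite sumr_const card_ffun card_ord -[leLHS]mulr_natl natrX.
apply: ler_sum => a _.
have [[s /eqP sa]|nos] := pselect (exists s, cnt s == a); last first.
  rewrite big_pred0 ?path_sum_ge0// => s; apply/negbTE/negP => h.
  by apply: nos; exists s.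
apply: le_trans (bestP s); rewrite sa /f /path_sum.
rewrite [leLHS]big_mkcond [leRHS]big_mkcond /=; apply: ler_sum => u _.
case: eqP => [ua|_]; last by case: ifP => // _; exact: expR_ge0.
by rewrite endpoint_count -ua cntE' eqxx.
Qed.

End CountVectors.

Section IntegerRay.
Context (R : realType) (d : nat) (steps : {fset 'rV[int]_d}).
Variable c : steps -> nat.
Let M := (\sum_z c z)%N.
Hypothesis M0 : (0 < M)%N.

Definition ray_weights (z : steps) : R := (c z)%:R / M%:R.

Lemma simplex_ray_weights : simplex ray_weights.
Proof.
split => [z|]; first by rewrite divr_ge0.
by rewrite -mulr_suml -natr_sum divff// pnatr_eq0 -lt0n.
Qed.

Lemma rational_barycenter_ray : rational_point R (barycenter ray_weights).
Proof.
move=> i; exists (\sum_(z : steps) (c z)%:R / M%:R * ((val z) ord0 i)%:~R) => //.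
rewrite rmorph_sum /= summxE; apply: eq_bigr => z _.
by rewrite !mxE rmorphM fmorph_div /= !ratr_nat ratr_int.
Qed.

(** A multiple of c at the multiples of M; the remaining n %% M steps are taken in
    the direction z1. *)
Definition ray_tracking (z1 : steps) (n : nat) (z : steps) : nat :=
  ((n %/ M) * c z + (n %% M) * (z == z1))%N.

Lemma tracks_ray (z1 : steps) : c z1 != 0%N ->
  tracks ray_weights (ray_tracking z1) M%:R.
Proof.
move=> cz1; have MR : 0 < M%:R :> R by rewrite ltr0n.
split => [n|n z /eqP|n z].
- rewrite big_split /= -!big_distrr /= -/M [X in (_ + _ * X)%N](bigD1 z1)//=.
  by rewrite eqxx big1 ?addn0 ?muln1 -?divn_eq// => z /negbTE ->.
- rewrite mulf_eq0 invr_eq0 !pnatr_eq0 (gtn_eqF M0) orbF /ray_tracking => cz.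
  rewrite (eqP cz) muln0 add0n.
  by case: eqP => [e|_]; [rewrite -e cz in cz1|rewrite muln0].
have cM : (c z <= M)%N by rewrite /M (bigD1 z)//= leq_addr.
have nE : n%:R = (n %/ M)%:R * M%:R + (n %% M)%:R :> R.
  by rewrite {1}(divn_eq n M) natrD natrM.
rewrite /ray_tracking /ray_weights nE natrD !natrM.
have -> : (n %/ M)%:R * (c z)%:R + (n %% M)%:R * (z == z1)%:R -
   ((n %/ M)%:R * M%:R + (n %% M)%:R) * ((c z)%:R / M%:R) =
   (n %% M)%:R * ((z == z1)%:R - (c z)%:R / M%:R) :> R.
  by field; rewrite gt_eqF.
rewrite normrM ger0_norm//; apply: (@le_trans _ _ ((n %% M)%:R * 1)).
  rewrite ler_wpM2l//.
  have f0 : 0 <= (c z)%:R / M%:R :> R by rewrite divr_ge0.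
  have f1 : (c z)%:R / M%:R <= 1 :> R by rewrite ler_pdivrMr// mul1r ler_nat.
  by rewrite ler_norml; case: (z == z1) => /=; lra.
by rewrite mulr1 ler_nat ltnW// ltn_mod.
Qed.

Lemma ray_trackingM z1 j : ray_tracking z1 (j * M) = (fun z => j * c z)%N.
Proof.
by apply/funext => z; rewrite /ray_tracking mulnK// modnMl mul0n addn0.
Qed.

End IntegerRay.

(** * Expectations over the walk *)

Section WalkLaw.
Context (R : realType) (d : nat) (steps : {fset 'rV[int]_d}).
Context (dW : measure_display) (W : measurableType dW) (Q : probability W R).
Variable Z : nat -> W -> steps.
Hypothesis hZ : iid_uniform_steps Q Z.

Let word_event (N : nat) (s : N.-tuple steps) : set W :=
  [set w | mkseq (Z^~ w) N = s].

Let word_eventE (z0 : steps) N (s : N.-tuple steps) :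
  word_event s = \bigcap_(i in [set` [fset i in iota 0 N]%fset])
    Z i @^-1` [set nth z0 s i].
Proof.
apply/seteqP; split => [w Hw i|w Hw].
  rewrite /= !inE mem_iota add0n => iN.
  by rewrite -Hw nth_mkseq.
apply: (@eq_from_nth _ z0); first by rewrite size_mkseq size_tuple.
rewrite size_mkseq => i iN; rewrite nth_mkseq//.
by apply: Hw; rewrite /= !inE mem_iota add0n.
Qed.

Let measurable_word_event N (s : N.-tuple steps) : measurable (word_event s).
Proof.
case: N s => [|N] s.
  have -> : word_event s = setT.
    by apply/seteqP; split => // w _ /=; rewrite /word_event /= tuple0.
  exact: measurableT.
rewrite (word_eventE (thead s)); apply: bigcap_measurableType => i _.
by have [hm _ _] := hZ; exact: hm.
Qed.

Let prob_word_event N (s : N.-tuple steps) :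
  Q (word_event s) = ((#|{: steps}|%:R ^- N)%:E)%E.
Proof.
case: N s => [|N] s.
  have -> : word_event s = setT.
    by apply/seteqP; split => // w _ /=; rewrite /word_event /= tuple0.
  by rewrite expr0 invr1; exact: probability_setT.
have [_ hu hi] := hZ.
rewrite (word_eventE (thead s)) (hi _ (fun i => [set nth (thead s) s i])).
under eq_bigr do rewrite hu.
rewrite prodEFin; congr (_%:E).
rewrite big_const_seq count_predT iter_mulr_1 exprVn; congr (_ ^- _).
by rewrite card_fseq undup_id ?iota_uniq// size_iota.
Qed.

Lemma expectation_word (N : nat) (F : seq steps -> R) : (forall s, 0 <= F s) ->
  ('E_Q[fun w => F (mkseq (Z^~ w) N)] =
   (\sum_(s : N.-tuple steps) F s * #|{: steps}|%:R ^- N)%:E)%E.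
Proof.
move=> F0; rewrite unlock.
have E w : (F (mkseq (Z^~ w) N))%:E =
    (\sum_(s : N.-tuple steps) (F s)%:E * (\1_(word_event s) w)%:E)%E.
  have sw : size (mkseq (Z^~ w) N) == N by rewrite size_mkseq.
  rewrite (bigD1 (Tuple sw))//= big1 ?adde0.
    by rewrite indicE mem_set ?mule1.
  move=> s ns; rewrite indicE memNset ?mule0// => e.
  by case/eqP: ns; apply: val_inj; rewrite /= e.
under eq_integral do rewrite E.
rewrite ge0_integral_sum//; last 2 first.
- by move=> s; apply/measurable_EFinP; apply: measurable_funM.
- by move=> s w _; rewrite mule_ge0// lee_fin.
rewrite -sumEFin; apply: eq_bigr => s _.
rewrite ge0_integralZl//; last 2 first.
- by apply/measurable_EFinP; exact: measurable_indic.
- by rewrite lee_fin.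
by rewrite integral_indic// setIT [X in (_ * X)%E]prob_word_event EFinM.
Qed.

End WalkLaw.

Section StreamEnergy.
Context (R : realType) (d ell : nat) (steps : {fset 'rV[int]_d}).
Context (phi : 'rV[int]_d -> ell.-tuple steps -> R) (G : 'rV[int]_d -> R).
Hypothesis phiG : forall x w, `|phi x w| <= G x.
Hypothesis G0 : forall x, 0 <= G x.

(** The energy of the first n sites of an infinite walk, whose windows reach up to
    time n + ell. *)
Definition stream_energy (p : 'rV[int]_d) (z : nat -> steps) (n : nat) : R :=
  \sum_(k < n) phi (p + \sum_(i < k) val (z i)) [tuple z (k + i)%N | i < ell].

Lemma stream_energyS p z n :
  stream_energy p z n.+1 =
  phi p [tuple z i | i < ell] + stream_energy (p + val (z 0%N)) (z \o succn) n.
Proof.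
rewrite /stream_energy big_ord_recl big_ord0 addr0; congr (_ + _).
apply: eq_bigr => k _; congr phi.
by rewrite big_ord_recl addrA.
Qed.

Lemma eq_stream_energy p z z' n : (forall i, (i < n + ell)%N -> z i = z' i) ->
  stream_energy p z n = stream_energy p z' n.
Proof.
move=> H; apply: eq_bigr => k _; congr phi.
  congr (_ + _); apply: eq_bigr => i _; rewrite H//.
  by rewrite (ltn_trans (ltn_ord i))// (leq_trans (ltn_ord k))// leq_addr.
apply: eq_mktuple => i; apply: H.
by rewrite -addSn leq_add// ltnW.
Qed.

Let mkseqSl (z : nat -> steps) n : mkseq z n.+1 = z 0%N :: mkseq (z \o succn) n.
Proof. by rewrite /mkseq /= (iotaDl 1 0 n) -map_comp. Qed.

Let site_energy_stream p z n :
  site_energy phi G p (mkseq z n) =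
  if (ell <= n)%N then phi p [tuple z i | i < ell] else - G p.
Proof.
rewrite /site_energy; case: insubP => [w|]; rewrite size_take_min size_mkseq.
  move=> /eqP/minn_idPl ln ew; rewrite ln; congr phi; apply: val_inj.
  apply: (@eq_from_nth _ (z 0%N)); first by rewrite !size_tuple.
  move=> i; rewrite size_tuple => il.
  rewrite ew nth_take// nth_mkseq ?(leq_trans il)//.
  by rewrite -[i]/(val (Ordinal il)) -tnth_nth tnth_mktuple.
by move=> /eqP h; case: leqP => // ln; case: h; apply/minn_idPl.
Qed.

Lemma stream_energy_ge p z n : path_energy phi G p (mkseq z n) <= stream_energy p z n.
Proof.
elim: n p z => [|n IH] p z; first by rewrite /stream_energy big_ord0.
rewrite stream_energyS mkseqSl /= lerD// -mkseqSl site_energy_stream.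
case: ifP => // _; rewrite lerNl.
by have := phiG p [tuple z i | i < ell]; rewrite ler_norml lerNl => /andP[].
Qed.

Lemma stream_energy_le (B : nat) (c : R) p z n : 0 <= c ->
  (forall x, lattice_span steps x -> (l1 x <= B)%N -> G x <= c) ->
  lattice_span steps p -> (l1 p + n * step_range steps <= B)%N ->
  stream_energy p z n <=
  path_energy phi G p (mkseq z n) + (2 * c) * (minn n ell)%:R.
Proof.
move=> c0 HG; elim: n p z => [|n IH] p z sp lp.
  by rewrite /stream_energy big_ord0 min0n mulr0 addr0.
rewrite stream_energyS mkseqSl /= -mkseqSl site_energy_stream.
have sp' : lattice_span steps (p + val (z 0%N)).
  by apply: lattice_spanD => //; exact: lattice_span_step.
have lp' : (l1 (p + val (z 0%N)) + n * step_range steps <= B)%N.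
  apply: leq_trans lp; rewrite mulSn addnA leq_add2r.
  by rewrite (leq_trans (l1D _ _))// leq_add2l l1_step.
have Gc : G p <= c by apply: HG => //; apply: leq_trans lp; rewrite leq_addr.
have phc : phi p [tuple z i | i < ell] <= c.
  by apply: le_trans Gc; exact: le_trans (ler_norm _) (phiG _ _).
apply: (le_trans (lerD (lexx _) (IH _ (z \o succn) sp' lp'))).
have shuffle (a s b x y : R) : a + x <= s + y -> a + (b + x) <= s + b + y by lra.
apply: shuffle; case: ifP => [ln|/negbT]; last rewrite -ltnNge => nl.
  rewrite lerD2l ler_wpM2l ?mulr_ge0// ler_nat.
  by rewrite leq_min geq_minr (leq_trans (geq_minl _ _)).
rewrite !(minn_idPl _) ?(ltnW nl)//; last by rewrite (leq_trans _ nl)// leqW.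
rewrite -[n.+1%:R]natr1 mulrDr mulr1; lra.
Qed.

End StreamEnergy.

Section ExpectationBounds.
Context (R : realType) (d ell : nat) (steps : {fset 'rV[int]_d}).
Context (dW : measure_display) (W : measurableType dW) (Q : probability W R).
Variable Z : nat -> W -> steps.
Hypothesis hZ : iid_uniform_steps Q Z.
Context (phi : 'rV[int]_d -> ell.-tuple steps -> R) (G : 'rV[int]_d -> R).
Hypothesis phiG : forall x w, `|phi x w| <= G x.
Hypothesis G0 : forall x, 0 <= G x.
Hypothesis steps0 : (0 < #|{: steps}|)%N.

(** Only the last ell windows see steps beyond time n. They contribute -G to the path
    energy and at least -G, at most G, to the stream energy. The steps beyond time n
    are averaged out. *)
Lemma expectation_bounds (n : nat) (c : R) (D : pred (seq steps)) : 0 <= c ->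
  (forall x, lattice_span steps x -> (l1 x <= n * step_range steps)%N -> G x <= c) ->
  exists e : R, [/\
    ('E_Q[fun w => (expR (stream_energy phi 0 (Z^~ w) n +
              n%:R * ln (#|{: steps}|%:R)) * (D (mkseq (Z^~ w) n))%:R)%R] = e%:E)%E,
    \sum_(s : n.-tuple steps | D s) expR (path_energy phi G 0 s) <= e
  & e <= expR (2 * c * ell%:R) *
         \sum_(s : n.-tuple steps | D s) expR (path_energy phi G 0 s)].
Proof.
move=> c0 HG.
have [z0 _] : exists z0 : steps, true.
  by have /card_gt0P[z0 _] := steps0; exists z0.
set q : R := #|{: steps}|%:R.
have q0 : 0 < q by rewrite ltr0n.
have qn0 m : 0 < q ^- m by rewrite invr_gt0 exprn_gt0.
pose N := (n + ell)%N.
pose F (s : seq steps) := expR (stream_energy phi 0 (nth z0 s) n + n%:R * ln q) *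
   (D (take n s))%:R.
have F0 s : 0 <= F s by rewrite mulr_ge0// expR_ge0.
have expq : expR (n%:R * ln q) = q ^+ n.
  by rewrite mulrC expRM_natr lnK ?posrE.
exists (\sum_(s : N.-tuple steps) F s * q ^- N).
pose S := \sum_(s : n.-tuple steps | D s) expR (path_energy phi G 0 s).
pose H s := expR (path_energy phi G 0 (take n s)) * (D (take n s))%:R.
have sumH : \sum_(s : N.-tuple steps) q ^+ n * H s * q ^- N = S.
  rewrite -(sum_cat_tuple n ell (fun s => q ^+ n * H s * q ^- N)).
  under eq_bigr => s _.
    under eq_bigr => t _ do rewrite /H take_size_cat ?size_tuple//.
    rewrite sumr_const card_tuple.
    over.
  rewrite /S [RHS]big_mkcond /=; apply: eq_bigr => s _.
  rewrite -[LHS]mulr_natr natrX -/q /N exprD invfM.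
  rewrite [X in _ = X](_ : _ = expR (path_energy phi G 0 s) * (D s)%:R); last first.
    by case: ifP; rewrite ?mulr1 ?mulr0.
  by field; rewrite !expf_neq0// gt_eqF.
have stream_mk (s : N.-tuple steps) : mkseq (nth z0 s) n = take n s.
  apply: (@eq_from_nth _ z0).
    by rewrite size_mkseq size_takel// size_tuple leq_addr.
  by rewrite size_mkseq => i il; rewrite nth_mkseq// nth_take.
have lo (s : N.-tuple steps) : q ^+ n * H s <= F s.
  rewrite /F /H expRD expq mulrCA mulrA ler_wpM2r//.
  rewrite ler_wpM2r ?exprn_ge0 ?(ltW q0)// ler_expR -stream_mk.
  exact: stream_energy_ge.
have up (s : N.-tuple steps) : F s <= expR (2 * c * ell%:R) * (q ^+ n * H s).
  rewrite /F /H expRD expq !mulrA ler_wpM2r// [leRHS]mulrAC.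
  rewrite ler_wpM2r ?exprn_ge0 ?(ltW q0)//.
  rewrite -expRD ler_expR -stream_mk addrC.
  apply: le_trans (stream_energy_le phiG _ c0 HG (lattice_span0 _) _) _.
    by rewrite l1_0.
  by rewrite lerD2l ler_wpM2l ?mulr_ge0// ler_nat geq_minr.
split.
- rewrite -(expectation_word hZ N F0); congr ('E_Q[_])%E; apply/funext => w.
  have -> : mkseq (Z^~ w) n = take n (mkseq (Z^~ w) N).
    apply: (@eq_from_nth _ z0).
      by rewrite size_mkseq size_takel// size_mkseq leq_addr.
    rewrite size_mkseq => i il.
    by rewrite nth_take// !nth_mkseq// (leq_trans il)// leq_addr.
  rewrite /F (@eq_stream_energy _ _ _ _ phi 0 (Z^~ w) (nth z0 (mkseq (Z^~ w) N)))//.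
  by move=> i iN; rewrite nth_mkseq.
- rewrite -/S -sumH; apply: ler_sum => s _; rewrite ler_wpM2r ?(ltW (qn0 _))//.
- rewrite -/S -sumH mulr_sumr; apply: ler_sum => s _.
  by rewrite mulrA ler_wpM2r ?(ltW (qn0 _)).
Qed.

End ExpectationBounds.

(** * Class L and integer rays in almost every environment *)

Lemma limf_esup_lt (R : realType) (T : choiceType) (X : filteredType T)
    (f : X -> \bar R) (F : set_system X) {FF : Filter F} (a : \bar R) :
  (limf_esup f F < a)%E -> \forall x \near F, (f x < a)%E.
Proof.
rewrite limf_esupE => /ereal_inf_lt[_ [V FV <-] lt].
apply: filterS FV => x Vx; apply: le_lt_trans lt.
by apply: ereal_sup_ubound; exists x.
Qed.

Lemma euclidean_norm_le_l1 (R : realType) (d : nat) (x : 'rV[int]_d) :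
  euclidean_norm R x <= (l1 x)%:R.
Proof.
have e i : (x ord0 i)%:~R ^+ 2 = (`|x ord0 i|%N)%:R ^+ 2 :> R.
  by rewrite natr_absz intr_norm real_normK// num_real.
rewrite /euclidean_norm -[leRHS]ger0_norm// -sqrtr_sqr ler_wsqrtr//.
under eq_bigr do rewrite e.
rewrite /l1 natr_sum expr2 mulr_suml; apply: ler_sum => i _.
rewrite expr2 ler_wpM2l// (bigD1 i)//= lerDl sumr_ge0//.
Qed.

Section ClassL.
Context (R : realType) (d : nat) (steps : {fset 'rV[int]_d}) (Omega : Type).
Context (T : 'rV[int]_d -> Omega -> Omega) (ell : nat).
Context (g : Omega -> ell.-tuple steps -> R) (omega : Omega) (L : R).
Hypothesis L0 : 0 <= L.
Hypothesis hL : forall (zt : ell.-tuple steps) (z : steps), val z != 0 ->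
  limf_esup (fun eps : R =>
    limn_esup (fun n : nat =>
      ereal_sup
        [set (n%:R^-1 * \sum_(0 <= k < (Num.truncn (eps * n%:R)).+1)
               `|g (T (x + val z *+ k) omega) zt|)%:E
        | x in [set x | lattice_span steps x /\ euclidean_norm R x <= n%:R]]))
    0^'+ = 0%E.

(** Summing over the windows turns the condition on each section of g into a condition
    on one function of the site. The constant L is for the entropy of a step, see
    [potential]. *)
Definition site_bound (x : 'rV[int]_d) : R := \sum_w `|g (T x omega) w| + L.

Let window_bound (delta : R) (zt : ell.-tuple steps) (z : steps) : 0 < delta ->
  exists2 eps : R, 0 < eps & \forall n \near \oo,
    forall x, lattice_span steps x -> (l1 x <= n)%N ->
      val z != 0 -> forall a : nat, a%:R <= eps * n%:R ->
      \sum_(k < a.+1) `|g (T (x + val z *+ k) omega) zt| <= delta * n%:R.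
Proof.
move=> d0; have [z0|z0] := eqVneq (val z) 0.
  by exists 1 => //; near=> n => x _ _; rewrite z0.
have := hL zt z0; set f := (fun eps : R => _) => Hf.
have flt : (limf_esup f 0^'+ < delta%:E)%E by rewrite Hf lte_fin.
have near0 : \forall x \near 0^'+, (f x < delta%:E)%E by exact: limf_esup_lt.
have [eps [eps0 feps]] : exists eps : R, 0 < eps /\ (f eps < delta%:E)%E.
  have [e [e0 fe]] := @filter_ex _ _ _ _ (filterI (nbhs_right_gt 0) near0).
  by exists e.
exists eps => //.
move: feps; rewrite /f /limn_esup; set u := (fun n : nat => ereal_sup _) => feps.
have late : \forall n \near \oo, (u n < delta%:E)%E by exact: limf_esup_lt.
apply: filter_app late; exists 1%N => // n /= n0 Hn x sx lx _ a ae.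
have n0R : 0 < n%:R :> R by rewrite ltr0n.
have : ((n%:R^-1 * \sum_(0 <= k < (Num.truncn (eps * n%:R)).+1)
               `|g (T (x + val z *+ k) omega) zt|)%:E < delta%:E)%E.
  apply: le_lt_trans Hn; apply: ereal_sup_ubound; exists x => //; split => //.
  by apply: le_trans (euclidean_norm_le_l1 _ _) _; rewrite ler_nat.
rewrite lte_fin mulrC ltr_pdivrMr// => /ltW; apply: le_trans.
have an : (a.+1 <= (Num.truncn (eps * n%:R)).+1)%N.
  by rewrite ltnS truncn_ge_nat// mulr_ge0// ltW.
rewrite -(big_mkord xpredT (fun k => `|g (T (x + val z *+ k) omega) zt|)).
by rewrite [leRHS](big_cat_nat (n := a.+1))//= lerDl sumr_ge0.
Unshelve. all: by end_near.
Qed.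

(** There are finitely many windows and steps, so a least eps can be taken. The
    constant L contributes L (a + 1), which the choice eps <= delta / (4 (L + 1))
    makes small. *)
Lemma class_L_tame : tame_environment steps site_bound.
Proof.
move=> delta d0.
pose c := #|{: ell.-tuple steps}|.
pose delta' := delta / (2 * c.+1%:R).
have d0' : 0 < delta' by rewrite divr_gt0.
have ex_eps (wz : (ell.-tuple steps) * steps) : exists e : R, 0 < e /\
   \forall n \near \oo,
    forall x, lattice_span steps x -> (l1 x <= n)%N ->
      val wz.2 != 0 -> forall a : nat, a%:R <= e * n%:R ->
      \sum_(k < a.+1) `|g (T (x + val wz.2 *+ k) omega) wz.1| <= delta' * n%:R.
  by have [e e0 He] := window_bound wz.1 wz.2 d0'; exists e.
have [e He] := choice ex_eps.
pose eps := \big[Num.min/(delta / (4 * (L + 1)))]_wz e wz.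
have L1 : 0 < L + 1 by rewrite ltr_wpDl.
have eps0 : 0 < eps.
  apply: lt_bigmin; first by rewrite divr_gt0// mulr_gt0.
  by move=> wz _; have [] := He wz.
exists eps => //.
have H : \forall n \near \oo, forall wz : (ell.-tuple steps) * steps,
    forall x, lattice_span steps x -> (l1 x <= n)%N ->
      val wz.2 != 0 -> forall a : nat, a%:R <= e wz * n%:R ->
      \sum_(k < a.+1) `|g (T (x + val wz.2 *+ k) omega) wz.1| <= delta' * n%:R.
  by apply: filter_forall => wz; have [] := He wz.
have d4 : 0 < delta / 4 by lra.
have := @near_natmul R (delta / 4) L d4.
apply: filter_app; apply: filter_app H; exists 0%N => // n _ H hn x sx lx z z0 a ae.
have part w : \sum_(k < a.+1) `|g (T (x + val z *+ k) omega) w| <= delta' * n%:R.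
  apply: (H (w, z)) => //=; apply: (le_trans ae); rewrite ler_wpM2r//.
  exact: bigmin_le_cond.
rewrite /site_bound big_split /= exchange_big /= sumr_const card_ord.
have h1 : \sum_(w : ell.-tuple steps) \sum_(k < a.+1) `|g (T (x + val z *+ k) omega) w|
    <= c%:R * (delta' * n%:R).
  apply: (@le_trans _ _ (\sum_(w : ell.-tuple steps) delta' * n%:R)).
    by apply: ler_sum => w _.
  by rewrite sumr_const -[leLHS]mulr_natl.
have h2 : c%:R * (delta' * n%:R) <= delta / 2 * n%:R.
  rewrite mulrA ler_wpM2r// /delta' mulrCA ler_pM2l// invfM.
  rewrite mulrCA ler_piMr// ler_pdivrMr// mul1r ler_nat//.
have h3 : L *+ a.+1 <= delta / 2 * n%:R.
  rewrite -[leLHS]mulr_natl -natr1 mulrDl mul1r.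
  have h4 : a%:R * L <= delta / 4 * n%:R.
    apply: (@le_trans _ _ (eps * n%:R * (L + 1))).
      by apply: ler_pM => //; rewrite lerDl.
    have : eps <= delta / (4 * (L + 1)) by exact: bigmin_le_id.
    rewrite ler_pdivlMr ?mulr_gt0// => h5.
    have : eps * (4 * (L + 1)) * n%:R <= delta * n%:R by rewrite ler_wpM2r.
    lra.
  by move: hn h4; lra.
apply: (le_trans (lerD h1 h3)); move: h2.
move: (c%:R * (delta' * n%:R)) => y h2; lra.
Qed.

End ClassL.

Section Environment.
Context (R : realType) (d : nat) (steps : {fset 'rV[int]_d}).
Context (dO : measure_display) (Omega : measurableType dO).
Context (P : probability Omega R) (T : 'rV[int]_d -> Omega -> Omega).
Hypothesis hT : measurable_dynamical_system steps P T.
Context (ell : nat) (g : Omega -> ell.-tuple steps -> R).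
Hypothesis ig : forall w, P.-integrable [set: Omega] (fun om => (g om w)%:E).
Hypothesis steps0 : (0 < #|{: steps}|)%N.

Definition log_card : R := ln (#|{: steps}|%:R).

(** Subtracting log_card at every site includes the probability of a path in its
    energy. *)
Definition potential (om : Omega) (x : 'rV[int]_d) (w : ell.-tuple steps) : R :=
  g (T x om) w - log_card.

Definition bound (om : Omega) : 'rV[int]_d -> R := site_bound T g om log_card.

Definition partition_sum (om : Omega) (n : nat) (x : 'rV[int]_d) : R :=
  path_sum (potential om) (bound om) 0 n x.

Lemma log_card_ge0 : 0 <= log_card.
Proof. by apply: ln_ge0; rewrite ler1n. Qed.

Lemma potential_le om x w : `|potential om x w| <= bound om x.
Proof.
apply: le_trans (ler_normB _ _) _; rewrite (ger0_norm log_card_ge0) lerD2r.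
by rewrite (bigD1 w)//= lerDl sumr_ge0.
Qed.

Lemma bound_ge0 om x : 0 <= bound om x.
Proof. by rewrite addr_ge0 ?log_card_ge0// sumr_ge0. Qed.

Let mT x : lattice_span steps x -> measurable_fun [set: Omega] (T x).
Proof. by have [h _ _ _] := hT; exact: h. Qed.

Let pT x : lattice_span steps x -> forall A, measurable A -> P (T x @^-1` A) = P A.
Proof. by have [_ _ _ h] := hT; exact: h. Qed.

Let T_add x y om : lattice_span steps x -> lattice_span steps y ->
  T x (T y om) = T (x + y) om.
Proof. by move=> sx sy; have [_ _ h _] := hT; rewrite h. Qed.

Let mg w : measurable_fun [set: Omega] (g^~ w).
Proof. exact/measurable_EFinP/(measurable_int _ (ig w)). Qed.

Let mgT w p : lattice_span steps p -> measurable_fun [set: Omega] (fun om => g (T p om) w).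
Proof. by move=> sp; exact: (measurableT_comp (mg w) (mT sp)). Qed.

Let measurable_bound p : lattice_span steps p ->
  measurable_fun [set: Omega] (fun om => bound om p).
Proof.
move=> sp; apply: measurable_funD => //.
apply: measurable_sum => w; apply: measurableT_comp => //; exact: mgT.
Qed.

Let integrable_bound p : lattice_span steps p ->
  P.-integrable [set: Omega] (fun om => (bound om p)%:E).
Proof.
move=> sp; rewrite /bound /site_bound.
under eq_fun do rewrite EFinD.
apply: integrableD => //; last exact: finite_measure_integrable_cst.
under eq_fun do rewrite -sumEFin.
apply: integrable_sum => // w _.
apply/integrableP; split.
  apply/measurable_EFinP; apply: measurableT_comp => //; exact: mgT.
have := ig w => /integrableP[_]; apply: le_lt_trans.
rewrite le_eqVlt; apply/orP; left; apply/eqP.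
rewrite -(integral_iter (mT sp) (pT sp) 1 (h := fun om => `|(g om w)%:E|%E)).
- by apply: eq_integral => om _ /=; rewrite normr_id.
- by apply: measurableT_comp => //; apply/measurable_EFinP; exact: mg.
- by move=> om; exact: abse_ge0.
Qed.

Let measurable_site p s : lattice_span steps p ->
  measurable_fun [set: Omega] (fun om => site_energy (potential om) (bound om) p s).
Proof.
move=> sp; rewrite /site_energy; case: insubP => [w _ _|_].
  by apply: measurable_funB => //; exact: mgT.
by apply: measurableT_comp => //; exact: measurable_bound.
Qed.

Let measurable_energy p s : lattice_span steps p ->
  measurable_fun [set: Omega] (fun om => path_energy (potential om) (bound om) p s).
Proof.
elim: s p => [|z s IH] p sp //=.
apply: measurable_funD; first exact: (measurable_site (z :: s)).
by apply: IH; apply: lattice_spanD => //; exact: lattice_span_step.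
Qed.

Let measurable_partition n x :
  measurable_fun [set: Omega] (fun om => partition_sum om n x).
Proof.
rewrite /partition_sum /path_sum.
under eq_fun do rewrite big_mkcond /=.
apply: measurable_sum => s; case: (_ == _) => //.
apply: measurableT_comp; first exact: measurable_expR.
exact/measurable_energy/lattice_span0.
Qed.

Let integrable_cost p (s : seq steps) : lattice_span steps p ->
  P.-integrable [set: Omega] (fun om => (path_cost (bound om) p s)%:E).
Proof.
elim: s p => [|z s IH] p sp /=; first exact: integrable0.
under eq_fun do rewrite EFinD.
apply: integrableD => //; first exact: integrable_bound.
by apply: IH; apply: lattice_spanD => //; exact: lattice_span_step.
Qed.

Lemma lattice_span_point (c : steps -> nat) : lattice_span steps (lattice_point c).
Proof. by have [t _ <-] := lattice_point_path c; exact: lattice_span_endpoint. Qed.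

Let lattice_spanMn x n : lattice_span steps x -> lattice_span steps (x *+ n).
Proof.
move=> sx; elim: n => [|n IH]; first by rewrite mulr0n; exact: lattice_span0.
by rewrite mulrS; exact: lattice_spanD.
Qed.

Let iter_T x n om : lattice_span steps x -> iter n (T x) om = T (x *+ n) om.
Proof.
move=> sx; elim: n => [|n IH] /=; first by have [_ h _ _] := hT; rewrite mulr0n h.
by rewrite IH mulrS; apply: T_add => //; exact: lattice_spanMn.
Qed.

Lemma partition_sum_gt0 om (s : seq steps) : 0 < partition_sum om (size s) (endpoint s).
Proof. exact: path_sum_gt0. Qed.

(** With y the endpoint of c, S j is superadditive for the shift by y, and S 1 is at
    least minus the cost of one fixed path from 0 to y, which is integrable. *)
Lemma ray_limit_ae (c : steps -> nat) : (0 < \sum_z c z)%N ->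
  {ae P, forall om, exists2 l : \bar R, (-oo < l)%E &
    (log_sum (partition_sum om) (fun z => j * c z)%N / j%:R)%:E @[j --> \oo] --> l}.
Proof.
move=> c0; set M := (\sum_z c z)%N; set y := lattice_point c.
have sy : lattice_span steps y := lattice_span_point c.
pose S j om := ln (partition_sum om (j * M) (y *+ j)).
have SE om j : log_sum (partition_sum om) (fun z => j * c z)%N = S j om.
  rewrite /log_sum /S -big_distrr /=; congr (ln (partition_sum _ _ _)).
  by rewrite /y /lattice_point -sumrMnl; apply: eq_bigr => z _; rewrite mulnC mulrnA.
have [t st et] := lattice_point_path c.
have gt0 om j : 0 < partition_sum om (j * M) (y *+ j).
  have [u su eu] := lattice_point_path (fun z => j * c z)%N.
  have -> : (j * M)%N = size u by rewrite su -big_distrr.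
  have -> : y *+ j = endpoint u.
    by rewrite eu /y /lattice_point -sumrMnl; apply: eq_bigr => z _; rewrite mulnC mulrnA.
  exact: partition_sum_gt0.
have := @superadditive_ergodic R dO Omega P (T y) (mT sy) (pT sy) S
  (fun om => path_cost (bound om) 0 t) _ _ _ (integrable_cost t (lattice_span0 _)) _ _.
move=> H; have {H} : {ae P, forall om, exists2 l : \bar R, (-oo < l)%E &
     (S n om / n%:R)%:E @[n --> \oo] --> l}.
  apply: H.
  - move=> j; apply: (measurableT_comp (@measurable_ln R)).
    exact: measurable_partition.
  - move=> om; rewrite /S mul0n mulr0n /partition_sum /path_sum.
    rewrite (big_pred1 [tuple])/= ?expR0 ?ln1// => s.
    by rewrite (tuple0 s) /= endpoint_nil !eqxx.
  - move=> m n om; rewrite -lnM ?posrE// ler_ln ?posrE ?mulr_gt0//.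
    rewrite iter_T// mulnDl mulrnDr.
    apply: le_trans (path_sum_mul (potential_le om) 0 _ _ _ _).
    rewrite ler_wpM2l ?path_sum_ge0// add0r /partition_sum.
    rewrite (@path_sum_translate _ _ _ _ (potential om) _ (bound om) _ (y *+ m))//.
      move=> x sx; apply/funext => w.
      by rewrite /potential (T_add om sx (lattice_spanMn m sy)) [x + _]addrC.
    by move=> x sx; rewrite /bound /site_bound (T_add om sx (lattice_spanMn m sy)) [x + _]addrC.
  - by move=> om; elim: (t) (0 : 'rV_d) => //= z s IH p; rewrite addr_ge0// bound_ge0.
  - move=> om; rewrite /S mul1n mulr1n -[leLHS]expRK ler_ln ?posrE ?expR_gt0//.
      apply: (@le_trans _ _ (expR (path_energy (potential om) (bound om) 0 t))).
        rewrite ler_expR; apply: path_energy_ge; first exact: potential_le.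
        exact: bound_ge0.
      by rewrite /y -et /M -st; exact: path_sum_ge.
    by have := gt0 om 1%N; rewrite mul1n mulr1n.
apply: filterS => om [l lNy cl]; exists l => //.
by under eq_fun do rewrite SE.
Qed.

End Environment.

(** * From path sums to free energies *)

Lemma cvg_log_sandwich (R : realType) (U : nat -> R) (X : nat -> \bar R)
    (l : \bar R) : (-oo < l)%E ->
  (forall delta : R, 0 < delta -> \forall n \near \oo, exists e : R,
     [/\ X n = ((n%:R^-1)%:E * lne e%:E)%E, expR (U n) <= e
       & e <= expR (delta * n%:R) * expR (U n)]) ->
  (U n / n%:R)%:E @[n --> \oo] --> l -> X n @[n --> \oo] --> l.
Proof.
move=> lNy H cU.
have H' (delta : R) : 0 < delta -> \forall n \near \oo,
    X n = (fine (X n))%:E /\ U n / n%:R <= fine (X n) <= U n / n%:R + delta.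
  move=> d0; have := H _ d0; apply: filter_app; exists 1%N => // n n0 [e [-> e1 e2]].
  have {}n0 : (0 < n)%N by exact: n0.
  have e0 : 0 < e by apply: lt_le_trans e1; exact: expR_gt0.
  have n0R : 0 < n%:R :> R by rewrite ltr0n.
  rewrite (lne_EFin e0) -EFinM; split; first by [].
  rewrite -[fine _]/(n%:R^-1 * ln e).
  rewrite [n%:R^-1 * _]mulrC ler_pM2r ?invr_gt0// ler_pdivrMr// mulrDl divfK ?gt_eqF//.
  apply/andP; split.
    by rewrite -[leLHS]expRK ler_ln ?posrE ?expR_gt0.
  by rewrite -[leRHS]expRK ler_ln ?posrE ?expR_gt0// addrC expRD.
suff : (fine (X n))%:E @[n --> \oo] --> l.
  apply: cvg_trans; apply: near_eq_cvg.
  by have := H' 1 ltr01; apply: filterS => n [].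
case: l lNy cU => [r| |]// _ cU.
  apply: cvg_EFin_of_bounds => e e0; have e2 : 0 < e / 2 by lra.
  have := bounds_of_cvg_EFin cU e2; apply: filter_app; have := H' _ e2.
  apply: filterS => n [_ /andP[h1 h2]] /andP[h3 h4].
  apply/andP; split; lra.
apply: cvg_pinfty_of_ge => A; have := ge_of_cvg_pinfty cU A; apply: filter_app.
have := H' 1 ltr01; apply: filterS => n [_ /andP[h1 _]] h.
exact: le_trans h1.
Qed.

Section Rounding.
Context (R : realType) (d : nat) (steps : {fset 'rV[int]_d}).
Variables (beta : steps -> R) (b : nat -> steps -> bool).
Hypothesis sb : simplex beta.
Hypothesis hb : admissible_rounding beta b.

Definition rounded (n : nat) (z : steps) : nat :=
  absz (Num.floor (n%:R * beta z) + (b n z)%:Z).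

Lemma roundedE n z : (rounded n z)%:Z = Num.floor (n%:R * beta z) + (b n z)%:Z.
Proof.
rewrite /rounded gez0_abs// addr_ge0// floor_ge0 mulr_ge0//.
by have [] := sb.
Qed.

Lemma tracks_rounded : tracks beta rounded 1.
Proof.
split => [n|n z bz|n z].
- apply/eqP; rewrite -eqz_nat (big_morph _ PoszD (erefl 0%:Z)).
  under eq_bigr do rewrite roundedE.
  rewrite big_split /=; have [_ ->] := hb n.
  by rewrite addrCA subrr addr0.
- apply/eqP; rewrite -eqz_nat roundedE bz mulr0 floor0 add0r.
  by have [-> //] := hb n; rewrite bz.
- have -> : (rounded n z)%:R = (Num.floor (n%:R * beta z) + (b n z)%:Z)%:~R :> R.
    by rewrite -roundedE.
  have /andP[f1] := floor_itv (n%:R * beta z); rewrite !intrD.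
  have -> : (b n z)%:Z%:~R = (b n z)%:R :> R by [].
  move: f1; move: ((Num.floor (n%:R * beta z))%:~R : R) => f f1 f2.
  move: f1 f2; move: (n%:R * beta z) => x f1 f2.
  by rewrite ler_norml; case: (b n z) => /=; lra.
Qed.

Lemma xhatE n : xhat beta b n = lattice_point (rounded n).
Proof.
by apply: eq_bigr => z _; rewrite -roundedE -[X in X *: _]natz scaler_nat.
Qed.

End Rounding.

Section GoodEnvironment.
Context (R : realType) (d : nat) (steps : {fset 'rV[int]_d}).
Context (dW : measure_display) (W : measurableType dW) (Q : probability W R).
Variable Z : nat -> W -> steps.
Hypothesis hZ : iid_uniform_steps Q Z.
Context (dO : measure_display) (Omega : measurableType dO).
Context (T : 'rV[int]_d -> Omega -> Omega).
Context (ell : nat) (g : Omega -> ell.-tuple steps -> R) (om : Omega).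
Hypothesis steps0 : (0 < #|{: steps}|)%N.
Let phi := potential T g om.
Let G := bound T g om.
Let Zs := partition_sum T g om.
Hypothesis tame : tame_environment steps G.

Let phiG x w : `|phi x w| <= G x. Proof. exact: potential_le. Qed.
Let G0 x : 0 <= G x. Proof. exact: bound_ge0. Qed.

Lemma energyE n w : energy Z T g om n w =
  stream_energy phi 0 (Z^~ w) n + n%:R * ln (#|{: steps}|%:R).
Proof.
rewrite /energy /stream_energy /phi /potential /log_card sumrB.
rewrite sumr_const card_ord -[_ *+ n]mulr_natl subrK.
by apply: eq_bigr => k _; rewrite add0r.
Qed.

Lemma walkE n w : walk Z n w = endpoint (mkseq (Z^~ w) n).
Proof.
rewrite /walk /endpoint /mkseq big_map.
by rewrite -(big_mkord predT (fun j => val (Z j w))) /index_iota subn0.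
Qed.

Let log_expectation (D : nat -> pred (seq steps)) (delta : R) : 0 < delta ->
  \forall n \near \oo, exists e : R, [/\
   ('E_Q[fun w => (expR (energy Z T g om n w) * (D n (mkseq (Z^~ w) n))%:R)%R] = e%:E)%E,
    \sum_(s : n.-tuple steps | D n s) expR (path_energy phi G 0 s) <= e
  & e <= expR (delta * n%:R) *
         \sum_(s : n.-tuple steps | D n s) expR (path_energy phi G 0 s)].
Proof.
move=> d0; have d0' : 0 < delta / (2 * ell%:R + 1).
  by rewrite divr_gt0// ltr_wpDl// mulr_ge0.
have := tame_site tame (step_range steps) d0'; apply: filterS => n Hn.
have c0 : 0 <= delta / (2 * ell%:R + 1) * n%:R by rewrite mulr_ge0// ltW.
have HG x : lattice_span steps x -> (l1 x <= n * step_range steps)%N ->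
    G x <= delta / (2 * ell%:R + 1) * n%:R.
  by move=> sx lx; apply: Hn => //; rewrite mulnC.
have [e [e1 e2 e3]] := expectation_bounds hZ phiG steps0 (D n) c0 HG.
exists e; split => //.
  by rewrite -e1; congr ('E_Q[_])%E; apply/funext => w; rewrite energyE.
apply: le_trans e3 _; rewrite ler_wpM2r//; first by apply: sumr_ge0 => s _; exact: expR_ge0.
rewrite ler_expR.
have -> : 2 * (delta / (2 * ell%:R + 1) * n%:R) * ell%:R =
   delta * n%:R * (2 * ell%:R / (2 * ell%:R + 1)).
  by ring.
rewrite ler_piMr ?mulr_ge0// ?(ltW d0)//.
rewrite ler_pdivrMr ?mul1r ?lerDl// ltr_wpDl// mulr_ge0.
Qed.

Lemma p2p_cvg (beta : steps -> R) b (l : \bar R) :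
  simplex beta -> admissible_rounding beta b -> (-oo < l)%E ->
  (log_sum Zs (rounded beta b n) / n%:R)%:E @[n --> \oo] --> l ->
  p2p_seq Q Z T g om beta b @ \oo --> l.
Proof.
move=> sb hb lNy; apply: cvg_log_sandwich => // delta d0.
have := log_expectation (fun n s => endpoint s == xhat beta b n) d0.
apply: filterS => n [e [e1 e2 e3]]; exists e.
have UE : expR (log_sum Zs (rounded beta b n)) =
    \sum_(s : n.-tuple steps | endpoint s == xhat beta b n)
       expR (path_energy phi G 0 s).
  rewrite /log_sum lnK; last first.
    by rewrite posrE; apply: Zs_point_gt0 => s; exact: partition_sum_gt0.
  by have [-> _ _] := tracks_rounded sb hb; rewrite xhatE.
rewrite UE; split => //.
rewrite /p2p_seq -e1; congr (_ * lne _)%E; congr ('E_Q[_])%E.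
apply/funext => w; congr (_ * _); rewrite indicE.
by congr (nat_of_bool _)%:R; apply/idP/idP => [/set_mem/= <-|/eqP h];
  [rewrite walkE|apply/mem_set; rewrite /= walkE].
Qed.

Lemma p2l_cvg (l : \bar R) : (-oo < l)%E ->
  (ln (free_path_sum phi G n) / n%:R)%:E @[n --> \oo] --> l ->
  p2l_seq Q Z T g om @ \oo --> l.
Proof.
move=> lNy; apply: cvg_log_sandwich => // delta d0.
have := log_expectation (fun n => predT) d0.
apply: filterS => n [e [e1 e2 e3]]; exists e.
have UE : expR (ln (free_path_sum phi G n)) =
    \sum_(s : n.-tuple steps) expR (path_energy phi G 0 s).
  rewrite lnK// posrE.
  have [z0 _] : exists z0 : steps, true.
    by have /card_gt0P[z0 _] := steps0; exists z0.
  have := path_sum_le_free phi G n (endpoint (nseq n z0)); apply: lt_le_trans.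
  by have := path_sum_gt0 phi G 0 (nseq n z0); rewrite size_nseq.
rewrite UE; split => //.
rewrite /p2l_seq -e1; congr (_ * lne _)%E; congr ('E_Q[_])%E.
by apply/funext => w; rewrite mulr1.
Qed.

End GoodEnvironment.

Lemma ge_of_lt_limit (R : realType) (u : nat -> R) (l : \bar R) (B : R) :
  (u n)%:E @[n --> \oo] --> l -> (B%:E < l)%E -> \forall n \near \oo, B <= u n.
Proof.
case: l => [r| |]// cu; last by move=> _; exact: ge_of_cvg_pinfty.
rewrite lte_fin => Br; have e0 : 0 < r - B by lra.
have := bounds_of_cvg_EFin cu e0; apply: filterS => n /andP[h _].
by rewrite subKr in h.
Qed.

Lemma convex_simplex (R : realType) (d : nat) (steps : {fset 'rV[int]_d})
    (zeta : 'rV[R]_d) (beta : steps -> R) :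
  convex_weights zeta beta -> simplex beta /\ barycenter beta = zeta.
Proof. by move=> [b01 b1 ->]; split => //; split => // z; have /andP[] := b01 z. Qed.

Lemma simplex_convex (R : realType) (d : nat) (steps : {fset 'rV[int]_d})
    (beta : steps -> R) :
  simplex beta -> step_hull R steps (barycenter beta).
Proof.
move=> [b0 b1]; exists beta; split => // z; rewrite b0 /= -b1 (bigD1 z)//=.
by rewrite lerDl sumr_ge0.
Qed.

Section FreeEnergies.
Context (R : realType) (d : nat) (steps : {fset 'rV[int]_d}).
Context (dW : measure_display) (W : measurableType dW) (Q : probability W R).
Variable Z : nat -> W -> steps.
Hypothesis hZ : iid_uniform_steps Q Z.
Context (dO : measure_display) (Omega : measurableType dO).
Context (T : 'rV[int]_d -> Omega -> Omega).
Context (ell : nat) (g : Omega -> ell.-tuple steps -> R) (om : Omega).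
Hypothesis steps0 : (0 < #|{: steps}|)%N.
Let phi := potential T g om.
Let G := bound T g om.
Let Zs := partition_sum T g om.
Hypothesis tame : tame_environment steps G.
Hypothesis rays : forall c : steps -> nat, (0 < \sum_z c z)%N ->
  exists2 l : \bar R, (-oo < l)%E &
    (log_sum Zs (fun z => (j * c z)%N) / j%:R)%:E @[j --> \oo] --> l.
Variables (beta : 'rV[R]_d -> steps -> R) (b : 'rV[R]_d -> nat -> steps -> bool).
Hypothesis hbeta : forall zeta, step_hull R steps zeta ->
  admissible_weights zeta (beta zeta) /\ admissible_rounding (beta zeta) (b zeta).

Let phiG x w : `|phi x w| <= G x. Proof. exact: potential_le. Qed.
Let G0 x : 0 <= G x. Proof. exact: bound_ge0. Qed.
Let Zs_gt0 (s : seq steps) : 0 < Zs (size s) (endpoint s).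
Proof. exact: partition_sum_gt0. Qed.
Let short := path_sum_short_bridge G0 tame phiG.
Let long := path_sum_long_bridge G0 tame phiG.

Let Lambda zeta := Lambda_p2p Q Z T g beta b zeta om.
Let reference zeta n := rounded (beta zeta) (b zeta) n.

Let hull_simplex zeta : step_hull R steps zeta ->
  [/\ simplex (beta zeta), barycenter (beta zeta) = zeta
    & tracks (beta zeta) (reference zeta) 1].
Proof.
move=> hz; have [[cw _] hb] := hbeta hz; have [sb bb] := convex_simplex cw.
by split => //; exact: tracks_rounded.
Qed.

Lemma p2p_rate zeta : step_hull R steps zeta ->
  [/\ (-oo < Lambda zeta)%E,
      (log_sum Zs (reference zeta n) / n%:R)%:E @[n --> \oo] --> Lambda zeta
    & p2p_seq Q Z T g om (beta zeta) (b zeta) @ \oo --> Lambda zeta].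
Proof.
move=> hz; have [sb bb tr] := hull_simplex hz; have [_ hb] := hbeta hz.
have [l lNy cl] := log_sum_rate_cvg Zs_gt0 long rays sb tr.
have cp := p2p_cvg hZ steps0 tame sb hb lNy cl.
have -> : Lambda zeta = l by apply: cvg_lim => //; exact: ereal_hausdorff.
by split.
Qed.

Lemma p2p_rate_unique zeta (beta' : steps -> R) (c : nat -> steps -> nat) (K : R) :
  step_hull R steps zeta ->
  simplex beta' -> barycenter beta' = zeta -> tracks beta' c K ->
  (log_sum Zs (c n) / n%:R)%:E @[n --> \oo] --> Lambda zeta.
Proof.
move=> hz sb' bb' tr'; have [sb bb tr] := hull_simplex hz.
have [lNy cl _] := p2p_rate hz.
by apply: (log_sum_rate_unique Zs_gt0 short sb sb' _ tr tr') => //; rewrite bb bb'.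
Qed.

Lemma p2p_cvg_unique zeta (beta' : steps -> R) b' : step_hull R steps zeta ->
  convex_weights zeta beta' -> admissible_rounding beta' b' ->
  p2p_seq Q Z T g om beta' b' @ \oo --> Lambda zeta.
Proof.
move=> hz /convex_simplex[sb' bb'] hb'; have [lNy _ _] := p2p_rate hz.
apply: p2p_cvg => //; exact: (p2p_rate_unique hz sb' bb' (tracks_rounded sb' hb')).
Qed.

Let A := ereal_sup [set Lambda xi | xi in rational_point R `&` step_hull R steps].
Let V := free_path_sum phi G.

Let ray_point (c : steps -> nat) : (0 < \sum_z c z)%N ->
  (rational_point R `&` step_hull R steps) (barycenter (ray_weights R c)).
Proof.
move=> c0; split; first exact: rational_barycenter_ray.
exact/simplex_convex/simplex_ray_weights.
Qed.

Let A_gtNy : (-oo < A)%E.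
Proof.
have c0 : (0 < \sum_(z : steps) 1)%N by rewrite sum1_card.
have rc := ray_point c0; have [lNy _ _] := p2p_rate rc.2.
by apply: lt_le_trans lNy _; apply: ereal_sup_ubound; exact: imageP.
Qed.

Let log_sum_le_free n (e : steps -> nat) : (\sum_z e z)%N = n ->
  log_sum Zs e / n%:R <= ln (V n) / n%:R.
Proof.
move=> en; rewrite ler_wpM2r ?invr_ge0// /log_sum.
have e0 : 0 < Zs n (lattice_point e) by rewrite -en; exact: Zs_point_gt0.
have le := path_sum_le_free phi G n (lattice_point e).
by rewrite en ler_ln// posrE//; exact: lt_le_trans le.
Qed.

Let V_gt0 n : 0 < V n.
Proof.
have [z0 _] : exists z0 : steps, true.
  by have /card_gt0P[z0 _] := steps0; exists z0.
have := Zs_gt0 (nseq n z0); rewrite size_nseq => h.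
by apply: lt_le_trans h _; exact: path_sum_le_free.
Qed.

(** The multiples of c form the subsequence of times j M of a sequence that follows the
    weights c / M, whose barycenter is a rational point of the hull. *)
Let ray_rate_le (a : R) : A = a%:E -> forall (c : steps -> nat) (l : \bar R),
  (0 < \sum_z c z)%N ->
  (log_sum Zs (fun z => (j * c z)%N) / j%:R)%:E @[j --> \oo] --> l ->
  (l <= ((\sum_z c z)%:R * a)%:E)%E.
Proof.
move=> Aa c l c0 cl; set M := (\sum_z c z)%N in c0 *.
have [z1 cz1] : exists z1, c z1 != 0%N.
  apply/existsP; rewrite -negb_forall; apply/negP => /forallP h.
  by move: c0; rewrite /M big1// => z _; exact/eqP.
have rc := ray_point c0; have [lNy _ _] := p2p_rate rc.2.
have := p2p_rate_unique rc.2 (simplex_ray_weights R c0) erefl (tracks_ray R c0 cz1).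
move=> /(cvg_comp _ _ (cvg_mulnr _ c0)) /= cM.
have : (Lambda (barycenter (ray_weights R c)) <= a%:E)%E.
  by rewrite -Aa; apply: ereal_sup_ubound; exact: imageP.
move: lNy cM; case: (Lambda _) => [r| |]// _ cM; rewrite lee_fin => ra.
have MR : 0 < M%:R :> R by rewrite ltr0n.
have cl' : (log_sum Zs (fun z => (j * c z)%N) / j%:R)%:E @[j --> \oo] -->
    (M%:R * r)%:E.
  rewrite EFinM; move: cM => /(cvgeZl (y := M%:R%:E) erefl).
  apply: cvg_trans; apply: near_eq_cvg; exists 1%N => // j /= j0.
  rewrite (ray_trackingM c0) -EFinM natrM invfM; congr (_%:E).
  by rewrite mulrCA [M%:R * _]mulrCA divff ?mulr1// gt_eqF.
have -> := cvg_unique (@ereal_hausdorff R) cl cl'.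
by rewrite lee_fin ler_pM2l.
Qed.

(** From below the free sum is compared with the sum at xhat for a nearly optimal
    rational point. From above A bounds the rates of all integer rays. *)
Lemma free_rate : (ln (V n) / n%:R)%:E @[n --> \oo] --> A.
Proof.
have lower (B : R) : (B%:E < A)%E -> \forall n \near \oo, B <= ln (V n) / n%:R.
  move=> /ereal_sup_gt[_ [xi [_ hxi] <-] Bx].
  have [_ cl _] := p2p_rate hxi; have [_ _ [tr _ _]] := hull_simplex hxi.
  have := ge_of_lt_limit cl Bx; apply: filterS => n h.
  by apply: le_trans h _; exact: log_sum_le_free.
case E : A A_gtNy => [a| |]// _; last first.
  by apply: cvg_pinfty_of_ge => B; apply: lower; rewrite E ltry.
apply: cvg_EFin_of_bounds => e e0.
have Ba : ((a - e)%:E < A)%E by rewrite E lte_fin; lra.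
have up := free_end_upper Zs_gt0 long rays V_gt0
  (fun n => free_path_sum_le phi G n steps0) (ray_rate_le E) e0.
apply: filterS2 (lower _ Ba) _; last first.
  by apply: filterI up (nbhs_infty_gt 0).
move=> n lo [hi n0]; rewrite lo /= ler_pdivrMr ?ltr0n//.
Qed.

Lemma p2p_le_free zeta : step_hull R steps zeta -> (Lambda zeta <= A)%E.
Proof.
move=> hz; have [_ cl _] := p2p_rate hz; have [_ _ [tr _ _]] := hull_simplex hz.
apply: (lee_cvg_to cl free_rate); apply: nearW => n; rewrite lee_fin.
exact: log_sum_le_free.
Qed.

Lemma free_energy_limits :
  [/\ p2l_seq Q Z T g om @ \oo --> Lambda_p2l Q Z T g om,
      (-oo < Lambda_p2l Q Z T g om)%E,
      Lambda_p2l Q Z T g om =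
        ereal_sup [set Lambda_p2p Q Z T g beta b xi om
                  | xi in rational_point R `&` step_hull R steps]
    & Lambda_p2l Q Z T g om =
        ereal_sup [set Lambda_p2p Q Z T g beta b zeta om
                  | zeta in step_hull R steps]].
Proof.
have cp := p2l_cvg hZ steps0 tame A_gtNy free_rate.
have -> : Lambda_p2l Q Z T g om = A.
  by apply: cvg_lim => //; exact: ereal_hausdorff.
split => //; apply/eqP; rewrite eq_le; apply/andP; split.
  by apply: le_ereal_sup => _ [xi [_ hxi] <-]; exists xi.
by apply: ge_ereal_sup => _ [zeta hz <-]; exact: p2p_le_free.
Qed.

End FreeEnergies.

(** The conditions are countable in number: integer vectors c, and pairs of a window
    and a step. *)
Lemma good_environment (R : realType) (d : nat) (steps : {fset 'rV[int]_d})
    (dO : measure_display) (Omega : measurableType dO) (P : probability Omega R)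
    (T : 'rV[int]_d -> Omega -> Omega) (ell : nat)
    (g : Omega -> ell.-tuple steps -> R) :
  (0 < #|{: steps}|)%N -> measurable_dynamical_system steps P T -> class_L P T g ->
  {ae P, forall om, tame_environment steps (bound T g om) /\
    forall c : steps -> nat, (0 < \sum_z c z)%N -> exists2 l : \bar R, (-oo < l)%E &
      (log_sum (partition_sum T g om) (fun z => (j * c z)%N) / j%:R)%:E
        @[j --> \oo] --> l}.
Proof.
move=> steps0 hT hg; have ig w := (hg w).1.
have rays : {ae P, forall om, forall c : {ffun steps -> nat}, (0 < \sum_z c z)%N ->
    exists2 l : \bar R, (-oo < l)%E &
      (log_sum (partition_sum T g om) (fun z => (j * c z)%N) / j%:R)%:E
        @[j --> \oo] --> l}.
  apply: ae_forall_countable => c.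
  have [c0|c0] := ltnP 0 (\sum_z c z)%N; last by apply: nearW.
  by have := ray_limit_ae hT ig steps0 c0; apply: filterS => om h _.
have tame : {ae P, forall om, forall p : ell.-tuple steps * steps, val p.2 != 0 ->
    limf_esup (fun eps : R => limn_esup (fun n : nat =>
      ereal_sup [set (n%:R^-1 * \sum_(0 <= k < (Num.truncn (eps * n%:R)).+1)
                     `|g (T (x + val p.2 *+ k) om) p.1|)%:E
                | x in [set x | lattice_span steps x /\ euclidean_norm R x <= n%:R]]))
      0^'+ = 0%E}.
  apply: ae_forall_countable => -[w z] /=.
  have [z0|z0] := eqVneq (val z) 0; first by apply: nearW => om.
  by have := (hg w).2 z z0; apply: filterS.
apply: filterS2 rays tame => om rays tame; split.
  by apply: class_L_tame (log_card_ge0 R steps0) _ => w z; exact: (tame (w, z)).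
move=> c c0; have cE : [ffun z => c z] = c :> (steps -> nat).
  by apply/funext => z; rewrite ffunE.
by have := rays [ffun z => c z]; rewrite cE; exact.
Qed.

Theorem theorem2p2 (R : realType) (d : nat) (hd : (0 < d)%N)
    (steps : {fset 'rV[int]_d}) (hS : steps != fset0)
    (dW : measure_display) (W : measurableType dW) (Q : probability W R)
    (Z : nat -> W -> steps) (hZ : iid_uniform_steps Q Z)
    (dO : measure_display) (Omega : measurableType dO)
    (P : probability Omega R) (T : 'rV[int]_d -> Omega -> Omega)
    (hT : measurable_dynamical_system steps P T)
    (beta : 'rV[R]_d -> steps -> R) (b : 'rV[R]_d -> nat -> steps -> bool)
    (hbeta : forall zeta, step_hull R steps zeta ->
       admissible_weights zeta (beta zeta) /\
       admissible_rounding (beta zeta) (b zeta))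
    (ell : nat) (g : Omega -> ell.-tuple steps -> R) (hg : class_L P T g) :
  {ae P, forall omega, forall zeta, step_hull R steps zeta ->
    [/\ p2p_seq Q Z T g omega (beta zeta) (b zeta) @ \oo -->
          Lambda_p2p Q Z T g beta b zeta omega,
        (-oo < Lambda_p2p Q Z T g beta b zeta omega)%E
      & forall (beta' : steps -> R) (b' : nat -> steps -> bool),
          admissible_weights zeta beta' -> admissible_rounding beta' b' ->
          p2p_seq Q Z T g omega beta' b' @ \oo -->
            Lambda_p2p Q Z T g beta b zeta omega]}
  /\
  {ae P, forall omega,
    [/\ p2l_seq Q Z T g omega @ \oo --> Lambda_p2l Q Z T g omega,
        (-oo < Lambda_p2l Q Z T g omega)%E,
        Lambda_p2l Q Z T g omega =
          ereal_sup [set Lambda_p2p Q Z T g beta b xi omega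
                    | xi in rational_point R `&` step_hull R steps]
      & Lambda_p2l Q Z T g omega =
          ereal_sup [set Lambda_p2p Q Z T g beta b zeta omega
                    | zeta in step_hull R steps]]}.
Proof.
have steps0 : (0 < #|{: steps}|)%N by rewrite -cardfE cardfs_gt0.
have good := good_environment steps0 hT hg.
split; apply: filterS good => om [tame rays]; last first.
  exact: (free_energy_limits hZ steps0 tame rays hbeta).
move=> zeta hzeta.
have [LNy _ cp] := p2p_rate hZ steps0 tame rays hbeta hzeta.
split => // beta' b' [cw _].
exact: (p2p_cvg_unique hZ steps0 tame rays hbeta hzeta cw).
Qed.
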